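(* Let $p$ be a prime number and let $n \ge 3$ be an integer. The spectrum of $\lambda_n$ contains the interval $\left[\frac{n+4}{3n}, + \infty\right]$. Moreover, for every real number $\lambda \ge \frac{n+4}{3n}$, we have $$\dim \{ \xi \in \mathbb{Q}_p : \lambda_n (\xi) = \lambda\} = \frac{2}{n(1 + \lambda)}.$$ In particular, for any real number $\lambda > 1/3$, there exists an integer $n_0$ such that $$\dim \{ \xi \in \mathbb{Q}_p : \lambda_n (\xi) = \lambda\} = \frac{2}{n(1 + \lambda)}$$ for any integer $n$ greater than $n_0$.
   Context: $|\cdot|_p$ is the usual $p$-adic absolute value on $\mathbb{Q}_p$, normalized by $|p|_p=p^{-1}$, and $\dim$ denotes Hausdorff dimension in $\mathbb{Q}_p$ for the metric $|x-y|_p$. For an integer $n\ge 1$ and $\xi\in\mathbb{Q}_p$, $\lambda_n(\xi)\in[-\infty,+\infty]$ denotes the supremum of the real numbers $\lambda$ such that, for arbitrarily large real numbers $X$, the inequalities $$\max\{|x_0|,\ldots,|x_n|\}\le X,\qquad 0<\max_{1\le m\le n}|x_0\xi^m-x_m|_p\le X^{-\lambda-1}$$ have a solution in integers $x_0,\ldots,x_n$. The spectrum of $\lambda_n$ is the set of values $\lambda_n(\xi)$ (possibly $+\infty$) taken at elements $\xi\in\mathbb{Q}_p$ that are transcendental over $\mathbb{Q}$. *)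

(* Defs.v *)
From HB Require Import structures.
From mathcomp Require Import all_boot all_order all_algebra.
From mathcomp Require Import all_classical all_reals all_analysis.
From mathcomp Require Import ring_quotient ring.

Set Implicit Arguments.
Unset Strict Implicit.
Unset Printing Implicit Defensive.

Import Order.TTheory GRing.Theory Num.Theory.
Import numFieldNormedType.Exports.

Local Open Scope classical_set_scope.
Local Open Scope ring_scope.

Section RationalAbsoluteValue.
Variables (R : realType) (p : nat).

(* |x|_p = p^(v_p(denominator) - v_p(numerator)). *)
Definition padic_absq (x : rat) : R :=
  if x == 0 then 0
  else p%:R ^ ((logn p `|denq x|)%:Z - (logn p `|numq x|)%:Z).

Hypothesis p_pr : prime p.
Local Notation absq := padic_absq.

Let p_gt0 : 0 < p%:R :> R.
Proof. by rewrite ltr0n prime_gt0. Qed.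

Lemma padic_absq0 : absq 0 = 0.
Proof. by rewrite /absq eqxx. Qed.

Lemma padic_absq_gt0 x : x != 0 -> 0 < absq x.
Proof. by rewrite /absq => /negPf->; rewrite exprz_gt0. Qed.

Lemma padic_absq_ge0 x : 0 <= absq x.
Proof.
have [->|/padic_absq_gt0/ltW//] := eqVneq x 0.
by rewrite padic_absq0.
Qed.

Lemma padic_absq_eq0 x : (absq x == 0) = (x == 0).
Proof.
have [->|x0] := eqVneq x 0; first by rewrite padic_absq0 eqxx.
by rewrite gt_eqF // padic_absq_gt0.
Qed.

Lemma padic_absq_frac (a b : int) : a != 0 -> b != 0 ->
  absq (a%:~R / b%:~R) = p%:R ^ ((logn p `|b|)%:Z - (logn p `|a|)%:Z).
Proof.
move=> a0 b0; set x := _ / _.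
have x0 : x != 0 by rewrite mulf_neq0 ?invr_eq0 ?intr_eq0.
rewrite /absq (negPf x0); congr (_ ^ _).
have nd : numq x * b = a * denq x.
  apply/eqP; rewrite -(eqr_int rat) !intrM numqE mulrAC.
  by rewrite {1}/x divfK ?intr_eq0.
have := congr1 (fun z : int => logn p `|z|) nd.
rewrite !abszM !lognM ?absz_gt0 ?numq_eq0 ?denq_neq0 // => e.
apply/eqP; rewrite subr_eq addrAC eq_sym subr_eq -!PoszD eqz_nat.
by rewrite [X in X == _]addnC [X in _ == X]addnC e addnC.
Qed.

Lemma padic_absqM x y : absq (x * y) = absq x * absq y.
Proof.
have [->|x0] := eqVneq x 0; first by rewrite !(mul0r, padic_absq0).
have [->|y0] := eqVneq y 0; first by rewrite !(mulr0, padic_absq0).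
have -> : x * y = (numq x * numq y)%:~R / (denq x * denq y)%:~R.
  by rewrite !intrM -{1}(divq_num_den x) -{1}(divq_num_den y) mulf_div.
rewrite padic_absq_frac ?mulf_neq0 ?numq_eq0 ?denq_neq0 //.
rewrite !abszM !lognM ?absz_gt0 ?numq_eq0 ?denq_neq0 //.
rewrite /absq (negPf x0) (negPf y0) -expfzDr ?gt_eqF //.
by congr (_ ^ _); rewrite !PoszD opprD addrACA.
Qed.

Lemma padic_absq1 : absq 1 = 1.
Proof.
have := padic_absqM 1 1; rewrite mulr1 => /esym/eqP.
rewrite -subr_eq0 -{3}[absq 1]mulr1 -mulrBr mulf_eq0 padic_absq_eq0 oner_eq0 /=.
by rewrite subr_eq0 => /eqP.
Qed.

Lemma padic_absqN x : absq (- x) = absq x.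
Proof.
have [->|x0] := eqVneq x 0; first by rewrite oppr0.
by rewrite /absq oppr_eq0 (negPf x0) numqN denqN abszN.
Qed.

Lemma padic_absqV x : absq x^-1 = (absq x)^-1.
Proof.
have [->|x0] := eqVneq x 0; first by rewrite invr0 padic_absq0 invr0.
apply: (mulfI (x := absq x)); first by rewrite padic_absq_eq0.
by rewrite -padic_absqM !divff ?padic_absq_eq0 // padic_absq1.
Qed.

Lemma padic_absq_int (z : int) : absq z%:~R <= 1.
Proof.
have [->|z0] := eqVneq z 0; first by rewrite mulr0z padic_absq0 ler01.
rewrite -[z%:~R]divr1 -[X in _ / X]/(1%:~R) padic_absq_frac //.
rewrite logn1 sub0r -exprnN invf_le1 ?exprn_gt0 //.
by rewrite exprn_ege1 // ler1n prime_gt0.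
Qed.

Let absq_1D z : absq z <= 1 -> absq (1 + z) <= 1.
Proof.
have [->|z0] := eqVneq z 0; first by rewrite addr0 padic_absq1.
have denN0 : absq (denq z)%:~R != 0 by rewrite padic_absq_eq0 intr_eq0 denq_neq0.
have numz : absq z = absq (numq z)%:~R / absq (denq z)%:~R.
  by rewrite -{1}(divq_num_den z) padic_absqM padic_absqV.
move=> z1.
have pden : ~~ (p %| `|denq z|)%N.
  apply/negP => pd.
  have pn : ~~ (p %| `|numq z|)%N.
    apply/negP => pn; have := dvdn_gcd p `|numq z| `|denq z|.
    rewrite pn pd /= (eqP (coprime_num_den z)) dvdn1 => /eqP p1.
    by move: p_pr; rewrite p1.
  have nz : logn p `|numq z| = 0%N by rewrite lognE (negPf pn) !andbF.
  have dz : (0 < logn p `|denq z|)%N.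
    by rewrite logn_gt0 mem_primes p_pr absz_gt0 denq_neq0 pd.
  move: z1; rewrite /absq (negPf z0) nz subr0 -exprnP.
  by rewrite leNgt exprn_egt1 ?ltr1n ?prime_gt1 // -lt0n dz.
have denz1 : absq (denq z)%:~R = 1.
  rewrite -[(denq z)%:~R]divr1 -[X in _ / X]/(1%:~R) padic_absq_frac ?denq_neq0 //.
  by rewrite logn1 lognE (negPf pden) !andbF subrr expr0z.
have -> : 1 + z = (denq z + numq z)%:~R / (denq z)%:~R.
  by rewrite intrD mulrDl divq_num_den divff // intr_eq0 denq_neq0.
by rewrite padic_absqM padic_absqV denz1 invr1 mulr1 padic_absq_int.
Qed.

Lemma padic_absqD x y : absq (x + y) <= Num.max (absq x) (absq y).
Proof.
wlog xy : x y / absq y <= absq x.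
  move=> H; have /orP[/H//|/H] := le_total (absq y) (absq x).
  by rewrite addrC maxC.
rewrite (max_idPl xy).
have [x0|x0] := eqVneq x 0.
  by rewrite x0 add0r -x0.
have -> : x + y = x * (1 + y / x) by rewrite mulrDr mulr1 mulrCA divff // mulr1.
rewrite padic_absqM ger_pMr ?padic_absq_gt0 //; apply: absq_1D.
by rewrite padic_absqM padic_absqV ler_pdivrMr ?padic_absq_gt0 // mul1r.
Qed.

Lemma padic_absqD_lt x y e : absq x < e -> absq y < e -> absq (x + y) < e.
Proof. by move=> xe ye; rewrite (le_lt_trans (padic_absqD x y)) // gt_max xe. Qed.

Lemma padic_absqB_lt x y e : absq x < e -> absq y < e -> absq (x - y) < e.
Proof. by move=> xe ye; rewrite padic_absqD_lt // padic_absqN. Qed.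

Lemma padic_absqB_sym x y : absq (x - y) = absq (y - x).
Proof. by rewrite -opprB padic_absqN. Qed.

Lemma padic_absq_dist x y : `|absq x - absq y| <= absq (x - y).
Proof.
wlog xy : x y / absq y <= absq x.
  move=> H; have /orP[/H//|/H] := le_total (absq y) (absq x).
  by rewrite distrC padic_absqB_sym.
rewrite ger0_norm ?subr_ge0 // lerBlDr -{1}(subrK y x).
by rewrite (le_trans (padic_absqD _ _)) // ge_max lerDl lerDr !padic_absq_ge0.
Qed.

End RationalAbsoluteValue.

Section CauchySequences.
Variables (R : realType) (p : nat) (p_pr : prime p).
Local Notation absq := (padic_absq R p).

(* The unused primality argument is needed by the algebraic instances below. *)
Definition padic_cauchy of prime p : {pred nat -> rat} := fun u =>
  `[< forall e : R, 0 < e -> exists N, forall m n, (N <= m)%N -> (N <= n)%N ->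
        absq (u m - u n) < e >].

Lemma padic_cauchyP (u : nat -> rat) :
  reflect (forall e : R, 0 < e -> exists N, forall m n,
             (N <= m)%N -> (N <= n)%N -> absq (u m - u n) < e)
          (u \in padic_cauchy p_pr).
Proof. exact: asboolP. Qed.

Lemma padic_cauchy_bounded u : u \in padic_cauchy p_pr ->
  exists2 M : R, 0 < M & exists N, forall n, (N <= n)%N -> absq (u n) <= M.
Proof.
move=> /padic_cauchyP/(_ _ ltr01)[N uN].
exists (Num.max 1 (absq (u N))); first by rewrite lt_max ltr01.
exists N => n Nn; rewrite -(subrK (u N) (u n)).
apply: le_trans (padic_absqD R p_pr _ _) _.
by rewrite ge_max !le_max lexx orbT (ltW (uN _ _ Nn (leqnn N))).
Qed.

Fact padic_cauchy_subring : subring_closed (padic_cauchy p_pr).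
Proof.
split.
- apply/padic_cauchyP => e e0; exists 0%N => m n _ _.
  by rewrite [_ - _]subrr padic_absq0.
- move=> u v /padic_cauchyP cu /padic_cauchyP cv.
  apply/padic_cauchyP => e e0; have [N uN] := cu e e0; have [M vM] := cv e e0.
  exists (maxn N M) => m n; rewrite !geq_max => /andP[Nm Mm] /andP[Nn Mn].
  have -> : (u - v) m - (u - v) n = (u m - u n) - (v m - v n).
    by rewrite -[(u - v) m]/(u m - v m) -[(u - v) n]/(u n - v n); ring.
  by rewrite padic_absqB_lt ?uN ?vM.
- move=> u v cu cv; apply/padic_cauchyP => e e0.
  have [A A0 [N1 uA]] := padic_cauchy_bounded cu.
  have [B B0 [N2 vB]] := padic_cauchy_bounded cv.
  move/padic_cauchyP/(_ (e / B) (divr_gt0 e0 B0)) : cu => [N3 uN].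
  move/padic_cauchyP/(_ (e / A) (divr_gt0 e0 A0)) : cv => [N4 vN].
  exists (maxn (maxn N1 N2) (maxn N3 N4)) => m n.
  rewrite !geq_max => /andP[/andP[m1 m2] /andP[m3 m4]].
  move=> /andP[/andP[n1 n2] /andP[n3 n4]].
  have -> : (u * v) m - (u * v) n = u m * (v m - v n) + (u m - u n) * v n.
    by rewrite -[(u * v) m]/(u m * v m) -[(u * v) n]/(u n * v n); ring.
  apply: padic_absqD_lt => //; rewrite padic_absqM //.
  + rewrite (le_lt_trans (ler_wpM2r _ (uA _ m1))) ?padic_absq_ge0 //.
    by rewrite mulrC -ltr_pdivlMr // vN.
  + rewrite (le_lt_trans (ler_wpM2l _ (vB _ n2))) ?padic_absq_ge0 //.
    by rewrite -ltr_pdivlMr // uN.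
Qed.

HB.instance Definition _ :=
  GRing.isSubringClosed.Build (nat -> rat) (padic_cauchy p_pr)
    padic_cauchy_subring.

Record padic_cauchy_seq := PadicCauchySeq {
  padic_cauchy_val :> nat -> rat;
  padic_cauchy_valP : padic_cauchy_val \in padic_cauchy p_pr }.

HB.instance Definition _ := [isSub for padic_cauchy_val].
HB.instance Definition _ := [Choice of padic_cauchy_seq by <:].
HB.instance Definition _ := [SubChoice_isSubComNzRing of padic_cauchy_seq by <:].

Definition padic_null : {pred padic_cauchy_seq} := fun u =>
  `[< forall e : R, 0 < e ->
        exists N, forall n, (N <= n)%N -> absq (u n) < e >].

Lemma padic_nullP (u : padic_cauchy_seq) :
  reflect (forall e : R, 0 < e ->
             exists N, forall n, (N <= n)%N -> absq (u n) < e)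
          (u \in padic_null).
Proof. exact: asboolP. Qed.

Fact padic_null_idealr : idealr_closed padic_null.
Proof.
split.
- by apply/padic_nullP => e e0; exists 0%N => n _; rewrite padic_absq0.
- apply/padic_nullP => /(_ 1 ltr01)[N /(_ _ (leqnn N))].
  by rewrite padic_absq1 // ltxx.
- move=> a u v /padic_nullP u0 /padic_nullP v0; apply/padic_nullP => e e0.
  have [A A0 [N1 aA]] := padic_cauchy_bounded (padic_cauchy_valP a).
  have [N2 uN] := u0 _ (divr_gt0 e0 A0); have [N3 vN] := v0 _ e0.
  exists (maxn N1 (maxn N2 N3)) => n; rewrite !geq_max => /and3P[n1 n2 n3].
  apply: padic_absqD_lt => //; last exact: vN.
  rewrite padic_absqM // (le_lt_trans (ler_wpM2r _ (aA _ n1))) ?padic_absq_ge0 //.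
  by rewrite mulrC -ltr_pdivlMr // uN.
Qed.

HB.instance Definition _ :=
  isIdealr.Build padic_cauchy_seq padic_null padic_null_idealr.

Lemma padic_non_null (u : padic_cauchy_seq) : u \notin padic_null ->
  exists2 c : R, 0 < c & exists N, forall n, (N <= n)%N -> absq (u n) = c.
Proof.
move=> u0; have [e e0 ue] : exists2 e : R, 0 < e &
    forall N, exists2 n, (N <= n)%N & e <= absq (u n).
  apply: contrapT => H; move/negP: u0; apply; apply/padic_nullP => e e0.
  apply: contrapT => H1; apply: H; exists e => // N.
  apply: contrapT => H2; apply: H1; exists N => n Nn.
  by rewrite ltNge; apply/negP => H3; apply: H2; exists n.
have /padic_cauchyP/(_ e e0)[N uN] := padic_cauchy_valP u.
have [n0 Nn0 un0] := ue N.
exists (absq (u n0)); first exact: lt_le_trans un0.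
exists N => n Nn; apply/eqP; rewrite eq_le.
have d : absq (u n - u n0) < absq (u n0) by rewrite (lt_le_trans _ un0) ?uN.
have le1 : absq (u n) <= absq (u n0).
  rewrite -{1}(subrK (u n0) (u n)) (le_trans (padic_absqD _ _ _ _)) //.
  by rewrite ge_max lexx ltW.
rewrite le1 /= leNgt; apply/negP => lt1.
have := padic_absqB_lt p_pr lt1 d.
by rewrite opprB addrC subrK ltxx.
Qed.

End CauchySequences.

(* The completion of rat for the p-adic absolute value: Cauchy sequences modulo
   null sequences.  The type R of real numbers only serves as the codomain of
   absolute values and distances. *)
Definition Qp (R : realType) (p : nat) (p_pr : prime p) : Type :=
  {ideal_quot (@padic_null R p p_pr)}.

Section PadicField.
Variables (R : realType) (p : nat) (p_pr : prime p).
Local Notation absq := (padic_absq R p).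
Local Notation Qp := (@Qp R p p_pr).
Local Open Scope quotient_scope.

HB.instance Definition _ := GRing.ComNzRing.on Qp.
HB.instance Definition _ := EqQuotient.on Qp.
HB.instance Definition _ := NzRingQuotient.on Qp.

Lemma padic_pi_eq (u v : padic_cauchy_seq R p_pr) :
  (\pi_Qp u == \pi_Qp v) = (u - v \in @padic_null R p p_pr).
Proof. by rewrite Quotient.idealrBE. Qed.

Lemma padic_repr_eq0 (x : Qp) :
  (x == 0) = (repr x \in @padic_null R p p_pr).
Proof.
rewrite -[repr x]subr0 -padic_pi_eq reprK.
by congr (x == _); rewrite pi_zeror.
Qed.

Fact padic_inv_cauchy (u : padic_cauchy_seq R p_pr) :
  u \notin @padic_null R p p_pr ->
  (fun n => (u n)^-1) \in @padic_cauchy R p p_pr.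
Proof.
move=> /padic_non_null[c c0 [N1 uc]].
apply/padic_cauchyP => e e0.
have /padic_cauchyP/(_ (e * c * c))[|N2 uN] := padic_cauchy_valP u.
  by rewrite !mulr_gt0.
exists (maxn N1 N2) => m n; rewrite !geq_max => /andP[m1 m2] /andP[n1 n2].
have um0 : u m != 0 by rewrite -(padic_absq_eq0 R p_pr) uc ?gt_eqF.
have un0 : u n != 0 by rewrite -(padic_absq_eq0 R p_pr) uc ?gt_eqF.
have -> : (u m)^-1 - (u n)^-1 = (u n - u m) / u m / u n.
  by field; rewrite um0 un0.
by rewrite !(padic_absqM, padic_absqV) // !uc // !ltr_pdivrMr // uN.
Qed.

(* The representative of 0 may have nonzero terms, whence the case analysis.
   The default value 0 of insubd is never used, by padic_inv_cauchy. *)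
Definition padic_inv (x : Qp) : Qp :=
  if x == 0 then 0
  else \pi_Qp (insubd (0 : padic_cauchy_seq R p_pr) (fun n => (repr x n)^-1)).

Fact padic_mulVf (x : Qp) : x != 0 -> padic_inv x * x = 1.
Proof.
move=> x0; rewrite /padic_inv (negPf x0) -{2}[x]reprK.
rewrite -[X in _ = X](@pi_oner _ _ _ _ _ _ _ Qp).
move: x0; rewrite padic_repr_eq0; set u := repr x => u0.
rewrite -pi_mulr; apply/eqP; rewrite padic_pi_eq.
have [c c0 [N uc]] := padic_non_null u0.
apply/padic_nullP => e e0; exists N => n Nn.
rewrite -[X in padic_absq _ _ X]/(val (insubd _ _) n * u n - 1) insubdK ?padic_inv_cauchy //.
by rewrite mulVf ?subrr ?padic_absq0 // -(padic_absq_eq0 R p_pr) uc ?gt_eqF.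
Qed.

Fact padic_inv0 : padic_inv 0 = 0.
Proof. by rewrite /padic_inv eqxx. Qed.

HB.instance Definition _ :=
  GRing.ComNzRing_isField.Build Qp padic_mulVf padic_inv0.

(* Independent of the chosen representative, by padic_abs_pi below. *)
Definition padic_abs (x : Qp) : R := lim (absq (repr x n) @[n --> \oo]).

Lemma padic_absq_cvg (u : padic_cauchy_seq R p_pr) :
  cvgn (fun n => absq (u n)).
Proof.
have [u0|/padic_non_null[c c0 [N uc]]] := boolP (u \in @padic_null R p p_pr).
  apply/cvg_ex; exists 0; apply/cvgrPdist_lt => e e0.
  have [N uN] := padic_nullP _ u0 _ e0.
  exists N => // n /= Nn; rewrite sub0r normrN ger0_norm ?padic_absq_ge0 //.
  exact: uN.
apply/cvg_ex; exists c; apply/cvgrPdist_lt => e e0.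
by exists N => // n /= Nn; rewrite uc // subrr normr0.
Qed.

Lemma padic_abs_pi (u : padic_cauchy_seq R p_pr) :
  absq (u n) @[n --> \oo] --> padic_abs (\pi_Qp u).
Proof.
have : repr (\pi_Qp u) - u \in @padic_null R p p_pr.
  by rewrite -padic_pi_eq reprK.
rewrite /padic_abs; set v := repr _ => /padic_nullP vu.
have /cvgrPdist_lt cv : absq (v n) @[n --> \oo] --> lim (absq (v n) @[n --> \oo]).
  exact: padic_absq_cvg.
apply/cvgrPdist_lt => e e0.
have [N1 _ vN] := cv _ (divr_gt0 e0 (ltr0Sn _ 1)).
have [N2 uvN] := vu _ (divr_gt0 e0 (ltr0Sn _ 1)).
exists (maxn N1 N2) => // n /=; rewrite geq_max => /andP[n1 n2].
rewrite [e]splitr (le_lt_trans (ler_distD (absq (v n)) _ _)) // ltrD ?vN //.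
by rewrite (le_lt_trans (padic_absq_dist _ p_pr _ _)) // uvN.
Qed.

Lemma padic_abs_cst (q : rat) (u : padic_cauchy_seq R p_pr) :
  (forall n, u n = q) -> padic_abs (\pi_Qp u) = absq q.
Proof.
move=> uq; rewrite -(cvg_lim (@Rhausdorff R) (@padic_abs_pi u)).
apply: cvg_lim; first exact: Rhausdorff.
by under eq_fun do rewrite uq; exact: cvg_cst.
Qed.

Lemma padic_absM (x y : Qp) : padic_abs (x * y) = padic_abs x * padic_abs y.
Proof.
rewrite -[x]reprK -[y]reprK -pi_mulr.
rewrite -(cvg_lim (@Rhausdorff R) (@padic_abs_pi _)).
apply: cvg_lim; first exact: Rhausdorff.
under eq_fun do rewrite padic_absqM //.
by apply: cvgM; exact: padic_abs_pi.
Qed.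

Lemma padic_abs_ge0 (x : Qp) : 0 <= padic_abs x.
Proof.
apply: limr_ge; first exact: padic_absq_cvg.
by apply: nearW => n; exact: padic_absq_ge0.
Qed.

Lemma padic_abs0 : padic_abs 0 = 0.
Proof.
rewrite -[X in padic_abs X](@pi_zeror _ _ _ _ _ Qp).
by rewrite (@padic_abs_cst 0) ?padic_absq0.
Qed.

Lemma padic_abs_ratr (q : rat) : padic_abs (ratr q) = absq q.
Proof.
have abs_int (z : int) : padic_abs z%:~R = absq z%:~R.
  have -> : z%:~R = \pi_Qp (z%:~R) by rewrite rmorph_int.
  apply: padic_abs_cst => n.
  have val_nat k : (k%:R : padic_cauchy_seq R p_pr) n = k%:R.
    by elim: k => // k IHk; rewrite !mulrSr -IHk.
  by case: z => k; [exact: val_nat | exact: (congr1 -%R (val_nat k.+1))].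
have den0 : padic_abs (denq q)%:~R != 0.
  by rewrite abs_int padic_absq_eq0 // intr_eq0 denq_neq0.
have den0' : (denq q)%:~R != 0 :> Qp.
  by apply: contraNneq den0 => d0; rewrite d0 padic_abs0.
apply: (mulIf den0); rewrite -padic_absM {1}/ratr divfK // !abs_int.
by rewrite -padic_absqM // numqE.
Qed.

Lemma padic_abs0_eq0 (x : Qp) : padic_abs x = 0 -> x = 0.
Proof.
move=> ax; apply/eqP; rewrite padic_repr_eq0; apply/padic_nullP => e e0.
have /cvgrPdist_lt/(_ e e0)[N _ xN] := @padic_abs_pi (repr x).
exists N => n /xN; rewrite reprK ax sub0r normrN ger0_norm //.
exact: padic_absq_ge0.
Qed.

Lemma padic_absN (x : Qp) : padic_abs (- x) = padic_abs x.
Proof.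
rewrite -[x]reprK -pi_oppr.
rewrite -(cvg_lim (@Rhausdorff R) (@padic_abs_pi _)).
apply: cvg_lim; first exact: Rhausdorff.
under eq_fun do rewrite padic_absqN //.
exact: padic_abs_pi.
Qed.

Lemma padic_absD (x y : Qp) :
  padic_abs (x + y) <= Num.max (padic_abs x) (padic_abs y).
Proof.
rewrite -[x]reprK -[y]reprK -pi_addr.
have xy : Num.max (absq (repr x n)) (absq (repr y n)) @[n --> \oo] -->
    Num.max (padic_abs (\pi_Qp (repr x))) (padic_abs (\pi_Qp (repr y))).
  rewrite maxr_absE; under eq_fun do rewrite maxr_absE.
  apply: cvgM; last exact: cvg_cst.
  apply: cvgD; last apply: cvg_norm.
    by apply: cvgD; exact: padic_abs_pi.
  by apply: cvgB; exact: padic_abs_pi.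
apply: (ler_cvg_to (@padic_abs_pi _) xy).
by apply: nearW => n; exact: padic_absqD.
Qed.

Definition padic_dist (x y : Qp) : R := padic_abs (x - y).

Fact padic_distxx (x : Qp) : padic_dist x x = 0.
Proof. by rewrite /padic_dist subrr padic_abs0. Qed.

Fact padic_dist0_eq (x y : Qp) : padic_dist x y = 0 -> x = y.
Proof. by move=> /padic_abs0_eq0/eqP; rewrite subr_eq0 => /eqP. Qed.

Fact padic_dist_sym (x y : Qp) : padic_dist x y = padic_dist y x.
Proof. by rewrite /padic_dist -opprB padic_absN. Qed.

Fact padic_dist_triangle (y x z : Qp) :
  padic_dist x z <= padic_dist x y + padic_dist y z.
Proof.
have -> : padic_dist x z = padic_abs ((x - y) + (y - z)).
  by rewrite /padic_dist addrA subrK.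
rewrite (le_trans (padic_absD _ _)) // ge_max lerDl lerDr.
by rewrite !padic_abs_ge0.
Qed.

HB.instance Definition _ := isMetric.Build R Qp
  padic_distxx padic_dist0_eq padic_dist_sym padic_dist_triangle.

End PadicField.

Section Hausdorff.
Variables (R : realType) (T : metricType R).
Local Open Scope ereal_scope.

Definition diameter (U : set T) : \bar R :=
  ereal_sup [set (mdist x y)%:E | x in U & y in U].

(* diam(U)^s, with the conventions diam(set0)^s = 0, and 0^0 = 1 otherwise. *)
Definition diameter_pow (s : R) (U : set T) : \bar R :=
  if U == set0 then 0 else poweR (diameter U) s.

Definition hausdorff_premeasure (s delta : R) (A : set T) : \bar R :=
  ereal_inf [set \sum_(0 <= i <oo) diameter_pow s (U i) |
    U in [set U : nat -> set T |
      A `<=` \bigcup_i U i /\ forall i, diameter (U i) <= delta%:E]].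

Definition hausdorff_measure (s : R) (A : set T) : \bar R :=
  ereal_sup [set hausdorff_premeasure s delta A |
    delta in [set delta | (0 < delta)%R]].

Definition hausdorff_dim (A : set T) : \bar R :=
  ereal_inf [set s%:E | s in [set s | (0 <= s)%R /\ hausdorff_measure s A = 0]].

End Hausdorff.

Section Exponent.
Variables (R : realType) (p : nat) (p_pr : prime p) (n : nat).

Definition padic_approximable (xi : Qp R p_pr) (lambda : R) : Prop :=
  forall X0 : R, exists2 X : R, X0 <= X &
  exists x : 'I_n.+1 -> int,
    (\big[Num.max/0]_(i < n.+1) `|x i|)%:~R <= X /\
    0 < \big[Num.max/0]_(m < n)
          padic_abs ((x ord0)%:~R * xi ^+ m.+1 - (x (lift ord0 m))%:~R)
      <= X `^ (- lambda - 1).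

(* The supremum is -oo when no real lambda qualifies. *)
Definition lambda_exp (xi : Qp R p_pr) : \bar R :=
  ereal_sup [set lambda%:E | lambda in padic_approximable xi].

Definition transcendental_padic (xi : Qp R p_pr) : Prop :=
  ~ algebraicOver (@ratr (Qp R p_pr)) xi.

Definition lambda_spectrum : set (\bar R) :=
  [set lambda_exp xi | xi in transcendental_padic].

End Exponent.

Arguments lambda_spectrum R {p} p_pr n _.

(* Main.v *)
Require Import Defs.
From mathcomp Require Import all_boot all_order all_fingroup all_algebra.
From mathcomp Require Import all_classical all_reals all_analysis.
From mathcomp Require Import zify ring lra.
From mathcomp.real_closed Require polyorder.

Set Implicit Arguments.
Unset Strict Implicit.
Unset Printing Implicit Defensive.

Import Order.TTheory GRing.Theory Num.Theory.
Import numFieldNormedType.Exports.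

(** Write [T = n (1 + lambda)] and [d = 2 / T]. The proof replaces Hausdorff
    measures by null sets: [E] is [s]-null if for every [eta > 0] it has a
    countable cover by balls of radii [r_i] with [sum r_i^s <= eta]
    ([hausdorff_null], [null_hausdorff]).

    Upper bound ([approximable_null]): for [s > d], the points approximable with
    some exponent slightly below [lambda] form an [s]-null set. Let [x_0, .., x_n]
    be an approximation to [xi] with [x_0] a unit, of height [X] and error
    [p^(-e)], where [p^e] is about [X^(1 + lambda)]. Then [x_i = x_0 z^i] modulo
    [p^e] for an integer [z] close to [xi]. A linear recurrence of least order [k]
    satisfied by the [x_i] has a characteristic polynomial [P] that vanishes at
    [z] modulo [p^e], so that [P(xi)] is small; a pigeonhole argument on the
    Hankel matrix of [x] bounds both [k] and the height of [P]
    ([hankel_recurrence]). As [lambda > 1/3], the degree [k] is at most 3, and with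
    [s' = d] the height is at most about [p^(e s' / 2)], [p^(e s' / 3)],
    [p^(e s' / 6)] for [k = 1, 2, 3]; for [k = 2] this is exactly the hypothesis
    [lambda >= (n + 4) / (3 n)]. It remains to cover the points where some
    polynomial of bounded height is small. A primitive [P] of degree [k] is small
    only on [k] balls of radius about [p^(-e) / |P'(xi)|] ([cover_poly]). In degree
    1 the derivative is a unit; in degree 2 its square is the discriminant, whose
    valuation is small on average; in degree 3 a small derivative forces a small,
    hence zero, resultant. Polynomials with a multiple root have rational linear
    factors and reduce to degree 1. Heights and radii fit together so that the
    covers for different [e] form a convergent series ([null_small_value_set]).

    Lower bound ([rational_approximations_not_null]): the points that have
    infinitely many rational approximations [a / b] of height [H] with
    [|b xi - a| <= H^(-T')], for all [T' < T], do not form a [d]-null set. Given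
    balls of small total mass, a point outside all of them is found in nested
    balls: inside a ball of radius [p^(-m)], the balls of radius about
    [p^(-m - g T)] around fractions of height [p^(m + g)] number about [p^(2 g)],
    and on average they meet the given balls in the right proportion. If
    [b xi - a] is small then so is the error of [(b^n, b^(n-1) a, .., a^n)], of
    height [H^n], and so [lambda_n(xi) >= lambda]. The points with
    [lambda_n(xi) > lambda] are [d]-null by the upper bound, and the algebraic
    points are countable. Hence transcendental points with [lambda_n(xi) = lambda]
    exist and are not [d]-null ([exists_lambda_exp]). The value [+oo] is attained
    at a limit of integers that converge fast enough ([exists_lambda_exp_oo]). *)

Local Open Scope ring_scope.

(** * Short vectors in the kernel of a Hankel matrix *)

(** Round down the coordinates of [w] in the basis of the rows of [U]: a
    combination of these rows with coefficients in [0, 1) remains. *)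
Lemma reduce_mod_rows (k : nat) (U : 'M[int]_k) (X : int) :
  map_mx (intr : int -> rat) U \in unitmx -> (forall i j, `|U i j| <= X) ->
  forall w : 'rV[int]_k, exists c : 'rV[int]_k,
    forall j, `|(w - c *m U) 0 j| <= k%:Z * X.
Proof.
move=> Uu UX w; pose d := map_mx (intr : int -> rat) w *m invmx (map_mx intr U).
exists (\row_i Num.floor (d 0 i)) => j.
have -> : (w - (\row_i Num.floor (d 0 i)) *m U) 0 j =
    w 0 j - \sum_i Num.floor (d 0 i) * U i j.
  by rewrite !mxE; congr (_ - _); apply: eq_bigr => i _; rewrite mxE.
rewrite -(ler_int rat) intr_norm rmorphB rmorph_sum /=.
have -> : (w 0 j)%:~R = \sum_i d 0 i * (U i j)%:~R.
  have : d *m map_mx intr U = map_mx intr w by rewrite /d mulmxKV.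
  move/matrixP => /(_ 0 j); rewrite !mxE => <-.
  by apply: eq_bigr => i _; rewrite !mxE.
rewrite -sumrB (le_trans (ler_norm_sum _ _ _)) //.
apply: le_trans (_ : \sum_(i < k) X%:~R <= _); last first.
  by rewrite sumr_const card_ord rmorphM /= mulr_natl.
apply: ler_sum => i _; rewrite rmorphM -mulrBl normrM -[leRHS]mul1r.
apply: ler_pM => //; last by rewrite -intr_norm ler_int UX.
have /andP[fl fu] := floor_itv (d 0 i).
by move: fu; rewrite intrD ger0_norm ?subr_ge0 // => fu; lra.
Qed.

Lemma ffun_pigeonhole (S : finType) (k B : nat) (v : S -> 'I_k -> int) :
  (forall s j, `|v s j| <= B%:Z) -> ((2 * B + 1) ^ k < #|S|)%N ->
  exists s t, s != t /\ forall j, v s j = v t j.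
Proof.
move=> vB cS.
pose f (s : S) := [ffun j : 'I_k => inord `|v s j + B%:Z| : 'I_(2 * B).+1].
have : ~~ injectiveb f.
  apply/negP => /injectiveP/leq_card; rewrite card_ffun !card_ord -addn1.
  by rewrite leqNgt cS.
case/injectivePn => s [t st fst]; exists s, t; split=> // j.
have /ffunP/(_ j) := fst; rewrite !ffunE => /(congr1 val) /=.
have := vB s j; have := vB t j => ht hs.
rewrite !inordK; lia.
Qed.

(** Pigeonhole in a twisted form. The combinations of the rows of the Hankel
    matrix all lie in the lattice of the [v] with [v_j = v_0 z^j] modulo [q], of
    index [q^k] in [Z^(k+1)]. Adding a representative of each coset of the lattice,
    made short by [reduce_mod_rows], gives as many short vectors as there are pairs
    of a combination and a coset, and two of them that coincide belong to the same
    coset. This gains the factor [q^k] over Siegel's lemma. *)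
Lemma hankel_siegel (k m : nat) (x : nat -> int) (z : int) (q X h : nat) :
  (0 < q)%N ->
  (forall i, (i <= m + k)%N -> `|x i| <= X%:Z) ->
  (forall i, (i <= m + k)%N -> (q%:Z %| x i - x 0%N * z ^+ i)%Z) ->
  (forall c : 'cV[rat]_k.+1,
     (\matrix_(i < m.+1, j < k.+1) (x (i + j)%N)%:~R) *m c = 0 -> c = 0) ->
  ((2 * ((m.+1 * h + k.+1) * X) + 1) ^ k.+1 < h.+1 ^ m.+1 * q ^ k)%N ->
  exists a : 'I_m.+1 -> int,
    [/\ exists i, a i != 0, forall i, `|a i| <= h%:Z &
        forall j, (j <= k)%N -> \sum_i a i * x (i + j)%N = 0].
Proof.
move=> q0 xX xz rk big.
set M := \matrix_(_, _) _ in rk.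
have Mfull : row_full M.
  rewrite /row_full -mxrank_tr -/(row_free M^T) -kermx_eq0.
  apply/eqP/row_matrixP => i; rewrite row0.
  apply: trmx_inj; rewrite trmx0; apply: rk.
  apply: trmx_inj; rewrite trmx_mul trmx0 trmxK.
  by apply/sub_kermxP; rewrite row_sub.
pose f := fullrankfun Mfull.
pose U : 'M[int]_k.+1 := \matrix_(i, j) x (f i + j)%N.
have Uu : map_mx (intr : int -> rat) U \in unitmx.
  suff -> : map_mx intr U = rowsub f M by exact: fullrowsub_unit.
  by apply/matrixP => i j; rewrite !mxE.
have fle (i j : 'I_k.+1) : (f i + j <= m + k)%N.
  by rewrite leq_add // -ltnS ltn_ord.
have UX i j : `|U i j| <= X%:Z by rewrite mxE xX.
pose w (y : {ffun 'I_k -> 'I_q}) : 'rV[int]_k.+1 :=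
  \row_j if unlift ord0 j is Some i then (y i)%:Z else 0.
have /fin_all_exists [c cP] : forall y : {ffun 'I_k -> 'I_q}, exists c : 'rV[int]_k.+1,
    forall j, `|(w y - c *m U) 0 j| <= k.+1%:Z * X%:Z.
  by move=> y; exact: (reduce_mod_rows Uu UX (w y)).
pose phi (A : {ffun 'I_m.+1 -> 'I_h.+1}) j := \sum_i (A i)%:Z * x (i + j)%N.
pose v (s : {ffun 'I_m.+1 -> 'I_h.+1} * {ffun 'I_k -> 'I_q}) (j : 'I_k.+1) : int :=
  phi s.1 j + (w s.2 - c s.2 *m U) 0 j.
have vB s j : `|v s j| <= ((m.+1 * h + k.+1) * X)%N%:Z.
  rewrite /v (le_trans (ler_normD _ _)) // mulnDl PoszD lerD //.
  rewrite (le_trans (ler_norm_sum _ _ _)) //.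
  apply: le_trans (_ : \sum_(i < m.+1) (h%:Z * X%:Z) <= _); last first.
    by rewrite sumr_const card_ord -mulr_natl natz -!PoszM mulnA.
  apply: ler_sum => i _; rewrite normrM ler_pM ?normr_ge0 //.
    by rewrite ger0_norm // lez_nat -ltnS.
  by rewrite xX // leq_add // -ltnS.
have [|[A y] [[A' y'] [neq eqv]]] := ffun_pigeonhole vB.
  by rewrite card_prod !card_ffun !card_ord.
pose D (u : 'rV[int]_k.+1) (j : 'I_k.+1) := u 0 j - u 0 ord0 * z ^+ j.
have DB u u' j : D (u - u') j = D u j - D u' j by rewrite /D !mxE; ring.
have Dx i (j : 'I_k.+1) : (i <= m)%N -> (q%:Z %| x (i + j)%N - x i * z ^+ j)%Z.
  move=> im; have -> : x (i + j)%N - x i * z ^+ j =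
     (x (i + j)%N - x 0%N * z ^+ (i + j)) - (x i - x 0%N * z ^+ i) * z ^+ j.
    by rewrite exprD; ring.
  rewrite rpredB ?dvdz_mulr // xz //; last by rewrite (leq_trans im) ?leq_addr.
  by rewrite leq_add // -ltnS.
have Dphi (B : {ffun 'I_m.+1 -> 'I_h.+1}) (j : 'I_k.+1) :
    (q%:Z %| phi B j - phi B 0%N * z ^+ j)%Z.
  rewrite /phi mulr_suml -sumrB big_seq; apply: rpred_sum => i _.
  by rewrite addn0 -mulrA -mulrBr dvdz_mull // Dx // -ltnS.
have DU (b : 'rV[int]_k.+1) j : (q%:Z %| D (b *m U) j)%Z.
  rewrite /D !mxE mulr_suml -sumrB big_seq; apply: rpred_sum => i _.
  by rewrite !mxE addn0 -mulrA -mulrBr dvdz_mull // Dx // -ltnS.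
have Dv A0 y0 (j : 'I_k.+1) :
    (q%:Z %| v (A0, y0) j - v (A0, y0) ord0 * z ^+ j - D (w y0) j)%Z.
  have -> : v (A0, y0) j - v (A0, y0) ord0 * z ^+ j - D (w y0) j =
    (phi A0 j - phi A0 0%N * z ^+ j) - D (c y0 *m U) j.
    rewrite /v /D /=.
    have ME (a b : 'rV[int]_k.+1) l : (a - b) 0 l = a 0 l - b 0 l by rewrite !mxE.
    by rewrite !ME; ring.
  by rewrite rpredB.
have yy' : y = y'.
  apply/ffunP => i; apply/val_inj.
  have : (q%:Z %| D (w y) (lift ord0 i) - D (w y') (lift ord0 i))%Z.
    have := rpredB (Dv A' y' (lift ord0 i)) (Dv A y (lift ord0 i)).
    rewrite eqv (eqv ord0) opprB addrC addrA.
    by congr (_ %| _)%Z; ring.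
  rewrite /D !mxE liftK unlift_none !mul0r !subr0 /=.
  rewrite -eqz_mod_dvd => /eqP; rewrite !modz_nat => -[].
  by rewrite !modn_small.
exists (fun i => (A i)%:Z - (A' i)%:Z); split.
- have AA' : A != A' by move: neq; rewrite yy' xpair_eqE eqxx andbT.
  case: (pickP (fun i => A i != A' i)) => [i Ai|AE]; last first.
    by case/eqP: AA'; apply/ffunP => i; have /negbFE/eqP := AE i.
  by exists i; rewrite subr_eq0 eqz_nat.
- by move=> i; have := ltn_ord (A i); have := ltn_ord (A' i); lia.
- move=> j jk; have := eqv (inord j); rewrite /v yy' /= => /addIr.
  rewrite /phi inordK // => e.
  by under eq_bigr do rewrite mulrBl; rewrite sumrB e subrr.
Qed.

(** * Heights of factors of integer polynomials *)

(** [|P(t)| <= |(P Q)(t)|] at every integer [t] that is not a root of [P Q];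
    interpolation at [K] such points among [0, .., 2 K - 1] bounds [P]. *)
Lemma int_factor_height (K : nat) : exists C : nat, (0 < C)%N /\
  forall (P Q : {poly int}) (h : nat), P * Q != 0 ->
    (size P <= K)%N -> (size (P * Q)%R <= K)%N ->
    (forall i, `|(P * Q)`_i| <= h%:Z) -> forall i, `|P`_i| <= (C * h)%N%:Z.
Proof.
pose a (t : {ffun 'I_K -> 'I_(2 * K)}) : 'rV[rat]_K := \row_j (t j)%:R.
pose V t := Vandermonde K (a t).
pose C0 : rat := \sum_t \sum_i \sum_j `|invmx (V t) i j|.
pose D : nat := (K * (2 * K) ^ K)%N.
exists (Num.truncn (C0 * D%:R)).+1; split=> // P Q h PQ0 sP sPQ PQh i.
have [iK|Ki] := ltnP i K; last first.
  by rewrite nth_default ?normr0 // (leq_trans sP).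
pose A := P * Q.
have Ah t : (t < 2 * K)%N -> `|A.[t%:R]| <= (D * h)%N%:Z.
  move=> tK; rewrite (horner_coef_wide _ sPQ) (le_trans (ler_norm_sum _ _ _)) //.
  apply: le_trans (_ : \sum_(j < K) (h%:Z * ((2 * K) ^ K)%N%:Z) <= _).
    apply: ler_sum => j _; rewrite normrM ler_pM //.
    rewrite normrX normr_nat -natrX natz lez_nat.
    have jK := ltn_ord j; apply: (@leq_trans ((2 * K) ^ j)%N).
      by case: (posnP j) => [->//|j0]; rewrite leq_exp2r // ltnW.
    by rewrite leq_pexp2l; lia.
  rewrite sumr_const card_ord -mulr_natl natz -!PoszM lez_nat /D.
  by rewrite leq_eqVlt; apply/orP; left; apply/eqP; ring.
have [t tinj At] : exists2 t : {ffun 'I_K -> 'I_(2 * K)}, injective t &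
    forall j, A.[(t j)%:R] != 0.
  pose G := [pred j : 'I_(2 * K) | A.[(nat_of_ord j)%:R] != 0].
  have cG : (K <= #|G|)%N.
    have : (#|[predC G]| < K)%N.
      rewrite cardE; have := max_poly_roots PQ0.
      move=> /(_ [seq (nat_of_ord j)%:R | j <- enum [predC G]]).
      rewrite size_map => R; apply: leq_trans (R _ _) sPQ.
        apply/allP => _ /mapP[j + ->]; rewrite mem_enum !inE negbK => /eqP jr.
        exact/rootP.
      rewrite map_inj_uniq ?enum_uniq // => j l /eqP.
      by rewrite eqr_nat => /eqP/val_inj.
    move=> cC; rewrite -(leq_add2r #|[predC G]|) cardC card_ord.
    by rewrite [leqRHS]mul2n -addnn leq_add2l ltnW.
  exists [ffun j : 'I_K => enum_val (widen_ord cG j)].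
    by move=> j l; rewrite !ffunE => /enum_val_inj/(congr1 val)/=/val_inj.
  by move=> j; rewrite ffunE; have := enum_valP (widen_ord cG j); rewrite inE.
have Vu : V t \in unitmx.
  rewrite unitmxE det_Vandermonde unitfE.
  apply/prodf_neq0 => j _; apply/prodf_neq0 => l jl.
  rewrite !mxE subr_eq0 eqr_nat; apply: contraTneq jl => /val_inj/tinj->.
  by rewrite ltnn.
pose p : 'rV[rat]_K := \row_j (P`_j)%:~R.
have pV j : (p *m V t) 0 j = (P.[(t j)%:R])%:~R.
  rewrite (horner_coef_wide _ sP) rmorph_sum mxE.
  by apply: eq_bigr => l _; rewrite !mxE rmorphM rmorphXn /= rmorph_nat.
have pE : (P`_i)%:~R = ((p *m V t) *m invmx (V t)) 0 (Ordinal iK).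
  by rewrite mulmxK // mxE.
have Pt j : `|P.[(t j)%:R]| <= (D * h)%N%:Z.
  apply: le_trans (Ah (t j) (ltn_ord _)); rewrite hornerM normrM ler_peMr //.
  have := At j; rewrite hornerM mulf_eq0 negb_or => /andP[_ q0].
  by lia.
have C0t : \sum_j `|invmx (V t) j (Ordinal iK)| <= C0.
  rewrite /C0 (bigD1 t) //= -[leLHS]addr0 lerD //; last first.
    by apply: sumr_ge0 => ? _; apply: sumr_ge0 => ? _; exact: sumr_ge0.
  apply: ler_sum => j _; rewrite (bigD1 (Ordinal iK)) //= lerDl.
  exact: sumr_ge0.
rewrite -(ler_int rat) intr_norm pE mxE.
apply: le_trans (_ : C0 * D%:R * h%:R <= _); last first.
  rewrite PoszM intrM ler_wpM2r // ltW //.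
  rewrite -[X in _ < X]/((Num.truncn (C0 * D%:R)).+1%:R).
  exact: truncnS_gt.
rewrite (le_trans (ler_norm_sum _ _ _)) // -mulrA -natrM.
apply: le_trans (ler_wpM2r _ C0t); last exact: ler0n.
rewrite mulr_suml; apply: ler_sum => j _; rewrite normrM mulrC.
rewrite ler_wpM2l // pV -intr_norm.
by rewrite -[X in _ <= X]/((D * h)%N%:~R) ler_int.
Qed.

(** * Recurrences satisfied by a geometric progression modulo an integer *)

Local Notation pZtoQ := (map_poly (intr : int -> rat)).

Definition hankel (x : nat -> int) (r c : nat) : 'M[rat]_(r, c) :=
  \matrix_(i < r, j < c) (x (i + j)%N)%:~R.

Lemma hankel_kernel_poly (x : nat -> int) (r k : nat) :
  (\rank (hankel x r k.+1) < k.+1)%N ->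
  exists P : {poly int}, [/\ P != 0, zcontents P = 1, (size P <= k.+1)%N &
    forall j, (j < r)%N -> \sum_(i < k.+1) P`_i * x (i + j)%N = 0].
Proof.
move=> rk; have : kermx (hankel x r k.+1)^T != 0.
  by rewrite kermx_eq0 /row_free mxrank_tr ltn_eqF.
case/rowV0Pn => v /sub_kermxP vM v0.
pose V : {poly rat} := \poly_(i < k.+1) (v 0 (inord i)).
have [q [a a0 qE]] := rat_poly_scale V.
have V0 : V != 0.
  apply: contraNneq v0 => /polyP V0; apply/eqP/rowP => i.
  have := V0 i; rewrite coef_poly ltn_ord inord_val coef0 => ->.
  by rewrite mxE.
have q0 : q != 0 by apply: contraNneq V0 => q0; rewrite qE q0 rmorph0 scaler0.
exists (zprimitive q); split.
- by rewrite zprimitive_eq0.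
- by rewrite zcontents_primitive q0.
- rewrite size_zprimitive -(size_rat_int_poly q).
  have -> : pZtoQ q = a%:~R *: V by rewrite qE scalerA divff ?scale1r ?intr_eq0.
  by rewrite size_scale ?intr_eq0 // size_poly.
move=> j jr.
have : zcontents q * \sum_(i < k.+1) (zprimitive q)`_i * x (i + j)%N = 0.
  rewrite mulr_sumr; under eq_bigr do rewrite mulrA -coefZ -zpolyEprim.
  apply: (@intr_inj rat); rewrite rmorph_sum /= -[RHS](mulr0 a%:~R).
  have /rowP/(_ (Ordinal jr)) := vM; rewrite !mxE => e; rewrite -[in RHS]e.
  rewrite mulr_sumr; apply: eq_bigr => i _; rewrite !mxE rmorphM /= addnC mulrA.
  congr (_ * _); have := congr1 (fun p : {poly rat} => p`_i) qE.
  rewrite coef_poly ltn_ord inord_val coefZ coef_map => -> /=.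
  by rewrite mulrA divff ?mul1r ?intr_eq0.
by move/eqP; rewrite mulf_eq0 zcontents_eq0 (negPf q0) => /eqP.
Qed.

(** By the rank condition the left kernel of the Hankel matrix has dimension [N];
    it is therefore spanned by the coefficients of the [P X^i] for [i < N]. *)
Lemma hankel_kernel_dvdp (x : nat -> int) (k N : nat) (P : {poly int})
    (a : 'I_(N + k) -> int) :
  P != 0 -> (size P <= k.+1)%N -> \rank (hankel x (N + k) k) = k ->
  (forall j, (j < N + k.-1)%N -> \sum_(i < k.+1) P`_i * x (i + j)%N = 0) ->
  (forall j, (j < k)%N -> \sum_i a i * x (i + j)%N = 0) ->
  P %| \sum_i a i *: 'X^i.
Proof.
move=> P0 sP rk PH aH.
pose S : 'M[rat]_(N, N + k) := \matrix_(i, l) ((P * 'X^i)`_l)%:~R.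
have sPX (i : 'I_N) : (size (P * 'X^i)%R <= N + k)%N.
  by rewrite size_mulXn //; have := ltn_ord i; lia.
have shift (i : 'I_N) j : \sum_(l < N + k) (P * 'X^i)`_l * x (l + j)%N =
    \sum_(l < k.+1) P`_l * x (l + (i + j))%N.
  have iN := ltn_ord i.
  rewrite -(big_mkord xpredT (fun l => (P * 'X^i)`_l * x (l + j)%N)).
  rewrite -(big_mkord xpredT (fun l => P`_l * x (l + (i + j))%N)).
  rewrite (big_cat_nat (n := i)) //=; last by lia.
  rewrite big_nat_cond big1 ?add0r; last first.
    by move=> l; rewrite andbT coefMXn => /andP[_ ->]; rewrite mul0r.
  rewrite -{1}[nat_of_ord i]add0n big_addn (big_cat_nat (n := k.+1)) //=; last by lia.
  rewrite [X in _ + X]big_nat_cond [X in _ + X]big1 ?addr0; last first.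
    move=> l; rewrite andbT => /andP[kl _]; rewrite coefMXn ltnNge leq_addl /= addnK.
    by rewrite nth_default ?mul0r // (leq_trans sP).
  by apply: eq_bigr => l _; rewrite coefMXn ltnNge leq_addl /= addnK addnA.
have SH : S *m hankel x (N + k) k = 0.
  apply/matrixP => i j; rewrite !mxE.
  have jk := ltn_ord j; have iN := ltn_ord i.
  rewrite -[RHS](rmorph0 (intmul (1 : rat))) -(PH (i + j)%N); last by lia.
  rewrite -shift rmorph_sum; apply: eq_bigr => l _.
  by rewrite !mxE rmorphM.
pose tp (v : 'rV[rat]_N) : {poly rat} := \sum_i v 0 i *: 'X^i.
have tpS (v : 'rV[rat]_N) l : (v *m S) 0 l = (tp v * pZtoQ P)`_l.
  rewrite mxE mulr_suml coef_sum; apply: eq_bigr => i _.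
  rewrite mxE -scalerAl coefZ [X in _ = _ * X](_ : _ = (pZtoQ (P * 'X^i))`_l).
    by rewrite coef_map.
  by rewrite rmorphM rmorphXn /= map_polyX mulrC.
have Sfree : row_free S.
  rewrite -kermx_eq0; apply/eqP/row_matrixP => i; rewrite row0.
  set v := row i _; have vS : v *m S = 0 by apply/sub_kermxP; rewrite row_sub.
  have : tp v * pZtoQ P = 0.
    apply/polyP => l; rewrite coef0; have [lN|Nl] := ltnP l (N + k).
      by have := tpS v (Ordinal lN); rewrite vS mxE => <-.
    rewrite nth_default // (leq_trans _ Nl) // mulr_suml.
    apply: (leq_trans (size_sum _ _ _)); apply/bigmax_leqP => j _.
    rewrite -scalerAl (leq_trans (size_scale_leq _ _)) //.
    have -> : 'X^j * pZtoQ P = pZtoQ (P * 'X^j).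
      by rewrite rmorphM rmorphXn /= map_polyX mulrC.
    by rewrite size_rat_int_poly.
  move/eqP; rewrite mulf_eq0 orbC map_poly_eq0_id0 ?intr_eq0 ?lead_coef_eq0 //.
  rewrite (negPf P0) /= => /eqP tv0; apply/rowP => j; rewrite [RHS]mxE.
  have /polyP/(_ j) := tv0; rewrite coef0 coef_sum => <-.
  rewrite (bigD1 j) //= coefZ coefXn eqxx mulr1 big1 ?addr0 // => l lj.
  by rewrite coefZ coefXn eq_sym (inj_eq val_inj) (negPf lj) mulr0.
have kerS : (kermx (hankel x (N + k) k) <= S)%MS.
  have /mxrank_leqif_sup [_ <-] : (S <= kermx (hankel x (N + k) k))%MS.
    exact/sub_kermxP.
  by rewrite mxrank_ker rk addnK (eqP Sfree).
have /submxP [v vE] : (\row_i (a i)%:~R <= S)%MS.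
  apply: submx_trans kerS; apply/sub_kermxP/rowP => j; rewrite !mxE.
  rewrite -[RHS](rmorph0 (intmul (1 : rat))) -(aH j) // rmorph_sum.
  by apply: eq_bigr => i _; rewrite !mxE rmorphM.
rewrite -dvdp_rat_int; apply/dvdpP; exists (tp v).
apply/polyP => l; rewrite coef_map coef_sum /=.
have [lN|Nl] := ltnP l (N + k).
  have := tpS v (Ordinal lN); rewrite -vE mxE /= => <-.
  rewrite (bigD1 (Ordinal lN)) //= coefZ coefXn eqxx mulr1 big1 ?addr0 // => j.
  move=> jl; rewrite coefZ coefXn; case: eqP => [lj|]; last by rewrite mulr0.
  by case/eqP: jl; apply/val_inj.
rewrite big1 => [|i _]; last first.
  by rewrite coefZ coefXn gtn_eqF ?mulr0 // (leq_trans (ltn_ord _)).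
rewrite rmorph0 nth_default // (leq_trans _ Nl) // mulr_suml.
apply: (leq_trans (size_sum _ _ _)); apply/bigmax_leqP => j _.
rewrite -scalerAl (leq_trans (size_scale_leq _ _)) //.
have -> : 'X^j * pZtoQ P = pZtoQ (P * 'X^j).
  by rewrite rmorphM rmorphXn /= map_polyX mulrC.
by rewrite size_rat_int_poly.
Qed.

(** [P] is the characteristic polynomial of a recurrence of least order [k]
    satisfied by [x] on [0, n], and the congruences [x_i = x_0 z^i] turn the
    recurrence into [P(z) = 0] modulo [q]. By minimality of [k], the Hankel matrix
    of [x] with [k] columns has rank [k], and [hankel_siegel] applies to it. With
    [h = 0] it can produce no vector, whence the bound on [q^(k-1)]. The least [h]
    for which it produces one yields a multiple of [P] of height [h], by
    [hankel_kernel_dvdp], and [int_factor_height] bounds the height of [P]. *)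
Lemma hankel_recurrence (n : nat) : (0 < n)%N ->
  exists C : nat, (0 < C)%N /\
  forall (x : nat -> int) (z : int) (q X : nat),
  (0 < q)%N -> x 0%N != 0 -> coprimez (x 0%N) q%:Z ->
  (forall i, (i <= n)%N -> `|x i| <= X%:Z) ->
  (forall i, (i <= n)%N -> (q%:Z %| x i - x 0%N * z ^+ i)%Z) ->
  exists (k : nat) (P : {poly int}),
  [/\ (0 < k <= n)%N, (size P <= k.+1)%N, zcontents P = 1,
      (q%:Z %| P.[z])%Z & (q ^ k.-1 <= (C * X) ^ k)%N /\
      ((2 * k <= n.+1)%N -> exists H : nat, (forall i, `|P`_i| <= H%:Z) /\
         (H ^ (n + 2 - 2 * k) * q ^ k.-1 <= (C * X) ^ k)%N)].
Proof.
move=> n0; have [G [G0 GP]] := int_factor_height n.+1.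
pose c := (2 * n + 3)%N.
exists (G ^ n * c)%N; split; first by rewrite muln_gt0 expn_gt0 G0 /c addnS.
move=> x z q X q0 x0 cop xX xz.
have X0 : (0 < X)%N.
  have := xX 0%N (leq0n _); case: X {xX} => // /(le_trans _) H.
  by move: x0; rewrite -normr_le0 H.
pose rk k := (\rank (hankel x (n - k).+1 k.+1) < k.+1)%N.
have exrk : exists k, rk k.
  exists n; rewrite /rk subnn (leq_ltn_trans (rank_leq_row _)) //.
have rkn : rk n by rewrite /rk subnn (leq_ltn_trans (rank_leq_row _)).
case: (ex_minnP exrk) => k rkk kmin.
have kn : (k <= n)%N := kmin _ rkn.
case: k rkk kmin kn => [|k] rkk kmin kn.
  move: rkk; rewrite /rk ltnS leqn0 mxrank_eq0 => /eqP/matrixP/(_ 0 0).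
  by rewrite !mxE => /eqP; rewrite intr_eq0 (negPf x0).
have [P [P0 Pc sP PH]] := hankel_kernel_poly rkk.
pose m := (n - k)%N.
have rkm : \rank (hankel x m.+1 k.+1) = k.+1.
  apply/eqP; rewrite eqn_leq rank_leq_col leqNgt; apply/negP => rm.
  by have := kmin k rm; rewrite ltnn.
have mk : (m + k = n)%N by rewrite /m; lia.
have siegel h : ((2 * ((m.+1 * h + k.+1) * X) + 1) ^ k.+1 < h.+1 ^ m.+1 * q ^ k)%N ->
    exists a : 'I_m.+1 -> int,
    [/\ exists i, a i != 0, forall i, `|a i| <= h%:Z &
        forall j, (j <= k)%N -> \sum_i a i * x (i + j)%N = 0].
  apply: (@hankel_siegel _ _ _ z) => //; rewrite ?mk //.
  move=> v; rewrite -/(hankel x m.+1 k.+1) => Hv.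
  have Hf : row_full (hankel x m.+1 k.+1) by rewrite /row_full rkm.
  by rewrite -(mul1mx v) -(mulVpmx Hf) -mulmxA Hv mulmx0.
have cbound h : (2 * ((m.+1 * h + k.+1) * X) + 1 <= c * X * h.+1)%N.
  have : (m.+1 * h + k.+1 <= n.+1 * h.+1)%N.
    have mn : (m.+1 <= n.+1)%N by rewrite /m; lia.
    have := leq_mul mn (leqnn h); rewrite mulnS; lia.
  rewrite /c -(leq_pmul2r X0); nia.
have cGc : (c * X <= G ^ n * c * X)%N.
  by rewrite -mulnA leq_pmull // expn_gt0 G0.
exists k.+1, P; split=> //.
- have : (q%:Z %| x 0%N * P.[z])%Z.
    rewrite (horner_coef_wide _ sP) mulr_sumr.
    have e := PH 0%N (ltn0Sn _).
    rewrite -[X in (_ %| X)%Z]subr0 -[X in (_ %| _ - X)%Z]e -sumrB big_seq; apply: rpred_sum => i _.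
    rewrite addn0 mulrCA -mulrBr dvdz_mull // -opprB rpredN xz //.
    by rewrite (leq_trans _ kn) // -ltnS.
  by rewrite Gauss_dvdzr // coprimez_sym.
split=> /= [|k2].
  apply: (@leq_trans ((c * X) ^ k.+1)); last by rewrite leq_exp2r.
  rewrite leqNgt; apply/negP => lt; have [|a [[i ai] ah _]] := siegel 0%N.
    rewrite exp1n mul1n (leq_ltn_trans _ lt) // leq_exp2r //.
    by have := cbound 0%N; rewrite muln1.
  by move: ai; rewrite -normr_le0 ah.
pose N := (n - 2 * k)%N.
have NE : (n + 2 - 2 * k.+1 = N)%N by rewrite /N; lia.
have N0 : (0 < N)%N by rewrite /N; lia.
have exh : exists h, ((c * X) ^ k.+1 < h.+1 ^ N * q ^ k)%N.
  exists ((c * X) ^ k.+1)%N.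
  apply: (@leq_trans ((c * X) ^ k.+1).+1) => //.
  rewrite -[leqLHS]muln1 leq_mul ?expn_gt0 ?q0 //.
  by rewrite -[leqLHS]expn1 leq_pexp2l.
(* Minimality of [h] gives the converse inequality for [h - 1]. *)
case: (ex_minnP exh) => h hP hmin.
have mN : (m.+1 = N + k.+1)%N by rewrite /m /N; lia.
have [|a [[i0 ai0] ah aH]] := siegel h.
  rewrite mN expnD.
  apply: (@leq_ltn_trans ((c * X * h.+1) ^ k.+1)); first by rewrite -mN leq_exp2r ?cbound.
  by rewrite expnMn [ltnRHS]mulnAC ltn_pmul2r // expn_gt0.
case: h => [|h] in hP hmin ah *.
  by move: ai0; rewrite -normr_le0 ah.
have {hmin} hb : (h.+1 ^ N * q ^ k <= (c * X) ^ k.+1)%N.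
  by rewrite leqNgt; apply/negP => /hmin; rewrite ltnn.
exists (G * h.+1)%N; split; last first.
  rewrite NE expnMn -!mulnA expnMn leq_mul //.
  rewrite -expnM leq_pexp2l // /N; nia.
pose A := \sum_i a i *: 'X^i : {poly int}.
have PA : P %| A.
  have rkm' : \rank (hankel x (N + k.+1) k.+1) = k.+1 by rewrite -mN.
  rewrite /A; move: {A i0 ai0 ah} a aH; rewrite mN => a aH.
  apply: (hankel_kernel_dvdp P0 sP rkm') => // j jN; apply: PH.
  by rewrite (leq_trans jN) // /N; lia.
have A0i i : A`_i = if insub i is Some j then a j else 0.
  rewrite coef_sum; case: insubP => [j _ ij|ni].
    rewrite (bigD1 j) //= coefZ coefXn -ij eqxx mulr1 big1 ?addr0 // => l lj.
    by rewrite coefZ coefXn eq_sym (inj_eq val_inj) (negPf lj) mulr0.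
  rewrite big1 // => l _; rewrite coefZ coefXn; case: eqP => [e|]; rewrite ?mulr0 //.
  by move: ni; rewrite e ltn_ord.
have [Q AE] := dvdpP_int PA.
have PE : zprimitive P = P by rewrite [RHS]zpolyEprim Pc scale1r.
rewrite PE in AE; apply: (GP P Q) => [|||i].
- rewrite -AE; apply: contraNneq ai0 => A0.
  by have := A0i i0; rewrite A0 coef0 valK => <-.
- by rewrite (leq_trans sP).
- rewrite -AE; apply: (leq_trans (size_sum _ _ _)); apply/bigmax_leqP => i _.
  rewrite (leq_trans (size_scale_leq _ _)) // size_polyXn.
  by have := ltn_ord i; rewrite /m; lia.
- by rewrite -AE A0i; case: insubP => // _; rewrite normr0.
Qed.

(** * Multiple roots in degree at most three *)

Lemma zprimitive_factor (L P : {poly int}) : zcontents L = 1 -> L %| P ->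
  exists Q, P = L * Q.
Proof.
move=> L1 /dvdpP_int[Q PE]; exists Q; rewrite {1}PE; congr (_ * _).
by rewrite [RHS]zpolyEprim L1 scale1r.
Qed.

Lemma rat_double_root (P : {poly int}) (r : rat) :
  root (pZtoQ P) r -> root (pZtoQ P^`()) r ->
  exists L M : {poly int}, [/\ size L = 2%N, zcontents L = 1 & P = L * L * M].
Proof.
move=> rP rP'.
pose L0 : {poly int} := (denq r)%:P * 'X - (numq r)%:P.
have L0Q : pZtoQ L0 = (denq r)%:~R *: ('X - r%:P).
  rewrite /L0 rmorphB rmorphM /= map_polyX !map_polyC /= mul_polyC scalerBr.
  by rewrite numqE mulrC polyCM mul_polyC.
have sL0 : size L0 = 2%N.
  by rewrite -(size_rat_int_poly L0) L0Q size_scale ?intr_eq0 ?denq_neq0 // size_XsubC.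
pose L := zprimitive L0.
have sL : size L = 2%N by rewrite size_zprimitive.
have L0N : L0 != 0 by rewrite -size_poly_gt0 sL0.
have L1 : zcontents L = 1 by rewrite zcontents_primitive L0N.
have dvL Q : root (pZtoQ Q) r -> exists Q', Q = L * Q'.
  move=> rQ; apply: zprimitive_factor => //.
  have : L0 %| Q.
    by rewrite -dvdp_rat_int L0Q dvdpZl ?intr_eq0 ?denq_neq0 // dvdp_XsubCl.
  apply: dvdp_trans; rewrite [L0]zpolyEprim -/L.
  by rewrite dvdpZr ?zcontents_eq0.
have [Q PE] := dvL _ rP.
suff /dvL[M QE] : root (pZtoQ Q) r by exists L, M; rewrite -mulrA -QE.
have rL : (pZtoQ L).[r] = 0.
  have c0 : (zcontents L0)%:~R != 0 :> rat by rewrite intr_eq0 zcontents_eq0.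
  apply: (mulfI c0).
  have e : pZtoQ L0 = (zcontents L0)%:~R *: pZtoQ L.
    by rewrite [in LHS](zpolyEprim L0) map_polyZ.
  rewrite mulr0 -hornerZ -e L0Q.
  by rewrite hornerZ hornerXsubC subrr mulr0.
have L' : L^`() = (lead_coef L)%:P.
  apply/polyP => -[|i]; rewrite coef_deriv coefC /= ?mulr1n ?lead_coefE ?sL //.
  by rewrite nth_default ?mul0rn // sL.
move: rP'; rewrite PE derivM rmorphD !rmorphM /= L' map_polyC /=.
rewrite /root hornerD !hornerM rL mul0r addr0 hornerC mulf_eq0 intr_eq0.
by rewrite lead_coef_eq0 -size_poly_eq0 sL.
Qed.

(** If the gcd of [p] and [p'] is not linear then [p] is cubic and [p = q p'] with
    [q] linear. Comparing leading coefficients gives [q' = 1/3], and differentiating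
    at the root [r] of [q] gives [p'(r) = q' p'(r)], so that [p'(r) = 0]. *)
Lemma rat_deriv_common_root (p : {poly rat}) :
  (size p <= 4)%N -> p != 0 -> (1 < size (gcdp p p^`()))%N ->
  exists r, root p r /\ root p^`() r.
Proof.
move=> sp p0 sg; have [sp1|sp1] := leqP (size p) 1.
  move: sg; rewrite ltnNge (leq_trans (leq_gcdpl _ p0)) //.
have sp' : size p^`() = (size p).-1 by exact: polyorder.size_deriv.
have p'0 : p^`() != 0 by rewrite -size_poly_gt0 sp'; lia.
have [sg2|sg3] := leqP (size (gcdp p p^`())) 2.
  have s2 : size (gcdp p p^`()) = 2%N by apply/eqP; rewrite eqn_leq sg2 sg.
  have [r rg] := poly2_root s2; exists r.
  by rewrite (root_dvdp (dvdp_gcdl _ _) rg) (root_dvdp (dvdp_gcdr _ _) rg).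
have s4 : size p = 4%N.
  have := leq_trans sg3 (leq_gcdpr p p'0); rewrite sp'; lia.
have /dvdpP[q pE] : p^`() %| p.
  have : gcdp p p^`() %= p^`().
    rewrite -dvdp_size_eqp ?dvdp_gcdr // sp' s4 /=.
    by apply/eqP/anti_leq; rewrite sg3 (leq_trans (leq_gcdpr p p'0)) ?sp' ?s4.
  by move/eqp_dvdl <-; rewrite dvdp_gcdl.
have q0 : q != 0 by apply: contraNneq p0 => q0; rewrite pE q0 mul0r.
have sq : size q = 2%N.
  by have := size_mul q0 p'0; rewrite -pE sp' s4 /= !addnS addn0 /= => -[<-].
have [r rq] := poly2_root sq; exists r.
split; first by rewrite pE rootM rq.
have q' : q^`() = (q`_1)%:P.
  apply/polyP => -[|i]; rewrite coef_deriv coefC /= ?mulr1n //.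
  by rewrite nth_default ?mul0rn // sq.
have q1 : q`_1 * 3 = 1.
  have p3 : p`_3 != 0.
    by move: p0; rewrite -lead_coef_eq0 lead_coefE s4.
  apply: (mulIf p3); rewrite mul1r.
  have := lead_coefM q p^`(); rewrite -pE !lead_coefE sp' s4 sq /= coef_deriv.
  by move=> e; rewrite [RHS]e; ring.
have := congr1 (fun u : {poly rat} => u^`().[r]) pE => /=.
rewrite derivM q' !hornerE (rootP rq) mul0r addr0 => e.
apply/rootP; have : p^`().[r] * (q`_1 - 1) = 0.
  by rewrite mulrBr mulr1 {2}e mulrC subrr.
move/eqP; rewrite mulf_eq0 => /orP[/eqP//|/eqP q11].
by move: q1; rewrite (subr0_eq q11).
Qed.

Lemma det_le (n : nat) (A : 'M[int]_n) (B : int) : 0 <= B ->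
  (forall i j, `|A i j| <= B) -> `|\det A| <= (n`!)%:Z * B ^+ n.
Proof.
move=> B0 AB; rewrite (le_trans (ler_norm_sum _ _ _)) //.
apply: le_trans (_ : \sum_(s : 'S_n) B ^+ n <= _).
  apply: ler_sum => s _; rewrite normrM normrX normrN1 expr1n mul1r normr_prod.
  have -> : B ^+ n = \prod_(i < n) B by rewrite prodr_const card_ord.
  apply: ler_prod => i _.
  by rewrite normr_ge0 AB.
by rewrite sumr_const -mulr_natl card_Sn natz.
Qed.

(** The alternative is whether the resultant of [P] and [P'] vanishes; the
    constant is [5! 3^5], from the Leibniz formula for the Sylvester matrix. *)
Lemma cubic_resultant_or_double_root (P : {poly int}) (H : nat) :
  (size P <= 4)%N -> zcontents P = 1 -> (forall i, `|P`_i| <= H%:Z) ->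
  (exists L M : {poly int}, [/\ size L = 2%N, zcontents L = 1 & P = L * L * M]) \/
  (exists (r : int) (U V : {poly int}), [/\ r != 0, `|r| <= (29160 * H ^ 5)%N%:Z &
     r%:P = U * P + V * P^`()]).
Proof.
move=> sP cP PH.
have P0 : P != 0 by rewrite -zcontents_eq0 cP.
have H0 : (0 < H)%N.
  have := PH (size P).-1; rewrite -lead_coefE; case: H {PH} => //.
  by rewrite normr_le0 lead_coef_eq0 (negPf P0).
have HH : (H <= 29160 * H ^ 5)%N.
  rewrite -{1}[H]expn1 (leq_trans (leq_pexp2l H0 (isT : (1 <= 5)%N))) //.
  exact: leq_pmull.
have [s1|s1] := leqP (size P) 1.
  right; exists P`_0, 1, 0; split.
  - by move: P0; rewrite -lead_coef_eq0 lead_coefE; case: (size P) s1 => [|[]].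
  - by rewrite (le_trans (PH 0%N)).
  - by rewrite mul0r addr0 mul1r -size1_polyC.
have sp' : size P^`() = (size P).-1 by exact: polyorder.size_deriv.
have [s2|s2] := leqP (size P) 2.
  right; exists P`_1, 0, 1; split.
  - move: P0; rewrite -lead_coef_eq0 lead_coefE.
    by have -> : size P = 2%N by apply/eqP; rewrite eqn_leq s2 s1.
  - by rewrite (le_trans (PH 1%N)).
  - rewrite mul0r add0r mul1r; apply/polyP => -[|i]; rewrite coef_deriv coefC //=.
    by rewrite nth_default ?mul0rn // (leq_trans s2).
have [r0|r0] := eqVneq (resultant P P^`()) 0.
  left; move/eqP: r0; rewrite resultant_eq0 => sg.
  have [|||r [r1 r2]] := @rat_deriv_common_root (pZtoQ P).
  - by rewrite size_rat_int_poly.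
  - by rewrite map_poly_eq0_id0 ?intr_eq0 ?lead_coef_eq0.
  - apply: leq_trans sg _; rewrite -(size_rat_int_poly (gcdp _ _)) dvdp_leq //.
      by rewrite gcdp_eq0 map_poly_eq0_id0 ?intr_eq0 ?lead_coef_eq0 // (negPf P0).
    by rewrite dvdp_gcd deriv_map !dvdp_rat_int dvdp_gcdl dvdp_gcdr.
  by apply: (@rat_double_root P r) => //; rewrite -deriv_map.
right; have [|[U V] /= [_ _ rE]] := resultant_in_ideal s1 (q := P^`()).
  by rewrite sp'; lia.
exists (resultant P P^`()), U, V; split=> //.
have P'H i : `|P^`()`_i| <= (3 * H)%N%:Z.
  rewrite coef_deriv normrMn; have [i3|i3] := leqP 3 i.
    by rewrite nth_default ?normr0 ?mul0rn // (leq_trans sP).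
  rewrite -mulr_natr PoszM mulrC ler_pM // natz lez_nat; lia.
rewrite /resultant; set n := ((size P^`()).-1 + (size P).-1)%N.
have n5 : (n <= 5)%N by rewrite /n sp'; lia.
apply: (le_trans (@det_le n _ (3 * H)%N%:Z _ _)) => //.
  move=> i j; rewrite Sylvester_mxE; case: fintype.split => k; rewrite normrMn.
  - by case: leqP => _; rewrite ?mulr0n // mulr1n (le_trans (PH _)) // lez_nat; lia.
  - by case: leqP => _; rewrite ?mulr0n // mulr1n.
have -> : (3 * H)%N%:Z ^+ n = ((3 * H) ^ n)%N%:Z by rewrite -[RHS]natz natrX natz.
rewrite -PoszM lez_nat.
have -> : (29160 * H ^ 5 = 5`! * (3 * H) ^ 5)%N by rewrite expnMn mulnA.
apply: leq_mul; last by rewrite leq_pexp2l //; lia.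
exact: leq_fact.
Qed.

(** * Counting residues *)

Lemma card_residue_class (n q : nat) (S : {set 'I_n}) : (0 < q)%N ->
  {in S &, forall i j : 'I_n, (i = j %[mod q])%N} ->
  (#|S| <= (n.-1 %/ q).+1)%N.
Proof.
move=> q0 Sq; pose f (i : 'I_n) : 'I_(n.-1 %/ q).+1 := inord (i %/ q).
rewrite -[leqRHS]card_ord; apply: (@leq_card_in _ _ f) => i j iS jS.
have le (k : 'I_n) : (k %/ q < (n.-1 %/ q).+1)%N.
  by rewrite ltnS leq_div2r //; case: n k {S Sq f iS jS i j} => [[]|n k] //=; rewrite -ltnS.
move/(congr1 (@nat_of_ord _)); rewrite /f !inordK // => ij; apply/val_inj => /=.
by rewrite (divn_eq i q) (divn_eq j q) ij (Sq i j).
Qed.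

(** Two solutions [b] and [b'] satisfy [p^v | (b - b') (b + b')], so that they are
    congruent up to sign modulo [p^(v/2)]. *)
Lemma card_square_near (p H i : nat) (N : int) : prime p ->
  (#|[set c : 'I_(2 * H).+1 | (((c%:Z - H%:Z) ^+ 2 - N != 0) &&
       (uphalf (logn p `|(c%:Z - H%:Z) ^+ 2 - N|) == i))%R]|
     <= 2 * ((2 * H) %/ p ^ i).+1)%N.
Proof.
move=> p_pr; set S := [set c | _].
case: i => [|i] in S *; last first.
  have pi (b c : 'I_(2 * H).+1) : b \in S -> c \in S ->
      (p%:Z ^+ i.+1 %| b%:Z - c%:Z)%Z || (p%:Z ^+ i.+1 %| b%:Z + c%:Z - (2 * H)%N%:Z)%Z.
    rewrite !inE => /andP[b0 /eqP bi] /andP[c0 /eqP ci].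
    have key (a : int) : a != 0 -> uphalf (logn p `|a|) = i.+1 -> (p%:Z ^+ (2 * i).+1 %| a)%Z.
      move=> a0 ai; rewrite dvdzE abszX absz_nat pfactor_dvdn ?absz_gt0 //.
      by move: ai; rewrite -[logn _ _]odd_double_half; case: (odd _); rewrite ?uphalf_half /=; lia.
    have := rpredB (key _ b0 bi) (key _ c0 ci).
    have -> : (b%:Z - H%:Z) ^+ 2 - N - ((c%:Z - H%:Z) ^+ 2 - N) =
      (b%:Z - c%:Z) * (b%:Z + c%:Z - (2 * H)%N%:Z) by rewrite PoszM; ring.
    move: (b%:Z - c%:Z) (b%:Z + c%:Z - _) => u v.
    have [->|u0] := eqVneq u 0; first by rewrite dvdz0.
    have [->|v0] := eqVneq v 0; first by rewrite dvdz0 orbT.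
    rewrite !dvdzE !abszX absz_nat abszM !pfactor_dvdn ?muln_gt0 ?absz_gt0 ?u0 //.
    by rewrite lognM ?absz_gt0 //; lia.
  have q0 : (0 < p ^ i.+1)%N by rewrite expn_gt0 prime_gt0.
  have Pq : (p ^ i.+1)%N%:Z = p%:Z ^+ i.+1 by rewrite -[LHS]natz natrX natz.
  case: (set_0Vmem S) => [->|[b bS]]; first by rewrite cards0.
  pose S1 := [set c in S | (p%:Z ^+ i.+1 %| b%:Z - c%:Z)%Z].
  pose S2 := [set c in S | (p%:Z ^+ i.+1 %| b%:Z + c%:Z - (2 * H)%N%:Z)%Z].
  have : (#|S| <= #|S1| + #|S2|)%N.
    rewrite -cardsUI (leq_trans _ (leq_addr _ _)) // subset_leq_card //.
    by apply/fintype.subsetP => c cS; rewrite !inE -/S; move: cS (pi _ _ bS cS); rewrite inE => ->.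
  move/leq_trans; apply; rewrite [leqRHS]mul2n -addnn leq_add //.
    apply: card_residue_class => // c d; rewrite !inE => /andP[_ bc] /andP[_ bd].
    apply/eqP; rewrite -(eqz_nat (c %% _) (d %% _)) -!modz_nat eqz_mod_dvd Pq.
    have -> : c%:Z - d%:Z = (b%:Z - d%:Z) - (b%:Z - c%:Z) by ring.
    exact: rpredB.
  apply: card_residue_class => // c d; rewrite !inE => /andP[_ bc] /andP[_ bd].
  apply/eqP; rewrite -(eqz_nat (c %% _) (d %% _)) -!modz_nat eqz_mod_dvd Pq.
  have -> : c%:Z - d%:Z = (b%:Z + c%:Z - (2 * H)%N%:Z) - (b%:Z + d%:Z - (2 * H)%N%:Z) by ring.
  exact: rpredB.
rewrite expn0 divn1 (leq_trans (max_card _)) // card_ord.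
by rewrite leq_pmull.
Qed.

(** At most [sum_(d >= 2) (h / d)^2 <= 3/4 h^2] pairs have a common factor [d]. *)
Lemma card_coprime_pairs (h : nat) :
  (h ^ 2 <= 4 * #|[set bc : 'I_h * 'I_h | coprime bc.1.+1 bc.2.+1]|)%N.
Proof.
set T := [set _ | _].
have cD d : (0 < d)%N -> (#|[set b : 'I_h | d %| b.+1]| <= h %/ d)%N.
  move=> d0.
  pose f (i : 'I_h) : nat := (i.+1 %/ d).-1.
  have fl (i : 'I_h) : (d %| i.+1)%N -> (f i < h %/ d)%N /\ ((f i).+1 * d = i.+1)%N.
    move=> di; have i0 : (0 < i.+1 %/ d)%N by rewrite divn_gt0 // dvdn_leq.
    rewrite /f prednK // divnK //; split=> //.
    by rewrite leq_div2r.
  rewrite -[leqRHS]card_ord.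
  have [->|[b bS]] := set_0Vmem [set b : 'I_h | d %| b.+1]%N; first by rewrite cards0.
  move: (bS); rewrite inE => /fl[]; case E: (h %/ d)%N => [//|n] _ _.
  apply: (@leq_card_in _ _ (fun i => inord (f i))) => i j; rewrite !inE.
  move=> /fl[fi Ei] /fl[fj Ej] /(congr1 (@nat_of_ord _)); rewrite !inordK -?E // => fij.
  by apply/val_inj/succn_inj; rewrite -Ei -Ej fij.
have cT : (#|~: T| <= \sum_(2 <= d < h.+1) (h %/ d) ^ 2)%N.
  pose D (d : 'I_h.+1) := [set bc : 'I_h * 'I_h | (d %| bc.1.+1) && (d %| bc.2.+1)]%N.
  have sub : ~: T \subset \bigcup_(d : 'I_h.+1 | (2 <= d)%N) D d.
    apply/fintype.subsetP => -[b c]; rewrite !inE /= => bc.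
    have gh : (gcdn b.+1 c.+1 < h.+1)%N.
      by rewrite ltnS (leq_trans (dvdn_leq _ (dvdn_gcdl _ _))).
    apply/finset.bigcupP; exists (Ordinal gh); last by rewrite inE dvdn_gcdl dvdn_gcdr.
    by rewrite /= ltn_neqAle eq_sym bc gcdn_gt0.
  apply: (leq_trans (subset_leq_card sub)).
  apply: (@leq_trans (\sum_(d : 'I_h.+1 | (2 <= d)%N) #|D d|)).
    elim/big_rec2: _ => [|d m A _ IH]; first by rewrite cards0.
    by rewrite (leq_trans (leq_card_setU _ _).1) // leq_add2l.
  rewrite big_geq_mkord; apply: leq_sum => d d2; rewrite /D.
  have -> : [set bc : 'I_h * 'I_h | (d %| bc.1.+1)%N && (d %| bc.2.+1)%N] =
     finset.setX [set b : 'I_h | d %| b.+1]%N [set b : 'I_h | d %| b.+1]%N.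
    by apply/finset.setP => -[b c]; rewrite !inE.
  by rewrite cardsX -mulnn leq_mul // cD // (leq_trans _ d2).
have s34 : (4 * \sum_(2 <= d < h.+1) (h %/ d) ^ 2 <= 3 * h ^ 2)%N.
  case: h {T cD cT} => [|[|h]]; [by rewrite big_nil|by rewrite big_nil|].
  rewrite -(ler_nat rat) !natrM natr_sum.
  have inv2 n : n.+3%:R ^- 2 <= n.+2%:R^-1 - n.+3%:R^-1 :> rat.
    have -> : n.+2%:R^-1 - n.+3%:R^-1 = (n.+2%:R * n.+3%:R)^-1 :> rat.
      have : n.+2%:R != 0 :> rat by rewrite pnatr_eq0.
      have : n.+3%:R != 0 :> rat by rewrite pnatr_eq0.
      by rewrite -(natr1 n.+2); move: n.+2%:R => a b0 a0; field; rewrite a0 b0.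
    rewrite expr2 lef_pV2 ?posrE ?mulr_gt0 ?ltr0n //.
    by rewrite ler_pM2r ?ltr0n // ler_nat.
  have key n : \sum_(2 <= d < n.+3) (d%:R ^- 2 : rat) <= 3 / 4 - n.+2%:R^-1.
    elim: n => [|n IH]; first by rewrite big_nat1; lra.
    rewrite big_nat_recr; last by [].
    apply: le_trans (lerD IH (inv2 n)) _.
    rewrite addrA subrK; exact: lexx.
  apply: le_trans (_ : 4 * (h.+2%:R ^+ 2 * \sum_(2 <= d < h.+3) (d%:R ^- 2 : rat)) <= _).
    rewrite ler_wpM2l // mulr_sumr big_nat_cond [leRHS]big_nat_cond.
    apply: ler_sum => d /andP[/andP[d2 _] _].
    have d0 : 0 < d%:R :> rat by rewrite ltr0n; lia.
    rewrite -exprVn -exprMn natrX lerXn2r ?nnegrE ?divr_ge0 ?ler0n //.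
    by rewrite ler_pdivlMr // -natrM ler_nat leq_trunc_div.
  rewrite mulrCA -expr2 [leRHS]mulrC ler_wpM2l ?exprn_ge0 ?ler0n //.
  have := key h; have : 0 <= h.+2%:R^-1 :> rat by rewrite invr_ge0 ler0n.
  by move: (\sum_(_ <= _ < _) _) (h.+2%:R^-1) => s x; lra.
have := cardsC T; rewrite card_prod !card_ord -mulnn => cC.
have := leq_mul (leqnn 4) cT; move: s34; rewrite -mulnn; lia.
Qed.

(** Fractions of height at most [p^g] are determined by their residue modulo
    [p^(2g)], because [c b'] and [c' b] are at most [p^(2g)]. At least a quarter of
    the pairs are coprime, and exchanging [b] and [c] shows that [b] is prime to [p]
    in at least half of these. *)
Lemma fraction_residues (p g : nat) : prime p ->
  exists S : {set 'I_(p ^ (2 * g))}, (p ^ (2 * g) <= 8 * #|S|)%N /\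
  forall u, u \in S -> exists b c : nat,
    [/\ (0 < b <= p ^ g)%N, (0 < c <= p ^ g)%N, ~~ (p %| b)%N &
        (b * u = c %[mod p ^ (2 * g)])%N].
Proof.
move=> p_pr; set h := (p ^ g)%N; set q := (p ^ (2 * g))%N.
have qE : q = (h ^ 2)%N by rewrite /q /h -expnM mulnC.
have q0 : (0 < q)%N by rewrite expn_gt0 prime_gt0.
pose T := [set bc : 'I_h * 'I_h | coprime bc.1.+1 bc.2.+1].
pose T' := [set bc in T | ~~ (p %| bc.1.+1)%N].
have cT : (#|T| <= 2 * #|T'|)%N.
  pose sw (bc : 'I_h * 'I_h) := (bc.2, bc.1).
  have swI : injective sw by move=> [a b] [c d] [-> ->].
  have sub : T \subset T' :|: sw @: T'.
    apply/fintype.subsetP => -[b c]; rewrite !inE /= => bc; rewrite bc /=.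
    have [pb|//] := boolP (p %| b.+1)%N; apply/imsetP; exists (c, b) => //.
    rewrite !inE /= coprime_sym bc /=; apply/negP => pc.
    have : (p %| gcdn b.+1 c.+1)%N by rewrite dvdn_gcd pb pc.
    by rewrite (eqP bc) dvdn1 => /eqP p1; rewrite p1 in p_pr.
  rewrite (leq_trans (subset_leq_card sub)) // (leq_trans (leq_card_setU _ _).1) //.
  by rewrite card_imset // mul2n addnn.
have ex (bc : 'I_h * 'I_h) : exists u : 'I_q, ~~ (p %| bc.1.+1)%N ->
    (bc.1.+1 * u = bc.2.+1 %[mod q])%N.
  have [pb|pb] := boolP (p %| bc.1.+1)%N; first by exists (Ordinal q0).
  have cop : coprime bc.1.+1 q.
    by rewrite coprime_sym /q coprimeXl // prime_coprime.
  have [u uP] : exists u, (bc.1.+1 * u = bc.2.+1 %[mod q])%N.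
    exists ((egcdn bc.1.+1 q).1 * bc.2.+1)%N.
    case: egcdnP => // km kn e _ /=; rewrite mulnA (mulnC bc.1.+1) e (eqP cop).
    by rewrite mulnDl mul1n mulnAC modnMDl.
  exists (Ordinal (ltn_pmod u q0)) => _ /=.
  by rewrite modnMmr.
have /fin_all_exists [f fP] := ex.
have finj : {in T' &, injective f}.
  move=> [b c] [b' c']; rewrite !inE /= => /andP[bc pb] /andP[bc' pb'] ff.
  have e1 := fP (b, c) pb; have e2 := fP (b', c') pb'; rewrite -ff /= in e1 e2.
  have : (c.+1 * b'.+1 = c'.+1 * b.+1 %[mod q])%N.
    rewrite -modnMml -e1 modnMml -[RHS]modnMml -e2 modnMml; congr (_ %% _)%N; lia.
  have small (i j : 'I_h) : (0 < i.+1 * j.+1 <= q)%N.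
    by rewrite muln_gt0 /= qE -mulnn leq_mul.
  have em : (c.+1 * b'.+1 = c'.+1 * b.+1 %[mod q] -> c.+1 * b'.+1 = c'.+1 * b.+1)%N.
    move: (small c b') (small c' b); move: (_ * _)%N (_ * _)%N => [//|x] [//|y].
    move=> /andP[_ xq] /andP[_ yq] /eqP; rewrite -(addn1 x) -(addn1 y) eqn_modDr !modn_small //.
    by move/eqP->.
  move/em => e.
  have bb : b.+1 = b'.+1.
    apply/eqP; rewrite eqn_dvd; apply/andP; split.
      by rewrite -(Gauss_dvdr _ bc) e dvdn_mull.
    by rewrite -(Gauss_dvdr _ bc') -e dvdn_mull.
  have cc : c.+1 = c'.+1.
    by move/eqP: e; rewrite bb eqn_pmul2r // => /eqP.
  by congr pair; apply/val_inj/succn_inj.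
exists (f @: T'); split.
  rewrite card_in_imset // qE; have := card_coprime_pairs h; rewrite -/T; lia.
move=> u /imsetP[[b c]]; rewrite !inE /= => /andP[bc pb] ->.
by exists b.+1, c.+1; split; [exact: ltn_ord|exact: ltn_ord|exact: pb|exact: (fP (b, c) pb)].
Qed.

Lemma square_near_valuation (p H e : nat) (N b : int) : prime p -> 
  `|N| <= (4 * H ^ 2)%N%:Z -> `|b| <= H%:Z -> (5 * p * H ^ 2 < p ^ e)%N ->
  b ^+ 2 - N != 0 -> let v := logn p `|b ^+ 2 - N| in
  [/\ (v < e)%N, (2 * uphalf v < e)%N & (p ^ uphalf v <= 5 * p * H)%N].
Proof.
move=> p_pr NH bH eH D0 v.
have Dv : (p ^ v <= 5 * H ^ 2)%N.
  apply: (@leq_trans `|b ^+ 2 - N|%N).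
    by rewrite dvdn_leq ?absz_gt0 // pfactor_dvdn ?absz_gt0.
  rewrite -lez_nat abszE (le_trans (ler_normB _ _)) //.
  have -> : (5 * H ^ 2)%N%:Z = H%:Z ^+ 2 + (4 * H ^ 2)%N%:Z.
    by rewrite -mulnn !PoszM; ring.
  by rewrite lerD // normrX lerXn2r ?nnegrE.
have p1 := prime_gt1 p_pr.
have v1 : (p ^ v.+1 <= 5 * p * H ^ 2)%N by rewrite expnS; nia.
have ve : (v.+1 < e)%N by rewrite -(ltn_exp2l _ _ p1) (leq_ltn_trans v1).
have u2 : (2 * uphalf v <= v.+1)%N by rewrite uphalf_half; have := odd_double_half v; lia.
split; [exact: ltnW | exact: leq_ltn_trans ve|].
rewrite -leq_sqr -expnM mulnC; apply: (@leq_trans (p ^ v.+1)).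
  by rewrite leq_pexp2l // ltnW.
apply: leq_trans v1 _; rewrite !expnMn leq_mul //.
by rewrite leq_mul // -[leqLHS]expn1 leq_pexp2l // ltnW.
Qed.

(** The terms equal to [p^i] number [O(H / p^i)] by [card_square_near], so each of
    the [e] possible values of [i] contributes [O(H)]. *)
Lemma sum_square_near (p H e : nat) (N : int) : prime p -> (0 < H)%N ->
  `|N| <= (4 * H ^ 2)%N%:Z -> (5 * p * H ^ 2 < p ^ e)%N ->
  (\sum_(c < (2 * H).+1 | ((c%:Z - H%:Z) ^+ 2 - N != 0)%R)
      p ^ uphalf (logn p `|((c%:Z - H%:Z) ^+ 2 - N)%R|) <= e * (14 * p * H))%N.
Proof.
move=> p_pr H0 NH eH; pose D (c : 'I_(2 * H).+1) : int := (c%:Z - H%:Z) ^+ 2 - N.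
pose u (c : 'I_(2 * H).+1) := uphalf (logn p `|D c|).
have cH (c : 'I_(2 * H).+1) : `|c%:Z - H%:Z| <= H%:Z by have := ltn_ord c; lia.
have vP c (D0 : D c != 0) := square_near_valuation p_pr NH (cH c) eH D0.
have e0 : (0 < e)%N by case: e eH {vP} => //; rewrite expn0; have := prime_gt1 p_pr; nia.
have ue c : D c != 0 -> (u c < e)%N.
  by move=> /vP[_ + _]; rewrite -/(D c) -/(u c); lia.
pose f c : 'I_e := insubd (Ordinal e0) (u c).
have fE c : D c != 0 -> f c = u c :> nat by move=> D0; rewrite /f val_insubd ue.
rewrite (partition_big f xpredT) //= -[X in (_ <= X * _)%N]card_ord -sum_nat_const.
apply: leq_sum => i _.
apply: (@leq_trans (\sum_(c in [set c : 'I_(2 * H).+1 | (D c != 0) && (u c == i)]) p ^ i)).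
  rewrite [leqRHS](eq_bigl (fun c => (D c != 0) && (f c == i))); last first.
    move=> c; rewrite inE; case: (boolP (D c != 0)) => //= D0.
    by rewrite -val_eqE /= fE.
  by apply: leq_sum => c /andP[D0 /eqP <-]; rewrite fE.
rewrite sum_nat_const; set S := [set _ | _].
have [->|[c]] := set_0Vmem S; first by rewrite cards0.
rewrite inE => /andP[/vP[_ _ +] /eqP ui]; rewrite -/(D c) -/(u c) ui => pi.
apply: leq_trans (leq_mul (card_square_near H i N p_pr) (leqnn _)) _.
have := leq_trunc_div (2 * H) (p ^ i); have := prime_gt1 p_pr; nia.
Qed.

(** * The field of p-adic numbers *)

Section PadicBasics.
Variables (R : realType) (p : nat) (p_pr : prime p).
Local Notation Qp := (@Qp R p p_pr).
Local Notation abs := (@padic_abs R p p_pr).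

Let pR_gt0 : 0 < p%:R :> R. Proof. by rewrite ltr0n prime_gt0. Qed.
Let pR_gt1 : 1 < p%:R :> R. Proof. by rewrite ltr1n prime_gt1. Qed.

Lemma ppow_gt0 e : 0 < p%:R ^- e :> R. Proof. by rewrite invr_gt0 exprn_gt0. Qed.

Lemma ppow_le e f : (e <= f)%N -> p%:R ^- f <= p%:R ^- e :> R.
Proof.
by move=> ef; rewrite lef_pV2 ?posrE ?exprn_gt0 // ler_weXn2l // ltW.
Qed.

Lemma ppow_lt e f : (p%:R ^- f < p%:R ^- e :> R) = (e < f)%N.
Proof. by rewrite ltf_pV2 ?posrE ?exprn_gt0 // ltr_eXn2l. Qed.

Lemma ppow_le1 e : p%:R ^- e <= 1 :> R.
Proof. by have := @ppow_le 0 e (leq0n e); rewrite expr0 invr1. Qed.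

Lemma ppow_lt1 e : (0 < e)%N -> p%:R ^- e < 1 :> R.
Proof. by move=> e0; rewrite invf_lt1 ?exprn_gt0 // exprn_egt1 // -lt0n. Qed.

Lemma padic_abs1 : abs 1 = 1.
Proof. by have := padic_abs_ratr R p_pr 1%:~R; rewrite ratr_int padic_absq1. Qed.

Lemma padic_absX x n : abs (x ^+ n) = abs x ^+ n.
Proof. by elim: n => [|n IH]; rewrite ?padic_abs1 // !exprS padic_absM IH. Qed.

Lemma padic_absB_sym x y : abs (x - y) = abs (y - x).
Proof. by rewrite -opprB padic_absN. Qed.

Lemma padic_absD_le x y e : abs x <= e -> abs y <= e -> abs (x + y) <= e.
Proof. by move=> xe ye; rewrite (le_trans (padic_absD x y)) // ge_max xe. Qed.

Lemma padic_absB_le x y e : abs x <= e -> abs y <= e -> abs (x - y) <= e.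
Proof. by move=> xe ye; rewrite padic_absD_le // padic_absN. Qed.

Lemma padic_absD_lt x y e : abs x < e -> abs y < e -> abs (x + y) < e.
Proof. by move=> xe ye; rewrite (le_lt_trans (padic_absD x y)) // gt_max xe. Qed.

Lemma padic_absB_lt x y e : abs x < e -> abs y < e -> abs (x - y) < e.
Proof. by move=> xe ye; rewrite padic_absD_lt // padic_absN. Qed.

Lemma padic_abs_eq0 x : (abs x == 0) = (x == 0).
Proof.
by apply/eqP/eqP => [/padic_abs0_eq0|->]; rewrite ?padic_abs0.
Qed.

Lemma padic_abs_gt0 x : x != 0 -> 0 < abs x.
Proof. by move=> x0; rewrite lt0r padic_abs_eq0 x0 padic_abs_ge0. Qed.

Lemma padic_absM_le x y e : 0 <= e -> abs x <= e -> abs y <= 1 -> abs (x * y) <= e.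
Proof.
move=> e0 xe y1; rewrite padic_absM -[leRHS]mulr1 ler_pM ?padic_abs_ge0 //.
Qed.

Lemma padic_absM_le1 x y : abs x <= 1 -> abs y <= 1 -> abs (x * y) <= 1.
Proof. by move=> x1 y1; rewrite padic_absM mulr_ile1 ?padic_abs_ge0. Qed.

Lemma padic_absV x : abs x^-1 = (abs x)^-1.
Proof.
have [->|x0] := eqVneq x 0; first by rewrite invr0 padic_abs0 invr0.
apply: (mulfI (x := abs x)); first by rewrite padic_abs_eq0.
by rewrite -padic_absM !divff ?padic_abs_eq0 // padic_abs1.
Qed.

Lemma padic_abs_intE (z : int) : z != 0 -> abs z%:~R = p%:R ^- logn p `|z|.
Proof.
move=> z0; rewrite -(@ratr_int Qp) padic_abs_ratr.
rewrite -[z%:~R]divr1 -[X in _ / X]/(1%:~R) padic_absq_frac //.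
by rewrite logn1 sub0r -exprnN.
Qed.

Lemma padic_abs_int (z : int) : abs z%:~R <= 1.
Proof.
have [->|z0] := eqVneq z 0; first by rewrite padic_abs0.
by rewrite padic_abs_intE // ppow_le1.
Qed.

Lemma padic_abs_int_dvd (z : int) e : (abs z%:~R <= p%:R ^- e) = (p%:Z ^+ e %| z)%Z.
Proof.
have [->|z0] := eqVneq z 0; first by rewrite padic_abs0 dvdz0 ltW // ppow_gt0.
rewrite padic_abs_intE // dvdzE abszX absz_nat pfactor_dvdn ?absz_gt0 //.
by rewrite leNgt ppow_lt -leqNgt.
Qed.

Lemma padic_abs_int_unit (z : int) : ~~ (p %| `|z|)%N -> abs z%:~R = 1.
Proof.
move=> pz; have z0 : z != 0 by apply: contraNneq pz => ->.
by rewrite padic_abs_intE // lognE (negPf pz) !andbF expr0 invr1.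
Qed.

Lemma padic_abs_p : abs p%:R = p%:R^-1.
Proof.
rewrite -[p%:R]/((p%:Z)%:~R) padic_abs_intE ?gt_eqF ?prime_gt0 //.
  by rewrite absz_nat logn_prime // eqxx expr1.
by rewrite ltz_nat prime_gt0.
Qed.

Lemma padic_abs_int_small (z : int) e : z != 0 -> `|z| < (p ^ e)%N%:Z ->
  p%:R ^- e < abs z%:~R.
Proof.
move=> z0 ze; rewrite ltNge padic_abs_int_dvd dvdzE abszX absz_nat.
by apply/negP => /dvdn_leq; rewrite absz_gt0 => /(_ z0); lia.
Qed.

Lemma ppow_small (e : R) : 0 < e -> exists n, p%:R ^- n < e.
Proof.
move=> e0; exists (Num.truncn e^-1); rewrite invf_plt ?posrE ?exprn_gt0 //.
apply: (lt_le_trans (truncnS_gt _)); rewrite -natrX ler_nat.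
exact/ltn_expl/prime_gt1.
Qed.

Lemma padic_nested (y m : nat -> nat) :
  (forall k, (m k < m k.+1)%N) -> (forall k, y k.+1 = y k %[mod p ^ m k]) ->
  exists xi : Qp, forall k, abs (xi - (y k)%:R) <= p%:R ^- m k.
Proof.
move=> m_inc y_mod.
have mk k : (k <= m k)%N by elim: k => // k IH; exact: leq_ltn_trans (m_inc k).
have mm k l : (k <= l)%N -> (m k <= m l)%N.
  by move=> kl; apply: (@homo_leq _ m (fun a b => a <= b)%N leqnn leq_trans) => // i; apply: ltnW.
have ykl k l : (k <= l)%N -> (y l = y k %[mod p ^ m k])%N.
  move=> kl; rewrite -(subnKC kl); elim: (l - k)%N => [|d IH]; first by rewrite addn0.
  rewrite addnS -IH; apply/eqP; rewrite -(modn_dvdm (m := p ^ m (k + d)%N)); last first.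
    by rewrite dvdn_exp2l // mm // leq_addr.
  by rewrite y_mod modn_dvdm // dvdn_exp2l // mm // leq_addr.
have ydist k l : (k <= l)%N -> abs ((y l)%:R - (y k)%:R) <= p%:R ^- m k.
  move=> kl; have -> : (y l)%:R - (y k)%:R = ((y l)%:Z - (y k)%:Z)%:~R :> Qp.
    by rewrite rmorphB.
  rewrite padic_abs_int_dvd -[X in (X %| _)%Z](_ : (p ^ m k)%N%:Z = _).
    by rewrite -eqz_mod_dvd !modz_nat eqz_nat; apply/eqP/ykl.
  by rewrite -[LHS]natz natrX natz.
pose u (k : nat) : rat := (y k)%:R.
have ratr_nat_abs k l : padic_absq R p (u k - u l) = abs ((y k)%:R - (y l)%:R).
  have -> : u k - u l = ((y k)%:Z - (y l)%:Z)%:~R by rewrite rmorphB.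
  by rewrite -padic_abs_ratr ratr_int rmorphB.
have cu : u \in @padic_cauchy R p p_pr.
  apply/padic_cauchyP => e e0; have [N Ne] := ppow_small e0.
  exists N => a b Na Nb; rewrite ratr_nat_abs.
  have le k : (N <= k)%N -> abs ((y k)%:R - (y N)%:R) <= p%:R ^- N.
    by move=> Nk; rewrite (le_trans (ydist _ _ Nk)) // ppow_le.
  apply: le_lt_trans Ne; rewrite -(subrKA (y N)%:R).
  by rewrite padic_absD_le ?le // padic_absB_sym le.
pose U : padic_cauchy_seq R p_pr := PadicCauchySeq cu.
exists (\pi_(Qp)%qT U) => k.
have pin (n : nat) : (\pi_(Qp)%qT (n%:R : padic_cauchy_seq R p_pr)) = n%:R :> Qp.
  by rewrite rmorph_nat.
have valn (n i : nat) : (n%:R : padic_cauchy_seq R p_pr) i = n%:R.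
  by elim: n => // n IH; rewrite !mulrSr -IH.
rewrite -pin -rmorphB /=.
have := @padic_abs_pi R p p_pr (U - (y k)%:R).
move/(cvg_lim (@Rhausdorff R)) => <-.
apply: limr_le.
  exact: padic_absq_cvg.
exists k => // l /= kl.
rewrite -[X in padic_absq _ _ X]/(u l - ((y k)%:R : padic_cauchy_seq R p_pr) l).
by rewrite valn -/(u k) ratr_nat_abs ydist.
Qed.

End PadicBasics.

(** * Integer polynomials at p-adic integers *)

Section PadicPolynomials.
Variables (R : realType) (p : nat) (p_pr : prime p).
Local Notation Qp := (@Qp R p p_pr).
Local Notation abs := (@padic_abs R p p_pr).
Local Notation ev P x := (map_poly (intr : int -> Qp) P).[x].

Lemma padic_ev_le1 (P : {poly int}) x : abs x <= 1 -> abs (ev P x) <= 1.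
Proof.
move=> x1; elim/poly_ind: P => [|P c IH].
  by rewrite rmorph0 horner0 padic_abs0.
rewrite rmorphD rmorphM /= map_polyX map_polyC /= !hornerE.
by apply: padic_absD_le; [exact: padic_absM_le1 | exact: padic_abs_int].
Qed.

Lemma padic_taylor (P : {poly int}) x y : abs x <= 1 -> abs y <= 1 ->
  exists2 S, abs S <= 1 & ev P y = ev P x + (y - x) * ev P^`() x + (y - x) ^+ 2 * S.
Proof.
move=> x1 y1; elim/poly_ind: P => [|P c [S S1 IH]].
  by exists 0; rewrite ?padic_abs0 // deriv0 rmorph0 !horner0 !mulr0 !addr0.
exists (S * y + ev P^`() x).
  by apply: padic_absD_le; [exact: padic_absM_le1 | exact: padic_ev_le1].
rewrite derivD derivM derivX derivC addr0 mulr1 !(rmorphD, rmorphM) /=.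
rewrite map_polyX map_polyC /= !hornerE IH; ring.
Qed.

Lemma padic_ev_lipschitz (P : {poly int}) x y : abs x <= 1 -> abs y <= 1 ->
  abs (ev P y - ev P x) <= abs (y - x).
Proof.
move=> x1 y1; have [S S1 E] := padic_taylor P x1 y1.
have -> : ev P y - ev P x = (y - x) * (ev P^`() x + (y - x) * S) by rewrite E; ring.
apply: padic_absM_le; [exact: padic_abs_ge0 | exact: lexx |].
apply: padic_absD_le; first exact: padic_ev_le1.
by apply: padic_absM_le1; first exact: padic_absB_le.
Qed.

(** Interpolation at the points of [s]: each of the successive divided
    differences costs a factor [d]. *)
Lemma padic_coef_small (Q : {poly Qp}) (s : seq Qp) (d e : R) :
  0 < d <= 1 -> 0 <= e -> (size Q <= size s)%N ->
  (forall x, x \in s -> abs x <= 1 /\ abs Q.[x] <= e) ->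
  pairwise (fun x y => d <= abs (x - y)) s ->
  forall i, abs Q`_i <= e / d ^+ (size s).-1.
Proof.
move=> /andP[d0 d1]; elim: s Q e => [|x s IH] Q e e0 sQ sP pw i.
  rewrite nth_default ?padic_abs0; first by rewrite divr_ge0 ?exprn_ge0 // ltW.
  by rewrite (leq_trans sQ).
have [x1 Qx] := sP x (mem_head _ _).
have dm m : e <= e / d ^+ m.
  by rewrite ler_pdivlMr ?exprn_gt0 // ler_piMr // exprn_ile1 // ltW.
have [s0|s0] := eqVneq s [::].
  have QC : Q = (Q`_0)%:P by apply: size1_polyC; move: sQ; rewrite s0.
  rewrite s0 /= expr0 divr1; move: Qx; rewrite {1}QC hornerC.
  case: i => [//|i _]; rewrite nth_default ?padic_abs0 //.
  by rewrite (leq_trans sQ) // s0.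
have /factor_theorem[Q1 QE] : root (Q - Q.[x]%:P) x.
  by rewrite rootE !hornerE subrr.
have QE' : Q = Q1 * ('X - x%:P) + Q.[x]%:P by rewrite -QE subrK.
have pws : pairwise (fun x y => d <= abs (x - y)) s by move: pw => /= /andP[].
have sQ1 : (size Q1 <= size s)%N.
  have [->|Q10] := eqVneq Q1 0; first by rewrite size_poly0.
  have : (size (Q1 * ('X - x%:P))%R <= (size s).+1)%N.
    rewrite -QE (leq_trans (size_polyD _ _)) // geq_max sQ size_polyN.
    by rewrite (leq_trans (size_polyC_leq1 _)).
  by rewrite size_Mmonic ?monicXsubC // size_XsubC addn2.
have ed0 : 0 <= e / d by rewrite divr_ge0 // ltW.
have c1 : forall j, abs Q1`_j <= e / d ^+ (size s).
  move=> j; have := IH Q1 (e / d) ed0 sQ1 _ pws j.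
  rewrite -mulrA -invfM -exprS prednK ?lt0n ?size_eq0 //; apply=> y ys.
  have [y1 Qy] := sP y (mem_behead (s := x :: s) ys); split=> //.
  have dxy : d <= abs (y - x).
    by move: pw => /= /andP[/allP/(_ _ ys)]; rewrite padic_absB_sym.
  have y_x : 0 < abs (y - x) by rewrite (lt_le_trans d0).
  have : abs (Q1.[y] * (y - x)) <= e.
    have -> : Q1.[y] * (y - x) = Q.[y] - Q.[x].
      by rewrite [in RHS]QE' !hornerE; ring.
    exact: padic_absB_le.
  rewrite padic_absM -ler_pdivlMr // => /le_trans; apply.
  by rewrite ler_wpM2l // lef_pV2.
rewrite QE' /= mulrBr coefD coefB coefMX coefMC coefC padic_absD_le //.
  rewrite padic_absB_le //; first by case: i => [|i] /=; rewrite ?padic_abs0 ?divr_ge0 ?exprn_ge0 // ltW.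
  by apply: padic_absM_le => //; rewrite divr_ge0 ?exprn_ge0 // ltW.
by case: i => [|i] /=; rewrite ?padic_abs0 ?(le_trans Qx) // divr_ge0 // exprn_ge0 // ltW.
Qed.

Lemma primitive_unit_coef (P : {poly int}) : zcontents P = 1 ->
  exists i, abs (P`_i)%:~R = 1.
Proof.
move=> P1; have [[i Pi]|nP] := pselect (exists i, ~~ (p %| `|(P`_i)%R|)%N).
  by exists i; rewrite padic_abs_int_unit.
have : (p%:Z %| zcontents P)%Z.
  rewrite dvdz_contents; apply/polyOverP => i; rewrite dvdzE /=.
  by apply: contrapT => /negP Pi; apply: nP; exists i.
rewrite P1 dvdz1 absz_nat => /eqP p1.
exfalso; have := prime_gt1 p_pr; lia.
Qed.

(** If [|x - y| < d] then [|P(x) - P(y)| = |x - y| |P'(x)|], which forces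
    [|x - y| <= e / d]. Points further apart than [e / d] are thus at distance at
    least [d], and a primitive polynomial is not small at more such points than its
    degree, by [padic_coef_small]. *)
Lemma padic_few_points (P : {poly int}) (s : seq Qp) (d e : R) :
  zcontents P = 1 -> (1 < size s)%N -> (size P <= size s)%N ->
  0 < d <= 1 -> 0 <= e < d ^+ (size s).-1 ->
  (forall x, x \in s ->
     [/\ abs x <= 1, abs (ev P x) <= e & d <= abs (ev P^`() x)]) ->
  ~ pairwise (fun x y => e / d < abs (x - y)) s.
Proof.
move=> P1 s1 sP /[dup] d01 /andP[d0 d1] /andP[e0 ed] sx pw.
have [i Pi] := primitive_unit_coef P1.
have := @padic_coef_small (map_poly intr P) s d e d01 e0.
move=> /(_ _ _ _ i) H.
have : abs (map_poly (intr : int -> Qp) P)`_i <= e / d ^+ (size s).-1.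
  apply: H.
  - exact: leq_trans (size_poly _ _) sP.
  - by move=> x /sx[].
  - apply/(pairwiseP 0) => a b /= asz bsz ab.
    have /(pairwiseP 0)/(_ a b asz bsz ab) /= := pw.
    have [x1 Px P'x] := sx _ (mem_nth 0 asz); have [y1 Py P'y] := sx _ (mem_nth 0 bsz).
    move: (nth 0 s a) (nth 0 s b) x1 Px P'x y1 Py P'y => x y x1 Px P'x y1 Py P'y exy.
    rewrite leNgt; apply/negP => xyd.
    have [S S1 E] := padic_taylor P x1 y1.
    have T : d <= abs (ev P^`() x + (y - x) * S).
      rewrite leNgt; apply/negP => lt.
      have : abs (ev P^`() x) < d.
        rewrite -[ev _ x](addrK ((y - x) * S)) padic_absB_lt //.
        rewrite padic_absM (le_lt_trans _ xyd) // padic_absB_sym ler_piMr ?padic_abs_ge0 //.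
      by rewrite ltNge P'x.
    have : abs ((y - x) * (ev P^`() x + (y - x) * S)) <= e.
      have -> : (y - x) * (ev P^`() x + (y - x) * S) = ev P y - ev P x by rewrite E; ring.
      exact: padic_absB_le.
    rewrite padic_absM padic_absB_sym => xe.
    move: exy; rewrite ltr_pdivrMr // ltNge => /negP; apply.
    by rewrite (le_trans _ xe) // ler_wpM2l ?padic_abs_ge0.
by rewrite coef_map Pi /= ler_pdivlMr ?exprn_gt0 // mul1r leNgt ed.
Qed.

(** A maximal family of points of [Z] at pairwise distance more than [r] gives the
    centres. *)
Lemma ultrametric_few_balls (Z : set Qp) (r : R) (k : nat) :
  (forall s : seq Qp, size s = k.+1 -> (forall x, x \in s -> Z x) ->
     ~ pairwise (fun x y => r < abs (x - y)) s) ->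
  exists s : seq Qp, (size s <= k)%N /\ forall x, Z x -> exists2 y, y \in s & abs (x - y) <= r.
Proof.
elim: k => [|k IH] few.
  exists [::]; split=> // x Zx; have := few [:: x] erefl; case=> // y.
  by rewrite inE => /eqP->.
have [|] := pselect (exists s : seq Qp, [/\ size s = k.+1, (forall x, x \in s -> Z x) &
    pairwise (fun x y => r < abs (x - y)) s]); last first.
  move=> nex; have [|s [sk sP]] := IH.
    by move=> s sk sZ pw; apply: nex; exists s.
  by exists s; split=> //; rewrite (leq_trans sk).
move=> [s [sk sZ pw]]; exists s; split; first by rewrite sk.
move=> x Zx; apply: contrapT => nx; apply: (few (x :: s)) => /=.
- by rewrite sk.
- by move=> y; rewrite inE => /orP[/eqP->//|/sZ].
- rewrite pw andbT; apply/allP => y ys; rewrite ltNge; apply/negP => le.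
  by apply: nx; exists y.
Qed.

End PadicPolynomials.

Local Open Scope classical_set_scope.
Local Open Scope ring_scope.

(** * Null sets *)

Section NullSets.
Variables (R : realType) (p : nat) (p_pr : prime p).
Local Notation Qp := (@Qp R p p_pr).
Local Notation abs := (@padic_abs R p p_pr).

(** For [s > 0] this is the vanishing of the [s]-dimensional Hausdorff measure,
    since small sums force small radii. Balls are open, so that radius 0 stands for
    the empty set and finite covers can be padded. *)
Definition null_set (s : R) (E : set Qp) : Prop :=
  forall eta : R, 0 < eta -> exists f : nat -> Qp * R,
    [/\ forall i, 0 <= (f i).2, forall N, \sum_(i < N) (f i).2 `^ s <= eta &
        forall x, E x -> exists i, abs (x - (f i).1) < (f i).2].

Definition coverable (s c : R) (E : set Qp) : Prop :=
  exists l : seq (Qp * R),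
    [/\ forall b, b \in l -> 0 <= b.2, \sum_(b <- l) b.2 `^ s <= c &
        forall x, E x -> exists2 b, b \in l & abs (x - b.1) < b.2].

Lemma coverable_sub s c c' (E F : set Qp) : E `<=` F -> c <= c' ->
  coverable s c F -> coverable s c' E.
Proof.
move=> EF cc [l [l0 lc lF]]; exists l; split=> //; first exact: le_trans cc.
by move=> x /EF/lF.
Qed.

Lemma coverable_bigU s (I : finType) (c : I -> R) (E : I -> set Qp) :
  (forall i, coverable s (c i) (E i)) ->
  coverable s (\sum_i c i) [set x | exists i, E i x].
Proof.
move=> cE; have /fin_all_exists[l lP] := cE.
exists (flatten [seq l i | i <- enum I]); split.
- by move=> b /flattenP[_ /mapP[i _ ->] bi]; have [+ _ _] := lP i; exact.
- rewrite big_flatten big_map big_enum /=; apply: ler_sum => i _.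
  by have [] := lP i.
- move=> x [i Eix]; have [_ _ /(_ x Eix)[b bi xb]] := lP i.
  by exists b => //; apply/flattenP; exists (l i) => //; rewrite map_f // mem_enum.
Qed.

Lemma coverableU s c d (E F : set Qp) : coverable s c E -> coverable s d F ->
  coverable s (c + d) [set x | E x \/ F x].
Proof.
move=> cE cF; have H b : coverable s (if b then c else d) (if b then E else F) by case: b.
have := coverable_bigU H; rewrite big_bool /=; apply: coverable_sub => //.
by move=> x [Ex|Fx]; [exists true|exists false].
Qed.

Lemma coverable_points s (r : R) (k : nat) (l : seq Qp) (Z : set Qp) : 0 <= r ->
  (size l <= k)%N -> (forall x, Z x -> exists2 y, y \in l & abs (x - y) < r) ->
  coverable s (k%:R * r `^ s) Z.
Proof.
move=> r0 lk lZ; exists [seq (y, r) | y <- l]; split.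
- by move=> b /mapP[y _ ->].
- rewrite big_map /= big_const_seq count_predT iter_addr_0 -[leLHS]mulr_natl.
  by rewrite ler_wpM2r ?powR_ge0 // ler_nat.
- by move=> x /lZ[y yl xy]; exists (y, r) => //; apply/mapP; exists y.
Qed.

Lemma null_set_sub s (E F : set Qp) : E `<=` F -> null_set s F -> null_set s E.
Proof.
move=> EF nF eta /nF[f [f0 fs fF]]; exists f; split=> // x /EF; exact: fF.
Qed.

(** A double sequence of balls is enumerated through the coding of pairs; the
    indices that code no pair receive an empty ball. *)
Lemma double_cover s (eta : R) (E : set Qp) (f : nat -> nat -> Qp * R) : s != 0 ->
  (forall a b, 0 <= (f a b).2) ->
  (forall M N, \sum_(a < M) \sum_(b < N) (f a b).2 `^ s <= eta) ->
  (forall x, E x -> exists a b, abs (x - (f a b).1) < (f a b).2) ->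
  exists g : nat -> Qp * R,
    [/\ forall i, 0 <= (g i).2, forall N, \sum_(i < N) (g i).2 `^ s <= eta &
        forall x, E x -> exists i, abs (x - (g i).1) < (g i).2].
Proof.
move=> s0 f0 fs fE.
pose g j : Qp * R := if pickle_inv (j : nat) is Some ab then f ab.1 ab.2 else (0, 0).
have gE a b : g (pickle (a, b)) = f a b by rewrite /g pickleK_inv.
exists g; split.
- by move=> i; rewrite /g; case: pickle_inv.
- move=> N.
  pose h (j : 'I_N) : nat :=
    if (pickle_inv (j : nat) : option (nat * nat)) is Some ab then maxn ab.1 ab.2 else 0%N.
  pose M := (\max_(j < N) h j).+1.
  apply: le_trans (fs M M).
  have gj (j : 'I_N) : (g j).2 `^ s = \sum_(a < M) \sum_(b < M)
      (if pickle (a : nat, b : nat) == j then (f a b).2 `^ s else 0).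
    have : (h j < M)%N by rewrite ltnS; exact: (leq_bigmax j).
    rewrite /h /g; case Ep : (pickle_inv _) => [[a b]|] /=.
      rewrite gtn_max => /andP[aM bM].
      rewrite (bigD1 (Ordinal aM)) //= (bigD1 (Ordinal bM)) //=.
      have Ej : pickle (a, b) = j by have := @pickle_invK (nat * nat)%type j; rewrite /oapp Ep.
      rewrite Ej eqxx !big1 ?addr0 // => [c ca|c cb].
        rewrite big1 // => d _; case: eqP => // e.
        move: ca; rewrite -val_eqE /=; have : pickle (c : nat, d : nat) = pickle (a, b) by rewrite e.
        by move/(pcan_inj pickleK_inv) => -[-> _]; rewrite eqxx.
      case: eqP => // e.
      move: cb; rewrite -val_eqE /=; have : pickle (a, c : nat) = pickle (a, b) by rewrite Ej e.
      by move/(pcan_inj pickleK_inv) => -[->]; rewrite eqxx.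
    move=> _; rewrite powR0 // big1 // => a _; rewrite big1 // => b _.
    by case: eqP => // e; move: Ep; rewrite -e pickleK_inv.
  under eq_bigr do rewrite gj.
  rewrite exchange_big /=; apply: ler_sum => a _.
  rewrite exchange_big /=; apply: ler_sum => b _.
  have [lt|ge] := ltnP (pickle (a : nat, b : nat)) N.
    rewrite (bigD1 (Ordinal lt)) //= eqxx big1 ?addr0 // => j; rewrite -val_eqE /= => /negPf.
    by rewrite eq_sym => ->.
  rewrite big1 ?powR_ge0 // => j _; case: eqP => // e.
  by move: (ltn_ord j); rewrite -e ltnNge ge.
- by move=> x /fE[a [b xab]]; exists (pickle (a, b)); rewrite gE.
Qed.

Lemma sum_half_le (eta : R) N : 0 < eta -> \sum_(i < N) eta / 2 ^+ i.+1 <= eta.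
Proof.
move=> e0; suff -> : \sum_(i < N) eta / 2 ^+ i.+1 = eta - eta / 2 ^+ N.
  by rewrite gerBl divr_ge0 ?exprn_ge0 // ltW.
elim: N => [|N IH]; first by rewrite big_ord0 expr0 divr1 subrr.
rewrite big_ord_recr /= IH exprS; field.
by rewrite expf_neq0.
Qed.

Lemma null_bigU s (E : nat -> set Qp) : s != 0 -> (forall i, null_set s (E i)) ->
  null_set s [set x | exists i, E i x].
Proof.
move=> s0 nE eta e0.
have ex i : exists f : nat -> Qp * R,
    [/\ forall j, 0 <= (f j).2, forall N, \sum_(j < N) (f j).2 `^ s <= eta / 2 ^+ i.+1 &
        forall x, E i x -> exists j, abs (x - (f j).1) < (f j).2].
  by apply: nE; rewrite divr_gt0 // exprn_gt0.
have [f fP] := choice ex.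
apply: (@double_cover s eta _ f) => //.
- by move=> a b; have [+ _ _] := fP a; exact.
- move=> M N; apply: le_trans (sum_half_le M e0); apply: ler_sum => a _.
  by have [_ + _] := fP a; exact.
- by move=> x [i Ei]; have [_ _ /(_ x Ei)[j xj]] := fP i; exists i, j.
Qed.

Lemma null_setU s (E F : set Qp) : s != 0 -> null_set s E -> null_set s F ->
  null_set s (E `|` F).
Proof.
move=> s0 nE nF.
have H i : null_set s (if i is 0%N then E else F) by case: i.
apply: null_set_sub (null_bigU s0 H) => x [Ex|Fx]; [by exists 0%N|by exists 1%N].
Qed.

Lemma null_countable s (g : nat -> Qp) : 0 < s -> null_set s [set x | exists i, x = g i].
Proof.
move=> s0 eta e0; exists (fun i => (g i, (eta / 2 ^+ i.+1) `^ s^-1)); split=> /=.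
- by move=> i; exact: powR_ge0.
- move=> N; apply: le_trans (sum_half_le N e0); apply: ler_sum => i _.
  rewrite -powRrM mulVf ?gt_eqF // powRr1 // divr_ge0 ?exprn_ge0 // ltW //.
- move=> x [i ->]; exists i; rewrite subrr padic_abs0 powR_gt0 //.
  by rewrite divr_gt0 // exprn_gt0.
Qed.

(** Borel-Cantelli: the tails of a geometric series are small. *)
Lemma null_limsup s (C r : R) (F : nat -> set Qp) : s != 0 -> 0 <= r < 1 -> 0 <= C ->
  (exists e0, forall e, (e0 <= e)%N -> coverable s (C * r ^+ e) (F e)) ->
  null_set s [set x | forall N, exists2 e, (N <= e)%N & F e x].
Proof.
move=> s0 /andP[r0 r1] C0 [e0 cF] eta eta0.
have [N0 N0P] : exists N0, C * r ^+ N0 / (1 - r) <= eta.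
  have : C / (1 - r) * r ^+ n @[n --> \oo] --> C / (1 - r) * 0.
    by apply: cvgMr; apply: cvg_expr; rewrite ger0_norm.
  rewrite mulr0 => /cvgrPdist_lt/(_ _ eta0)[N0 _ /(_ N0 (leqnn _))] H.
  exists N0; move: H; rewrite /= sub0r normrN ger0_norm; last first.
    by rewrite mulr_ge0 ?exprn_ge0 // divr_ge0 // subr_ge0 ltW.
  by move/ltW; rewrite mulrAC.
pose E1 := maxn e0 N0.
have ex a : exists l : seq (Qp * R),
    [/\ forall b, b \in l -> 0 <= b.2, \sum_(b <- l) b.2 `^ s <= C * r ^+ (E1 + a) &
        forall x, F (E1 + a)%N x -> exists2 b, b \in l & abs (x - b.1) < b.2].
  by apply: cF; rewrite (leq_trans (leq_maxl e0 N0)) // leq_addr.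
have [l lP] := choice ex.
pose f a b : Qp * R := nth (0, 0) (l a) b.
apply: (@double_cover s eta _ f) => //.
- move=> a b; rewrite /f; have [bl|lb] := ltnP b (size (l a)).
    by have [+ _ _] := lP a; apply; rewrite mem_nth.
  by rewrite nth_default.
- move=> M N; apply: le_trans N0P.
  apply: le_trans (_ : \sum_(a < M) C * r ^+ (E1 + a) <= _).
    apply: ler_sum => a _; have [l0 ls _] := lP a; apply: le_trans ls.
    rewrite -(big_mkord xpredT (fun b => (f a b).2 `^ s)).
    rewrite (big_nth (0, 0)) -/(f a).
    have [NL|LN] := leqP N (size (l a)).
      rewrite [leRHS](big_cat_nat _ NL) //= lerDl.
      by apply: sumr_ge0 => b _; exact: powR_ge0.
    rewrite (big_cat_nat _ (ltnW LN)) //= [X in _ + X](_ : _ = 0) ?addr0 //.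
    rewrite big_nat_cond big1 // => b; rewrite andbT => /andP[lb _].
    by rewrite /f nth_default //= powR0.
  have geo : \sum_(a < M) r ^+ a <= (1 - r)^-1.
    have -> : \sum_(a < M) r ^+ a = (1 - r ^+ M) / (1 - r).
      apply: (mulIf (x := 1 - r)); first by rewrite subr_eq0 gt_eqF.
      rewrite divfK ?subr_eq0 ?gt_eqF //.
      by rewrite -[1 - r]opprB mulrN mulrC -subrX1 opprB.
    apply: ler_piMl; first by rewrite invr_ge0 subr_ge0 ltW.
    by rewrite gerBl exprn_ge0.
  under eq_bigr do rewrite exprD mulrA.
  rewrite -mulr_sumr ler_pM ?mulr_ge0 ?exprn_ge0 //.
    by apply: sumr_ge0 => a _; rewrite exprn_ge0.
  by apply: ler_wpM2l => //; apply: ler_wiXn2l => //; [exact: ltW|exact: leq_maxr].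
- move=> x /(_ E1)[e Ee Fx]; have := lP (e - E1)%N; rewrite subnKC // => -[_ _ /(_ x Fx)[b bl xb]].
  by exists (e - E1)%N, (index b (l (e - E1)%N)); rewrite /f nth_index.
Qed.

Lemma null_scale s (t : nat) (E : set Qp) : null_set s E ->
  null_set s [set x | E (p%:R ^+ t * x)].
Proof.
move=> nE eta eta0.
have P0 : 0 < p%:R ^+ t :> R by rewrite exprn_gt0 // ltr0n prime_gt0.
have Ps0 : 0 < (p%:R ^+ t) `^ s by rewrite powR_gt0.
have [f [f0 fs fE]] := nE (eta / (p%:R ^+ t) `^ s) (divr_gt0 eta0 Ps0).
exists (fun i => ((f i).1 / p%:R ^+ t, p%:R ^+ t * (f i).2)); split=> /=.
- by move=> i; rewrite mulr_ge0 // ltW.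
- move=> N; under eq_bigr do rewrite powRM ?(ltW P0) //.
  by rewrite -mulr_sumr mulrC -ler_pdivlMr ?fs.
- move=> x /fE[i xi]; exists i.
  have aP : abs (p%:R ^+ t) = (p%:R ^+ t)^-1 by rewrite padic_absX padic_abs_p exprVn.
  have pt0 : p%:R ^+ t != 0 :> Qp by rewrite -padic_abs_eq0 aP invr_eq0 gt_eqF.
  have -> : x - (f i).1 / p%:R ^+ t = (p%:R ^+ t)^-1 * (p%:R ^+ t * x - (f i).1).
    by rewrite mulrBr mulKf // mulrC.
  by rewrite padic_absM padic_absV aP invrK ltr_pM2l.
Qed.

End NullSets.

(** * Comparison with Hausdorff measures *)

Section HausdorffNull.
Variables (R : realType) (p : nat) (p_pr : prime p).
Local Notation Qp := (@Qp R p p_pr).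
Local Notation abs := (@padic_abs R p p_pr).
Local Open Scope ereal_scope.

Lemma diameter_ge0 (U : set Qp) : U !=set0 -> 0 <= diameter U.
Proof.
move=> [x Ux]; apply: ereal_sup_ubound; exists x => //; exists x => //.
by rewrite mdistxx.
Qed.

Lemma diameter_pow_ge0 s (U : set Qp) : 0 <= diameter_pow s U.
Proof. by rewrite /diameter_pow; case: ifP => // _; exact: poweR_ge0. Qed.

Lemma diameter_ball (x : Qp) (r : R) : (0 <= r)%R ->
  diameter [set y : Qp | (abs (y - x) < r)%R] <= r%:E.
Proof.
move=> r0; apply: ge_ereal_sup => _ [y /= yx [z /= zx <-]].
rewrite lee_fin -[mdist y z]/(abs (y - z)%R) -(subrKA x).
by rewrite ltW // padic_absD_lt // padic_absB_sym.
Qed.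

(** A ball of a cover with [sum r_i^s <= delta^s] has radius, hence diameter, at
    most [delta]. *)
Lemma hausdorff_null s (E : set Qp) : (0 < s)%R -> null_set s E ->
  hausdorff_measure s E = 0.
Proof.
move=> s0 nE; apply/eqP; rewrite eq_le; apply/andP; split; last first.
  apply: (@le_trans _ _ (hausdorff_premeasure s 1 E)).
    apply: le_ereal_inf_tmp => _ [U _ <-].
    by apply: nneseries_ge0 => i _ _; exact: diameter_pow_ge0.
  by apply: ereal_sup_ubound; exists 1%R => //=.
apply: ge_ereal_sup => _ [delta /= d0 <-].
apply/lee_addgt0Pr => eta eta0; rewrite add0e.
have m0 : (0 < Num.min eta (delta `^ s))%R by rewrite lt_min eta0 powR_gt0.
have [f [f0 fs fE]] := nE _ m0.
pose U i : set Qp := [set y : Qp | (abs (y - (f i).1) < (f i).2)%R].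
have rd i : ((f i).2 <= delta)%R.
  have : ((f i).2 `^ s <= delta `^ s)%R.
    apply: le_trans (_ : Num.min eta (delta `^ s) <= _)%R; last by rewrite ge_min lexx orbT.
    apply: le_trans (fs i.+1); rewrite big_ord_recr /= lerDr.
    by apply: sumr_ge0 => j _; exact: powR_ge0.
  rewrite !leNgt; apply: contra => lt.
  by apply: gt0_ltr_powR => //; rewrite nnegrE // ltW.
apply: (@le_trans _ _ (\sum_(0 <= i <oo) diameter_pow s (U i))).
  apply: ereal_inf_lbound; exists U => //; split.
    by move=> x /fE[i xi]; exists i.
  move=> i; apply: le_trans (diameter_ball _ (f0 i)) _.
  by rewrite lee_fin.
have Ur i : diameter_pow s (U i) <= ((f i).2 `^ s)%:E.
  rewrite /diameter_pow; case: ifPn => [_|/set0P U0]; first by rewrite lee_fin powR_ge0.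
  rewrite -poweR_EFin gt0_ler_poweR ?(ltW s0) //.
  - by rewrite in_itv /= diameter_ge0 //= leey.
  - by rewrite in_itv /= lee_fin f0 leey.
  - exact: diameter_ball.
apply: lime_le; first by apply: is_cvg_nneseries => i _ _; exact: diameter_pow_ge0.
apply: nearW => N; apply: (@le_trans _ _ (\sum_(0 <= i < N) ((f i).2 `^ s)%:E)).
  by apply: lee_sum => i _; exact: Ur.
rewrite sumEFin lee_fin big_mkord; apply: le_trans (fs N) _.
by rewrite ge_min lexx.
Qed.

(** Each piece of diameter [D <= 1] is replaced by an open ball around one of its
    points, with radius [r] slightly above [D]: [r^s] exceeds [D^s], which is at most
    [D^s'], by a term of a series with sum [eta / 2]. *)
Lemma null_hausdorff s' s (E : set Qp) : (0 <= s' <= s)%R -> (0 < s)%R ->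
  hausdorff_measure s' E = 0 -> null_set s E.
Proof.
move=> /andP[s'0 s's] s0 mE eta eta0.
have pm : hausdorff_premeasure s' 1 E < (eta / 2)%:E.
  apply: (@le_lt_trans _ _ 0); last by rewrite lte_fin divr_gt0.
  by rewrite -mE; apply: ereal_sup_ubound; exists 1%R => //=.
have [_ [U [EU dU] <-] sU] := ereal_inf_lt pm.
have ex i : exists b : Qp * R, [/\ (0 <= b.2)%R,
    (b.2 `^ s)%:E <= diameter_pow s' (U i) + (eta / 2 / 2 ^+ i.+1)%:E &
    forall x, U i x -> (abs (x - b.1) < b.2)%R].
  have q0 : (0 < eta / 2 / 2 ^+ i.+1)%R by rewrite !divr_gt0 // exprn_gt0.
  have [U0|/set0P[x0 Ux0]] := eqVneq (U i) set0.
    exists (0%R, 0%R); split=> //=; last by rewrite U0.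
    rewrite powR0 ?gt_eqF // /diameter_pow U0 eqxx add0e lee_fin ltW //.
  have di : diameter (U i) \is a fin_num.
    rewrite fin_numE; apply/andP; split; apply/eqP => e.
      by have := @diameter_ge0 (U i) (ex_intro _ x0 Ux0); rewrite e leeNy_eq.
    by have := dU i; rewrite e leye_eq.
  pose d := fine (diameter (U i)).
  have dE : diameter (U i) = d%:E by rewrite fineK.
  have d0 : (0 <= d)%R.
    by rewrite -lee_fin -dE diameter_ge0 //; exists x0.
  have d1 : (d <= 1)%R by rewrite -lee_fin -dE.
  have b0 : (0 <= d `^ s + eta / 2 / 2 ^+ i.+1)%R.
    by rewrite addr_ge0 ?powR_ge0 // ltW.
  exists (x0, ((d `^ s + eta / 2 / 2 ^+ i.+1) `^ s^-1)%R); split=> /=.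
  - exact: powR_ge0.
  - rewrite -powRrM mulVf ?gt_eqF // powRr1 // EFinD leeD2r //.
    rewrite /diameter_pow ifF; last by apply/negbTE/set0P; exists x0.
    rewrite dE lee_fin; have [->|dN0] := eqVneq d 0%R.
      by rewrite powR0 ?gt_eqF // powR_ge0.
    by apply: ger_powR => //; rewrite lt0r dN0 d0.
  - move=> x Ux; apply: (@le_lt_trans _ _ d).
      rewrite -lee_fin -dE; apply: ereal_sup_ubound.
      by exists x => //; exists x0.
    have dd : d = ((d `^ s) `^ s^-1)%R by rewrite -powRrM mulfV ?gt_eqF // powRr1.
    rewrite {1}dd; apply: gt0_ltr_powR; rewrite ?invr_gt0 ?nnegrE ?powR_ge0 //.
    by rewrite ltrDl.
have [f fP] := choice ex.
exists f; split.
- by move=> i; have [] := fP i.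
- move=> N; rewrite -lee_fin -sumEFin.
  apply: (@le_trans _ _ (\sum_(i < N) (diameter_pow s' (U i) + (eta / 2 / 2 ^+ i.+1)%:E))).
    by apply: lee_sum => i _; have [] := fP i.
  rewrite big_split /= sumEFin [in leRHS](splitr eta) EFinD leeD //.
    rewrite -(big_mkord xpredT (fun i => diameter_pow s' (U i))).
    apply: le_trans (ltW sU); apply: nneseries_lim_ge => i _ _.
    exact: diameter_pow_ge0.
  by rewrite lee_fin sum_half_le // divr_gt0.
- move=> x /EU[i _ Uix]; exists i; have [_ _] := fP i; exact.
Qed.

End HausdorffNull.

(** * Covers of the points where a polynomial of bounded height is small *)

Lemma shift_ord (H : nat) (z : int) : `|z| <= H%:Z ->
  exists c : 'I_(2 * H).+1, z = c%:Z - H%:Z.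
Proof.
move=> zH; have e1 : (`|(z + H%:Z)%R| < (2 * H).+1)%N by lia.
by exists (Ordinal e1) => /=; lia.
Qed.

(** The shift of the coefficients by [H] makes the polynomials of height at most
    [H] the values of a function on a finite type. *)
Definition shift_poly (k H : nat) (f : {ffun 'I_k -> 'I_(2 * H).+1}) : {poly int} :=
  \poly_(i < k) (if insub i is Some j then (f j)%:Z - H%:Z else 0).

Lemma shift_polyP (k H : nat) (P : {poly int}) : (size P <= k)%N ->
  (forall i, `|P`_i| <= H%:Z) -> exists f : {ffun 'I_k -> 'I_(2 * H).+1}, P = shift_poly f.
Proof.
move=> sP PH; exists [ffun j : 'I_k => inord `|P`_j + H%:Z|].
apply/polyP => i; rewrite coef_poly; case: ltnP => [ik|ki]; last first.
  by rewrite nth_default // (leq_trans sP).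
rewrite insubT ffunE /= inordK; move: (PH i); move: (P`_i) => c; lia.
Qed.

Section PolynomialCovers.
Variables (R : realType) (p : nat) (p_pr : prime p).
Local Notation Qp := (@Qp R p p_pr).
Local Notation abs := (@padic_abs R p p_pr).
Local Notation ev P x := (map_poly (intr : int -> Qp) P).[x].

Let pR_gt0 : 0 < p%:R :> R. Proof. by rewrite ltr0n prime_gt0. Qed.
Let pR_gt1 : 1 < p%:R :> R. Proof. by rewrite ltr1n prime_gt1. Qed.

Definition small_values (k H e : nat) : set Qp :=
  [set xi | abs xi <= 1 /\ exists P : {poly int},
     [/\ zcontents P = 1, (size P <= k.+1)%N, forall i, `|P`_i| <= H%:Z &
         abs (ev P xi) <= p%:R ^- e]].

(** [padic_few_points] allows at most [k] points at pairwise distance more than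
    [p^(i - e)]; the radius has one more factor [p] because the balls are open. *)
Lemma cover_poly s (P : {poly int}) (k e i : nat) :
  zcontents P = 1 -> (size P <= k.+1)%N -> (0 < k)%N -> (k * i < e)%N ->
  coverable s (k%:R * (p%:R ^+ i.+1 * p%:R ^- e) `^ s)
    [set xi : Qp | [/\ abs xi <= 1, abs (ev P xi) <= p%:R ^- e &
        p%:R ^- i <= abs (ev P^`() xi)]].
Proof.
move=> P1 sP k0 kie; set Z := [set _ | _].
have [|l [lk lZ]] := @ultrametric_few_balls R p p_pr Z (p%:R ^- e / p%:R ^- i) k.
  move=> l lk lZ; apply: (@padic_few_points R p p_pr P l (p%:R ^- i) (p%:R ^- e)) => //.
  - by rewrite lk.
  - by rewrite lk.
  - by rewrite ppow_gt0 // ppow_le1.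
  - have dE : (p%:R ^- i) ^+ k = p%:R ^- (k * i) :> R by rewrite mulnC exprM exprVn.
    by rewrite lk (ltW (ppow_gt0 _ _ _)) //= dE ppow_lt.
have r0 : 0 <= p%:R ^+ i.+1 * p%:R ^- e :> R.
  by rewrite mulr_ge0 ?exprn_ge0 ?(ltW (ppow_gt0 _ _ _)) // ltW.
apply: (@coverable_points R p p_pr s _ k l Z) => //.
move=> x /lZ[y yl xy]; exists y => //; apply: le_lt_trans xy _.
rewrite invrK mulrC exprS -mulrA ltr_pMl // mulr_gt0 ?exprn_gt0 // ppow_gt0 //.
Qed.

(** If a primitive [P] of degree at most 1 is small at an integral point then its
    leading coefficient is a unit, and one ball suffices. *)
Lemma cover_linear s (H e : nat) : (0 < e)%N ->
  coverable s ((2 * H).+1%:R ^+ 2 * (p%:R * p%:R ^- e) `^ s) (small_values 1 H e).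
Proof.
move=> e0.
have c (f : {ffun 'I_2 -> 'I_(2 * H).+1}) :
  coverable s ((p%:R * p%:R ^- e) `^ s)
    [set xi : Qp | [/\ abs xi <= 1, zcontents (shift_poly f) = 1 &
       abs (ev (shift_poly f) xi) <= p%:R ^- e]].
  have [f1|f1] := eqVneq (zcontents (shift_poly f)) 1; last first.
    exists [::]; split=> //; first by rewrite big_nil powR_ge0.
    by move=> x [_ /eqP]; rewrite (negPf f1).
  have sf : (size (shift_poly f) <= 2)%N by exact: size_poly.
  have := @cover_poly s (shift_poly f) 1 e 0 f1 sf isT; rewrite muln0 expr1 mul1r => /(_ e0).
  apply: coverable_sub => // x [x1 _ fx]; split=> //.
  rewrite expr0 invr1; have [i fi] := primitive_unit_coef R p_pr f1.
  move: fx fi; set P := shift_poly f in sf f1 *; rewrite (horner_coef_wide _ (leq_trans (size_poly _ _) sf)).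
  have P' : P^`() = (P`_1)%:P.
    apply/polyP => -[|j]; rewrite coef_deriv coefC //= ?mulr1n //.
    by rewrite nth_default ?mul0rn // (leq_trans sf).
  rewrite P' map_polyC hornerC /= !big_ord_recl big_ord0 /= !coef_map /= expr0 mulr1 addr0 expr1 => fx.
  (* As [P(x)] is small, a unit constant coefficient makes the linear one a unit. *)
  case: i => [|[|i]] fi; [|by rewrite fi|]; last first.
    move: fi; rewrite nth_default ?(leq_trans sf) // padic_abs0 => /eqP.
    by rewrite eq_sym oner_eq0.
  rewrite leNgt; apply/negP => lt.
  have : abs (P`_0)%:~R < 1.
    rewrite -[_%:~R](addrK ((P`_1)%:~R * x)); apply: padic_absB_lt.
      by rewrite (le_lt_trans fx) // -[ltRHS]invr1 -[X in _ < X^-1](expr0 p%:R) ppow_lt.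
    by rewrite padic_absM (le_lt_trans _ lt) // ler_piMr ?padic_abs_ge0.
  by rewrite fi ltxx.
have := coverable_bigU c; rewrite sumr_const card_ffun !card_ord -[X in coverable _ X]mulr_natl natrX.
apply: coverable_sub => // x [x1 [P [P1 sP PH Px]]].
have [f fE] := shift_polyP sP PH.
by exists f; rewrite -fE.
Qed.

End PolynomialCovers.

Lemma horner_quadratic (F : comNzRingType) (P : {poly int}) (x : F) : (size P <= 3)%N ->
  (map_poly intr P).[x] = (P`_0)%:~R + (P`_1)%:~R * x + (P`_2)%:~R * x ^+ 2.
Proof.
move=> sP; rewrite (horner_coef_wide _ (leq_trans (size_poly _ _) sP)).
rewrite !big_ord_recl big_ord0 /= !coef_map /= /bump /=; ring.
Qed.

Lemma horner_deriv_quadratic (F : comNzRingType) (P : {poly int}) (x : F) : (size P <= 3)%N ->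
  (map_poly intr P^`()).[x] = (P`_1)%:~R + 2 * (P`_2)%:~R * x.
Proof.
move=> sP; have sP' : (size P^`() <= 2)%N.
  apply/leq_sizeP => j j2; rewrite coef_deriv nth_default ?mul0rn //.
  by rewrite (leq_trans sP).
rewrite (horner_coef_wide _ (leq_trans (size_poly _ _) sP')).
rewrite !big_ord_recl big_ord0 /= !coef_map /= /bump /= !coef_deriv /=; ring.
Qed.

Section QuadraticCover.
Variables (R : realType) (p : nat) (p_pr : prime p).
Local Notation Qp := (@Qp R p p_pr).
Local Notation abs := (@padic_abs R p p_pr).
Local Notation ev P x := (map_poly (intr : int -> Qp) P).[x].

Let pR_gt0 : 0 < p%:R :> R. Proof. by rewrite ltr0n prime_gt0. Qed.
Let pR_gt1 : 1 < p%:R :> R. Proof. by rewrite ltr1n prime_gt1. Qed.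

(** The discriminant [D] equals [P'^2 - 4 P_2 P], so [|P'(xi)|^2 = |D|] at the
    points where [P] is small, and [P] contributes two balls of radius about
    [p^(-e) |D|^(-1/2)]. By [sum_square_near] the values [|D|^(-1/2)], summed over the
    middle coefficient, amount to [O(e H)]: on average [P'(xi)] is a unit. *)
Lemma cover_quadratic_slice s (H e : nat) (a b : int) : 0 <= s <= 1 -> (0 < H)%N ->
  (5 * p * H ^ 2 < p ^ e)%N -> `|a| <= H%:Z -> `|b| <= H%:Z ->
  coverable s (2 * (p%:R * p%:R ^- e) `^ s * (e * (14 * p * H))%:R)
    [set xi : Qp | exists P : {poly int}, [/\ abs xi <= 1 /\ zcontents P = 1,
       (size P <= 3)%N /\ `|P`_1| <= H%:Z, (P`_0 = a /\ P`_2 = b),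
       P`_1 ^+ 2 - 4 * a * b != 0 & abs (ev P xi) <= p%:R ^- e]].
Proof.
move=> /andP[s0 s1] H0 eH aH bH.
pose N := 4 * a * b.
have NH : `|N| <= (4 * H ^ 2)%N%:Z.
  rewrite /N -mulrA normrM PoszM ler_pM // normrM -mulnn PoszM.
  by rewrite ler_pM.
pose D (c : 'I_(2 * H).+1) := (c%:Z - H%:Z) ^+ 2 - N.
pose u (c : 'I_(2 * H).+1) := uphalf (logn p `|D c|).
pose w c : R := if D c != 0 then 2 * (p%:R * p%:R ^- e) `^ s * (p ^ u c)%:R else 0.
have pe0 : 0 < p%:R * p%:R ^- e :> R by rewrite mulr_gt0 ?ppow_gt0.
have cov (c : 'I_(2 * H).+1) : coverable s (w c)
    [set xi : Qp | exists P : {poly int}, [/\ abs xi <= 1 /\ zcontents P = 1,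
       (size P <= 3)%N /\ P`_1 = c%:Z - H%:Z, (P`_0 = a /\ P`_2 = b),
       D c != 0 & abs (ev P xi) <= p%:R ^- e]].
  rewrite /w; have [D0|D0] := boolP (D c != 0); last first.
    by exists [::]; split=> //; [rewrite big_nil|move=> x [P []]].
  have cH : `|c%:Z - H%:Z| <= H%:Z by have := ltn_ord c; lia.
  have [ve ue uH] := square_near_valuation p_pr NH cH eH D0.
  pose P := Poly [:: a; c%:Z - H%:Z; b].
  have sP : (size P <= 3)%N by exact: (size_Poly [:: a; c%:Z - H%:Z; b]).
  have [P1|P1] := eqVneq (zcontents P) 1; last first.
    exists [::]; split=> //.
      by rewrite big_nil !mulr_ge0 ?powR_ge0 ?ler0n.
    move=> x [P' [[_ P'1] [sP' E1] [E0 E2] _ _]]; case/eqP: P1.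
    rewrite -P'1; congr zcontents; apply/polyP => i; rewrite coef_Poly.
    by case: i => [|[|[|i]]] //=; rewrite nth_nil nth_default // (leq_trans sP').
  have := @cover_poly R p p_pr s P 2 e (u c) P1 sP isT ue.
  apply: coverable_sub.
    move=> x [P' [[x1 P'1] [sP' E1] [E0 E2] _ Px]].
    have PP' : P = P'.
      apply/polyP => i; rewrite coef_Poly.
      by case: i => [|[|[|i]]] //=; rewrite nth_nil nth_default // (leq_trans sP').
    rewrite -PP' in Px; split=> //.
    rewrite leNgt; apply/negP => lt.
    have : abs (D c)%:~R < p%:R ^- logn p `|D c|.
      have -> : (D c)%:~R = ev P^`() x ^+ 2 - 4 * b%:~R * ev P x :> Qp.
        rewrite (horner_quadratic x sP) (horner_deriv_quadratic x sP) !coef_Poly /= /D /N.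
        by rewrite !(rmorphB, rmorphM, rmorphXn) /=; ring.
      apply: padic_absB_lt.
        rewrite padic_absX; apply: (@lt_le_trans _ _ ((p%:R ^- u c) ^+ 2)).
          by rewrite ltrXn2r ?padic_abs_ge0.
        have -> : (p%:R ^- u c) ^+ 2 = p%:R ^- (u c * 2) :> R by rewrite exprM exprVn.
        by apply: ppow_le => //; rewrite /u muln2 uphalfK leq_addl.
      apply: (@le_lt_trans _ _ (p%:R ^- e)); last by rewrite ppow_lt.
      rewrite mulrC; apply: padic_absM_le Px _; first exact: (ltW (ppow_gt0 _ p_pr _)).
      by have := @padic_abs_int R p p_pr (4 * b); rewrite intrM.
    by rewrite padic_abs_intE // ltxx.
  have -> : p%:R ^+ (u c).+1 * p%:R ^- e = (p%:R * p%:R ^- e) * p%:R ^+ u c :> R.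
    by rewrite exprS mulrAC.
  rewrite powRM ?exprn_ge0 ?(ltW pR_gt0) ?(ltW pe0) // mulrA.
  rewrite ler_wpM2l ?mulr_ge0 ?powR_ge0 // natrX.
  have p1 : 1 <= p%:R ^+ u c :> R by rewrite exprn_ege1 // ltW.
  by rewrite -[leRHS]powRr1 ?(le_trans ler01) // ler_powR.
have := coverable_bigU cov.
apply: coverable_sub.
  move=> x [P [[x1 P1] [sP PH] [E0 E2] D0 Px]].
  have [c cE] := shift_ord PH.
  by exists c, P; split=> //; rewrite /D -cE.
rewrite /w -big_mkcond -mulr_sumr ler_wpM2l ?mulr_ge0 ?powR_ge0 //.
by rewrite -natr_sum ler_nat sum_square_near.
Qed.

End QuadraticCover.

Lemma quadratic_double_root (P : {poly int}) : (size P <= 3)%N -> P`_2 != 0 ->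
  P`_1 ^+ 2 - 4 * P`_0 * P`_2 = 0 ->
  exists L M : {poly int}, [/\ size L = 2%N, zcontents L = 1 & P = L * L * M].
Proof.
move=> sP P2 D0; have P2Q : (P`_2)%:~R != 0 :> rat by rewrite intr_eq0.
have D0Q : (P`_1)%:~R ^+ 2 = 4 * (P`_0)%:~R * (P`_2)%:~R :> rat.
  by have := congr1 (intr : int -> rat) D0; rewrite rmorphB rmorphXn !rmorphM => /subr0_eq.
pose r : rat := - (P`_1)%:~R / (2 * (P`_2)%:~R).
apply: (@rat_double_root P r); apply/rootP.
  rewrite horner_quadratic // /r.
  have -> : (P`_0)%:~R = (P`_1)%:~R ^+ 2 / (4 * (P`_2)%:~R) :> rat by rewrite D0Q; field.
  by field.
by rewrite horner_deriv_quadratic // /r; field.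
Qed.

Lemma size_square_linear (L M : {poly int}) : size L = 2%N -> M != 0 ->
  size (L * L * M) = (size M).+2.
Proof.
move=> sL M0; have L0 : L != 0 by rewrite -size_poly_gt0 sL.
by rewrite size_mul ?mulf_neq0 // size_mul // sL.
Qed.

Section CubicCover.
Variables (R : realType) (p : nat) (p_pr : prime p).
Local Notation Qp := (@Qp R p p_pr).
Local Notation abs := (@padic_abs R p p_pr).
Local Notation ev P x := (map_poly (intr : int -> Qp) P).[x].

Lemma ev_primitive_const (P : {poly int}) x : zcontents P = 1 -> (size P <= 1)%N ->
  abs (ev P x) = 1.
Proof.
move=> P1 sP; have [[|i] Pi] := primitive_unit_coef R p_pr P1; last first.
  by move: Pi; rewrite nth_default ?padic_abs0 ?(leq_trans sP) // => /eqP; rewrite eq_sym oner_eq0.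
by rewrite (size1_polyC sP) map_polyC hornerC.
Qed.

(** A primitive quadratic polynomial with discriminant 0 is the square of a linear
    one, of height at most [H^(1/2)] and of value at most [p^(-e/2)]. *)
Lemma cover_quadratic s (H e h : nat) : 0 <= s <= 1 -> (0 < H)%N ->
  (5 * p * H ^ 2 < p ^ e)%N -> (forall l, (l ^ 2 <= H)%N -> (l <= h)%N) ->
  coverable s (((2 * H).+1 ^ 2)%:R * (2 * (p%:R * p%:R ^- e) `^ s * (e * (14 * p * H))%:R) +
    (2 * h).+1%:R ^+ 2 * (p%:R * p%:R ^- e./2) `^ s) (@small_values R p p_pr 2 H e).
Proof.
move=> s01 H0 eH hH.
have p1 := prime_gt1 p_pr.
have e2 : (1 < e)%N.
  rewrite -(ltn_exp2l _ _ p1) (leq_ltn_trans _ eH) // expn1; nia.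
have cH (c : 'I_(2 * H).+1) : `|c%:Z - H%:Z| <= H%:Z by have := ltn_ord c; lia.
have cov (c : 'I_(2 * H).+1 * 'I_(2 * H).+1) :=
  @cover_quadratic_slice R p p_pr s H e _ _ s01 H0 eH (cH c.1) (cH c.2).
have := coverable_bigU cov; rewrite sumr_const card_prod !card_ord.
rewrite -[X in coverable _ X]mulr_natl mulnn => cov1.
have e20 : (0 < e./2)%N by rewrite half_gt0.
apply: coverable_sub (coverableU cov1 (@cover_linear R p p_pr s h e./2 e20)) => //.
move=> x [x1 [P [P1 sP PH Px]]].
have [D0|D0] := eqVneq (P`_1 ^+ 2 - 4 * P`_0 * P`_2) 0; last first.
  left; have [a aE] := shift_ord (PH 0%N); have [b bE] := shift_ord (PH 2%N).
  by exists (a, b), P; rewrite /= -aE -bE; split.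
right; have big_pe : ~ (1 <= p%:R ^- e :> R).
  by rewrite leNgt (ppow_lt1 R p_pr (ltnW e2)).
have [P2|P2] := eqVneq P`_2 0.
  have P10 : P`_1 = 0.
    by move: D0; rewrite P2 mulr0 subr0 => /eqP; rewrite sqrf_eq0 => /eqP.
  have sP1 : (size P <= 1)%N; last first.
    by case: big_pe; move: Px; rewrite ev_primitive_const.
  apply/leq_sizeP => -[|[|[|j]]] // _; rewrite nth_default //.
  by rewrite (leq_trans sP).
have [L [M [sL L1 PE]]] := quadratic_double_root sP P2 D0.
have P0 : P != 0 by rewrite -zcontents_eq0 P1.
have M1 : zcontents M = 1 by move: P1; rewrite PE !zcontentsM L1 !mul1r.
have L0 : L != 0 by rewrite -zcontents_eq0 L1.
have M0 : M != 0 by rewrite -zcontents_eq0 M1.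
have sM : (size M <= 1)%N by move: sP; rewrite PE size_square_linear.
have MC : M = 1.
  have := M1; rewrite (size1_polyC sM) -alg_polyC zcontentsZ zcontents_monic ?monic1 //.
  by rewrite mulr1 => ->; rewrite scale1r.
move: PE; rewrite MC mulr1 => PE.
have LE : L = (L`_1)%:P * 'X + (L`_0)%:P.
  apply/polyP => -[|[|i]]; rewrite coefD coefMX !coefC ?add0r ?addr0 //.
  by rewrite nth_default // sL.
have PL0 : P`_0 = L`_0 ^+ 2 by rewrite PE coef0M.
have PL2 : P`_2 = L`_1 ^+ 2.
  rewrite PE coefM !big_ord_recl big_ord0 /= /bump /= [L`_2]nth_default ?sL //.
  by rewrite mulr0 mul0r add0r ?addr0.
split=> //; exists L; split=> //; first by rewrite sL.
  have sq (z : int) : `|z ^+ 2| <= H%:Z -> `|z| <= h%:Z.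
    move=> zH; rewrite -abszE lez_nat; apply: hH; rewrite -mulnn -abszM.
    by rewrite -lez_nat abszE -expr2.
  case=> [|[|i]]; first by apply: sq; rewrite -PL0.
    by apply: sq; rewrite -PL2.
  by rewrite nth_default ?normr0 ?sL.
rewrite leNgt; apply/negP => lt; move: Px.
rewrite PE rmorphM hornerM padic_absM leNgt => /negP; apply.
apply: (@le_lt_trans _ _ (p%:R ^- e./2 * p%:R ^- e./2)).
  rewrite -invfM -exprD; apply: ppow_le => //.
  by rewrite addnn -[leqRHS]odd_double_half leq_addl.
by rewrite ltr_pM ?(ltW (ppow_gt0 _ _ _)).
Qed.

(** Where [|P'| >= p^(-e/4)], three balls suffice. Elsewhere the resultant of [P]
    and [P'] is an integer divisible by [p^(e/4)], too small to be nonzero. Then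
    [P = L^2 M] with [L] and [M] of degree at most 1, and one of these is at most
    [p^(-e/3)] at the point. *)
Lemma cover_cubic s (H e C : nat) : (0 < H)%N ->
  (forall (P Q : {poly int}) (h : nat), P * Q != 0 ->
    (size P <= 4)%N -> (size (P * Q)%R <= 4)%N ->
    (forall i, `|(P * Q)`_i| <= h%:Z) -> forall i, `|P`_i| <= (C * h)%N%:Z) ->
  (29160 * H ^ 5 < p ^ (e %/ 4))%N ->
  coverable s ((2 * H).+1%:R ^+ 4 * (3 * (p%:R ^+ (e %/ 4).+1 * p%:R ^- e) `^ s) +
    2 * ((2 * (C * H)).+1%:R ^+ 2 * (p%:R * p%:R ^- (e %/ 3)) `^ s))
    (@small_values R p p_pr 3 H e).
Proof.
move=> H0 CP eH.
have f0 : (0 < e %/ 4)%N.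
  case: (e %/ 4)%N eH => //; rewrite expn0 ltnS leqn0 muln_eq0 expn_eq0 /=.
  by rewrite (gtn_eqF H0).
have f3 : (3 * (e %/ 4) < e)%N by lia.
have g0 : (0 < e %/ 3)%N by lia.
have g3 : (e %/ 3 + e %/ 3 + e %/ 3 <= e)%N by lia.
have g00 := ltW (ppow_gt0 R p_pr (e %/ 3)).
have cov (f : {ffun 'I_4 -> 'I_(2 * H).+1}) :
  coverable s (3 * (p%:R ^+ (e %/ 4).+1 * p%:R ^- e) `^ s)
    [set xi : Qp | zcontents (shift_poly f) = 1 /\
      [/\ abs xi <= 1, abs (ev (shift_poly f) xi) <= p%:R ^- e &
        p%:R ^- (e %/ 4) <= abs (ev (shift_poly f)^`() xi)]].
  have [f1|f1] := eqVneq (zcontents (shift_poly f)) 1; last first.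
    exists [::]; split=> //; first by rewrite big_nil mulr_ge0 // powR_ge0.
    by move=> x [/eqP]; rewrite (negPf f1).
  have sf : (size (shift_poly f) <= 4)%N by exact: size_poly.
  apply: coverable_sub (@cover_poly R p p_pr s (shift_poly f) 3 e (e %/ 4) f1 sf isT f3) => //.
  by move=> x [].
have := coverable_bigU cov; rewrite sumr_const card_ffun !card_ord.
rewrite -[X in coverable _ X]mulr_natl natrX => cov1.
have cl := @cover_linear R p p_pr s (C * H) (e %/ 3) g0.
have := coverableU cov1 (coverableU cl cl); rewrite -mulr2n -[_ *+ 2]mulr_natl.
apply: coverable_sub => //.
move=> x [x1 [P [P1 sP PH Px]]].
have [lt|ge] := ltP (abs (ev P^`() x)) (p%:R ^- (e %/ 4)); last first.
  by left; have [f fE] := shift_polyP sP PH; exists f; rewrite -fE.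
right; have [|[r [U [V [r0 rH rE]]]]] := cubic_resultant_or_double_root sP P1 PH; last first.
  have : abs r%:~R <= p%:R ^- (e %/ 4).
    have -> : r%:~R = ev U x * ev P x + ev V x * ev P^`() x.
      have := congr1 (fun Q => ev Q x) rE.
      by rewrite map_polyC hornerC rmorphD !rmorphM hornerD !hornerM.
    apply: padic_absD_le; rewrite mulrC.
      apply: padic_absM_le; [exact: ltW (ppow_gt0 _ p_pr _)| |exact: padic_ev_le1].
      by apply: le_trans Px _; apply: ppow_le => //; rewrite leq_div.
    apply: padic_absM_le; [exact: ltW (ppow_gt0 _ p_pr _)|exact: ltW|exact: padic_ev_le1].
  rewrite leNgt padic_abs_int_small //.
  by rewrite (le_lt_trans rH) // ltz_nat.
move=> [L [M [sL L1 PE]]].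
have P0 : P != 0 by rewrite -zcontents_eq0 P1.
have M1 : zcontents M = 1 by move: P1; rewrite PE !zcontentsM L1 !mul1r.
have L0 : L != 0 by rewrite -zcontents_eq0 L1.
have M0 : M != 0 by rewrite -zcontents_eq0 M1.
have sM : (size M <= 2)%N by move: sP; rewrite PE size_square_linear.
have LH : forall i, `|L`_i| <= (C * H)%N%:Z.
  by apply: (CP L (L * M)); rewrite ?mulrA -?PE // sL.
have MH : forall i, `|M`_i| <= (C * H)%N%:Z.
  apply: (CP M (L * L)); rewrite ?[M * _]mulrC -?PE //.
  by rewrite (leq_trans sM).
have [Lx|Lx] := leP (abs (ev L x)) (p%:R ^- (e %/ 3)).
  by left; split=> //; exists L; split=> //; rewrite sL.
right; split=> //; exists M; split=> //.
rewrite leNgt; apply/negP => Mx; move: Px.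
rewrite PE !rmorphM !hornerM !padic_absM leNgt => /negP; apply.
apply: (@le_lt_trans _ _ (p%:R ^- (e %/ 3) * p%:R ^- (e %/ 3) * p%:R ^- (e %/ 3))).
  by rewrite -!invfM -!exprD; exact: ppow_le.
by apply: ltr_pM => //; exact: ltr_pM.
Qed.

End CubicCover.

(** * Points where infinitely many polynomials are small *)

Lemma quadratic_count_le (e H p : nat) :
  ((2 * H).+1 ^ 2 * (e * (14 * p * H)) <= (2 * H).+1 ^ 3 * (e.+1 * (14 * p)))%N.
Proof.
have le : (e * H <= (2 * H).+1 * e.+1)%N by nia.
have -> : ((2 * H).+1 ^ 2 * (e * (14 * p * H)) = ((2 * H).+1 ^ 2 * (14 * p)) * (e * H))%N by ring.
have -> : ((2 * H).+1 ^ 3 * (e.+1 * (14 * p)) =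
   ((2 * H).+1 ^ 2 * (14 * p)) * ((2 * H).+1 * e.+1))%N by rewrite expnSr; ring.
exact: leq_mul.
Qed.

Lemma square_root_count_le (h H : nat) : (h ^ 2 <= H)%N ->
  ((2 * h).+1 ^ 2 <= 9 * (2 * H).+1)%N.
Proof. by rewrite -!mulnn; nia. Qed.

Lemma linear_count_le (G H : nat) : (0 < G)%N -> ((2 * (G * H)).+1 <= G * (2 * H).+1)%N.
Proof. by nia. Qed.

Section NullSmallValues.
Variables (R : realType) (p : nat) (p_pr : prime p).
Local Notation Qp := (@Qp R p p_pr).

Let pR_gt0 : 0 < p%:R :> R. Proof. by rewrite ltr0n prime_gt0. Qed.
Let pR_gt1 : 1 < p%:R :> R. Proof. by rewrite ltr1n prime_gt1. Qed.
Let pN0 : p%:R != 0 :> R. Proof. by rewrite gt_eqF. Qed.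

Local Notation q e x := ((p%:R : R) `^ (e%:R * x)).

Lemma ppowR_gt0 (x : R) : 0 < (p%:R : R) `^ x. Proof. by rewrite powR_gt0. Qed.

Lemma ppowRD (x y : R) : (p%:R : R) `^ (x + y) = p%:R `^ x * p%:R `^ y.
Proof. by rewrite powRD // (negPf (_ : p%:R != 0)) ?pN0 //= implybT. Qed.

Lemma ppowR_le (x y : R) : x <= y -> (p%:R : R) `^ x <= p%:R `^ y.
Proof. by move=> xy; apply: ler_powR => //; exact: ltW. Qed.

Lemma ppowR_lt (x y : R) : x < y -> (p%:R : R) `^ x < p%:R `^ y.
Proof.
move=> xy; rewrite lt_neqAle ppowR_le ?ltW // andbT; apply/eqP => e.
have lp : ln (p%:R : R) != 0 by rewrite gt_eqF // ln_gt0.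
have := congr1 (@ln R) e; rewrite !ln_powR => /eqP.
by rewrite (inj_eq (mulIf lp)) lt_eqF.
Qed.

Lemma ppowR_large (K d : R) : 0 < d -> exists e0, forall e, (e0 <= e)%N -> K < q e d.
Proof.
move=> d0; set b := p%:R `^ d.
have b1 : 1 < b by rewrite /b -[ltLHS](powRr0 p%:R) ppowR_lt.
have qE e : q e d = b ^+ e by rewrite mulrC powRrM powR_mulrn // powR_ge0.
have b0 : 0 < b := lt_trans ltr01 b1.
have : (b^-1) ^+ n @[n --> \oo] --> (0 : R).
  by apply: cvg_expr; rewrite ger0_norm ?invr_ge0 ?(ltW b0) // invf_lt1.
have K0 : 0 < `|K| + 1 by rewrite ltr_pwDr.
move/cvgrPdist_lt/(_ (`|K| + 1)^-1); rewrite invr_gt0 => /(_ K0)[e0 _ e0P].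
exists e0 => e ee; have := e0P e ee; rewrite /= sub0r normrN exprVn normfV.
rewrite ltf_pV2 ?posrE ?normr_gt0 ?expf_neq0 ?gt_eqF //.
rewrite [`|b ^+ e|]ger0_norm ?exprn_ge0 ?(ltW b0) // -qE; apply: le_lt_trans.
by rewrite (le_trans (ler_norm K)) // lerDl.
Qed.

Lemma ppowR_large_mul (K a b : R) : a < b ->
  exists e0, forall e, (e0 <= e)%N -> K * q e a < q e b.
Proof.
move=> ab; have ba : 0 < b - a by rewrite subr_gt0.
have [e0 e0P] := ppowR_large K ba.
exists e0 => e /e0P; rewrite -(ltr_pM2r (ppowR_gt0 (e%:R * a))) -ppowRD.
by rewrite -mulrDr subrK.
Qed.

(** The factor [p] compensates the rounding of the exponent. *)
Lemma ppow_div_le (e d : nat) : (0 < d)%N ->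
  (p%:R : R) ^- (e %/ d) <= p%:R * q e (- d%:R^-1).
Proof.
move=> d0; rewrite -powR_invn ?(ltW pR_gt0) // -{2}(powRr1 (ltW pR_gt0)) -ppowRD.
apply: ppowR_le; have dR : 0 < d%:R :> R by rewrite ltr0n.
have : e%:R / d%:R <= (e %/ d).+1%:R :> R.
  by rewrite ler_pdivrMr // -natrM ler_nat ltnW // ltn_ceil.
by rewrite mulrN -natr1; lra.
Qed.

(** A polynomial factor, such as the one from the discriminants, is absorbed by
    half of the exponential decay. *)
Lemma succ_mul_geometric (x : R) e : 0 <= x < 1 -> (e.+1)%:R * x ^+ e <= (1 - x)^-1.
Proof.
move=> /andP[x0 x1].
have -> : e.+1%:R * x ^+ e = \sum_(i < e.+1) x ^+ e.
  by rewrite sumr_const card_ord mulr_natl.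
apply: le_trans (_ : \sum_(i < e.+1) x ^+ i <= _).
  by apply: ler_sum => i _; apply: ler_wiXn2l => //; [exact: ltW|rewrite -ltnS].
rewrite -[leRHS]mul1r ler_pdivlMr ?subr_gt0 // mulrC -[1 - x]opprB mulNr -subrX1 opprB.
by rewrite gerBl exprn_ge0.
Qed.

Definition height_bound (C : nat) (x : R) (e : nat) : nat := Num.truncn (C%:R * q e x).

Lemma height_boundP C x e : (0 < C)%N -> 0 <= x ->
  (0 < height_bound C x e)%N /\ (height_bound C x e)%:R <= C%:R * q e x.
Proof.
move=> C0 x0; split; last by rewrite truncn_le mulr_ge0 ?powR_ge0.
rewrite truncn_gt0 -[leLHS]mul1r ler_pM ?ler1n //.
by rewrite -[leLHS](powRr0 p%:R) ppowR_le // mulr_ge0.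
Qed.

Lemma ppowR_expn (x : R) (e n : nat) : q e x ^+ n = q e (n%:R * x).
Proof. by rewrite -powR_mulrn ?powR_ge0 // -powRrM; congr (_ `^ _); ring. Qed.

Lemma height_pow_le (C H n : nat) x e : (0 < H)%N -> H%:R <= C%:R * q e x ->
  (2 * H).+1%:R ^+ n <= (3 * C%:R) ^+ n * q e (n%:R * x).
Proof.
move=> H0 HC; rewrite -ppowR_expn -exprMn lerXn2r ?nnegrE ?ler0n ?mulr_ge0 ?powR_ge0 //.
apply: le_trans (_ : 3 * H%:R <= _); last by rewrite -mulrA ler_wpM2l.
by rewrite -natrM ler_nat; lia.
Qed.

Lemma radius_pow_le s (e d : nat) : 0 <= s -> (0 < d)%N ->
  (p%:R * p%:R ^- (e %/ d)) `^ s <= (p%:R * p%:R) `^ s * q e (- (s / d%:R)).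
Proof.
move=> s0 d0; apply: (@le_trans _ _ ((p%:R * (p%:R * q e (- d%:R^-1))) `^ s)).
  rewrite ge0_ler_powR ?nnegrE ?mulr_ge0 ?powR_ge0 ?invr_ge0 ?exprn_ge0 ?(ltW pR_gt0) //.
  by rewrite ler_wpM2l ?(ltW pR_gt0) // ppow_div_le.
rewrite mulrA powRM ?mulr_ge0 ?powR_ge0 ?(ltW pR_gt0) // ler_wpM2l ?powR_ge0 //.
by rewrite -powRrM le_eqVlt; apply/orP; left; apply/eqP; congr (_ `^ _); ring.
Qed.

(** The heights are those which [hankel_recurrence] provides in degrees 1, 2, 3;
    [b] tells whether degree 3 can occur. *)
Definition small_value_set (C : nat) (sig : R) (b : bool) (e : nat) : set Qp :=
  [set xi | [\/ @small_values R p p_pr 1 (height_bound C (sig / 2) e) e xi,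
      @small_values R p p_pr 2 (height_bound C (sig / 3) e) e xi |
      b /\ @small_values R p p_pr 3 (height_bound C (sig / 6) e) e xi]].

(** The polynomials number [p^(2 e sig/2)], [p^(3 e sig/3)], [p^(4 e sig/6)] in
    degrees 1, 2, 3 and contribute balls of radius [p^(-e)], [p^(-e)] on average, and
    [p^(-3e/4)]. The linear factors of those with a multiple root number
    [p^(e sig/3)] and [p^(2 e sig/6)], with balls of radius [p^(-e/2)] and [p^(-e/3)].
    In every case the number times the [s]-th power of the radius is at most
    [p^(- e k)] for [k = (s - sig) / 3], up to a factor [O(e)]. *)
Lemma null_small_value_set s sig C (b : bool) : 0 < sig < s -> s <= 1 -> sig < 1 -> (0 < C)%N ->
  (b -> sig < 4^-1) ->
  null_set s [set xi | forall N, exists2 e, (N <= e)%N & small_value_set C sig b e xi].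
Proof.
move=> /andP[sig0 sigs] s1 sig1 C0 bsig; have s0 : 0 < s := lt_trans sig0 sigs.
pose k := (s - sig) / 3; have k0 : 0 < k by rewrite /k divr_gt0 // subr_gt0.
have [G [G0 GP]] := int_factor_height 4.
pose H1 := height_bound C (sig / 2); pose H2 := height_bound C (sig / 3).
pose H3 := height_bound C (sig / 6).
have H1P e : (0 < H1 e)%N /\ (H1 e)%:R <= C%:R * q e (sig / 2).
  by apply: height_boundP => //; rewrite divr_ge0 // ltW.
have H2P e : (0 < H2 e)%N /\ (H2 e)%:R <= C%:R * q e (sig / 3).
  by apply: height_boundP => //; rewrite divr_ge0 // ltW.
have H3P e : (0 < H3 e)%N /\ (H3 e)%:R <= C%:R * q e (sig / 6).
  by apply: height_boundP => //; rewrite divr_ge0 // ltW.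
pose P2 := ((p%:R : R) * p%:R) `^ s.
have P20 : 0 <= P2 by exact: powR_ge0.
pose c3 : R := 3 * C%:R; have c30 : 0 <= c3 by rewrite mulr_ge0.
pose bnd (K : R) e := K * (e.+1%:R * q e (- k)).
have bndD K K' e : bnd (K + K') e = bnd K e + bnd K' e by rewrite /bnd mulrDl.
have bndP (K x : R) e : 0 <= K -> x <= - k -> K * q e x <= bnd K e.
  move=> K0 xk; rewrite /bnd ler_wpM2l // -[leLHS]mul1r ler_pM ?powR_ge0 ?ler1n //.
  by apply: ppowR_le; rewrite ler_wpM2l.
have b1 e : (0 < e)%N -> coverable s (bnd (c3 ^+ 2 * P2) e) (@small_values R p p_pr 1 (H1 e) e).
  move=> e0; apply: coverable_sub (@cover_linear R p p_pr s (H1 e) e e0) => //.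
  have [h0 hC] := H1P e.
  have := @radius_pow_le s e 1 (ltW s0) isT; rewrite divn1 divr1 => rad.
  apply: le_trans (ler_pM _ _ (height_pow_le 2 h0 hC) rad) _; rewrite ?exprn_ge0 ?powR_ge0 //.
  rewrite mulrACA -ppowRD -mulrDr; apply: bndP; first by rewrite mulr_ge0 // exprn_ge0.
  by rewrite /k; lra.
have b2 : exists e0, forall e, (e0 <= e)%N ->
    coverable s (bnd (c3 ^+ 3 * (2 * P2 * (14 * p)%:R) + 9 * (c3 * P2)) e)
      (@small_values R p p_pr 2 (H2 e) e).
  have lt1 : 2 * (sig / 3) < 1 by lra.
  have [e0 e0P] := ppowR_large_mul ((5 * p)%:R * C%:R ^+ 2) lt1.
  have exh e : exists h : nat, (h ^ 2 <= H2 e)%N /\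
      forall l, (l ^ 2 <= H2 e)%N -> (l <= h)%N.
    have ex0 : exists l, (l ^ 2 <= H2 e)%N by exists 0%N; rewrite exp0n.
    have ub l : (l ^ 2 <= H2 e)%N -> (l <= H2 e)%N.
      by move=> lH; apply: leq_trans lH; case: l => // l; rewrite -mulnn leq_pmulr.
    by case: (ex_maxnP ex0 ub) => h hH hmax; exists h.
  have [h hP] := choice exh.
  exists (maxn e0 2) => e; rewrite geq_max => /andP[ee e2].
  have [h0 hC] := H2P e; have [hH hmax] := hP e.
  have s01 : 0 <= s <= 1 by rewrite ltW.
  have eH : (5 * p * H2 e ^ 2 < p ^ e)%N.
    rewrite -(ltr_nat R) natrM !natrX; apply: (@le_lt_trans _ _ ((5 * p)%:R * C%:R ^+ 2 * q e (2 * (sig / 3)))).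
      rewrite -mulrA ler_wpM2l ?ler0n // -ppowR_expn -exprMn.
      by rewrite lerXn2r ?nnegrE ?ler0n ?mulr_ge0 ?powR_ge0.
    by have := e0P e ee; rewrite mulr1 powR_mulrn ?(ltW pR_gt0).
  apply: coverable_sub (@cover_quadratic R p p_pr s (H2 e) e (h e) s01 h0 eH hmax) => //.
  have rad1 := @radius_pow_le s e 1 (ltW s0) isT; rewrite divn1 divr1 in rad1.
  have rad2 := @radius_pow_le s e 2 (ltW s0) isT; rewrite divn2 in rad2.
  rewrite bndD lerD //.
    have hp := height_pow_le 3 h0 hC; rewrite -/c3 in hp.
    apply: (@le_trans _ _ ((2 * H2 e).+1%:R ^+ 3 * ((2 * (p%:R * p%:R ^- e) `^ s) * (e.+1 * (14 * p))%:R))).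
      rewrite mulrCA [leRHS]mulrCA ler_wpM2l ?mulr_ge0 ?powR_ge0 //.
      rewrite -natrX -!natrM ler_nat.
      exact: quadratic_count_le.
    apply: le_trans (ler_pM _ _ hp (lexx _)) _.
    - by rewrite exprn_ge0.
    - by rewrite !mulr_ge0 ?powR_ge0.
    apply: (@le_trans _ _ (c3 ^+ 3 * q e (3 * (sig / 3)) * (2 * (P2 * q e (- s)) * (e.+1 * (14 * p))%:R))).
      by rewrite ler_wpM2l ?mulr_ge0 ?powR_ge0 ?exprn_ge0 // ler_wpM2r // ler_wpM2l.
    rewrite natrM.
    have -> : c3 ^+ 3 * q e (3 * (sig / 3)) * (2 * (P2 * q e (- s)) * (e.+1%:R * (14 * p)%:R)) =
      c3 ^+ 3 * (2 * P2 * (14 * p)%:R) * (e.+1%:R * (q e (3 * (sig / 3)) * q e (- s))) by ring.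
    rewrite ler_wpM2l ?mulr_ge0 ?exprn_ge0 // ler_wpM2l // -ppowRD -mulrDr ppowR_le //.
    by rewrite ler_wpM2l // /k; lra.
  have hp := height_pow_le 1 h0 hC; rewrite -/c3 !expr1 mul1r in hp.
  apply: (@le_trans _ _ (9 * (c3 * q e (sig / 3)) * (P2 * q e (- (s / 2))))).
    apply: ler_pM rad2 => //; rewrite ?exprn_ge0 ?powR_ge0 //.
    apply: (@le_trans _ _ (9 * (2 * H2 e).+1%:R)); last by rewrite ler_wpM2l.
    by rewrite -natrX -natrM ler_nat square_root_count_le.
  have -> : 9 * (c3 * q e (sig / 3)) * (P2 * q e (- (s / 2))) =
    9 * (c3 * P2) * (q e (sig / 3) * q e (- (s / 2))) by ring.
  rewrite -ppowRD -mulrDr; apply: bndP; first by rewrite !mulr_ge0.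
  by rewrite /k; lra.
have b3 : b -> exists e0, forall e, (e0 <= e)%N ->
    coverable s (bnd (c3 ^+ 4 * (3 * P2) + 2 * ((G%:R * c3) ^+ 2 * P2)) e)
      (@small_values R p p_pr 3 (H3 e) e).
  move=> /bsig sig4.
  have lt4 : 5 * (sig / 6) < 4^-1 by lra.
  have [e0 e0P] := ppowR_large_mul (29160%:R * C%:R ^+ 5 * p%:R) lt4.
  exists (maxn e0 4) => e; rewrite geq_max => /andP[ee e4].
  have [h0 hC] := H3P e.
  have eH : (29160 * H3 e ^ 5 < p ^ (e %/ 4))%N.
    rewrite -(ltr_nat R) natrM !natrX -(ltr_pM2r pR_gt0).
    apply: (@le_lt_trans _ _ (29160%:R * C%:R ^+ 5 * p%:R * q e (5 * (sig / 6)))).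
      rewrite [leRHS]mulrAC ler_wpM2r ?(ltW pR_gt0) // -mulrA ler_wpM2l ?ler0n //.
      by rewrite -ppowR_expn -exprMn lerXn2r ?nnegrE ?ler0n ?mulr_ge0 ?powR_ge0.
    apply: lt_le_trans (e0P e ee) _.
    have := @ppow_div_le e 4 isT; rewrite mulrN powRN mulrC.
    rewrite -lef_pV2 ?posrE ?mulr_gt0 ?invr_gt0 ?ppowR_gt0 ?exprn_gt0 //.
    by rewrite invfM !invrK ler_pdivrMr.
  apply: coverable_sub (@cover_cubic R p p_pr s (H3 e) e G h0 GP eH) => //.
  rewrite bndD lerD //.
    have hp := height_pow_le 4 h0 hC; rewrite -/c3 in hp.
    have rad : (p%:R ^+ (e %/ 4).+1 * p%:R ^- e) `^ s <= P2 * q e (- (3 * s / 4)).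
      have -> : q e (- (3 * s / 4)) = (q e (- (3 / 4))) `^ s.
        by rewrite -powRrM; congr (_ `^ _); ring.
      rewrite -powRM ?mulr_ge0 ?powR_ge0 ?(ltW pR_gt0) //.
      rewrite ge0_ler_powR ?nnegrE ?mulr_ge0 ?powR_ge0 ?invr_ge0 ?exprn_ge0 ?(ltW pR_gt0) ?(ltW s0) //.
      have -> : - (3 / 4) = 4^-1 + (-1) :> R by field.
      rewrite mulrDr ppowRD mulrN1 -(powR_invn e (ltW pR_gt0)) exprS -!mulrA.
      rewrite ler_wpM2l ?(ltW pR_gt0) // mulrA ler_wpM2r ?powR_ge0 //.
      rewrite -(powR_mulrn _ (ltW pR_gt0)) -[leLHS]mul1r ler_pM ?powR_ge0 ?(ltW pR_gt1) //.
      by apply: ppowR_le; rewrite ler_pdivlMr // -natrM ler_nat leq_trunc_div.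
    apply: (@le_trans _ _ (c3 ^+ 4 * q e (4 * (sig / 6)) * (3 * (P2 * q e (- (3 * s / 4)))))).
      apply: ler_pM => //; rewrite ?exprn_ge0 ?mulr_ge0 ?powR_ge0 //.
      by rewrite ler_wpM2l.
    rewrite [3 * (P2 * _)]mulrA mulrACA -ppowRD -mulrDr; apply: bndP.
      by rewrite !mulr_ge0 ?exprn_ge0.
    by rewrite /k; lra.
  have hp := height_pow_le 2 h0 hC; rewrite -/c3 in hp.
  have rad3 := @radius_pow_le s e 3 (ltW s0) isT.
  apply: (@le_trans _ _ (2 * ((G%:R ^+ 2 * (c3 ^+ 2 * q e (2 * (sig / 6)))) * (P2 * q e (- (s / 3)))))).
    rewrite ler_wpM2l //; apply: ler_pM rad3; rewrite ?exprn_ge0 ?powR_ge0 //.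
    apply: le_trans (_ : G%:R ^+ 2 * (2 * H3 e).+1%:R ^+ 2 <= _); last by rewrite ler_wpM2l ?exprn_ge0.
    by rewrite -exprMn lerXn2r ?nnegrE ?mulr_ge0 // -natrM ler_nat linear_count_le.
  have -> : 2 * (G%:R ^+ 2 * (c3 ^+ 2 * q e (2 * (sig / 6))) * (P2 * q e (- (s / 3)))) =
     2 * ((G%:R * c3) ^+ 2 * P2) * (q e (2 * (sig / 6)) * q e (- (s / 3))) by ring.
  rewrite -ppowRD -mulrDr; apply: bndP; first by rewrite !mulr_ge0 ?exprn_ge0 // mulr_ge0.
  by rewrite /k; lra.
have [e2 b2P] := b2.
have [e3 [K3 [K30 b3P]]] : exists e3 (K3 : R), 0 <= K3 /\ forall e, (e3 <= e)%N ->
    coverable s (bnd K3 e) [set xi : Qp | b /\ @small_values R p p_pr 3 (H3 e) e xi].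
  case: b {bsig} b3 => b3; last first.
    exists 0%N, 0; split=> // e _; exists [::]; split=> //; last by move=> x [].
    by rewrite big_nil /bnd mul0r.
  have [e3 b3P] := b3 isT; exists e3, (c3 ^+ 4 * (3 * P2) + 2 * ((G%:R * c3) ^+ 2 * P2)).
  split; first by rewrite addr_ge0 ?mulr_ge0 ?exprn_ge0 // mulr_ge0.
  by move=> e /b3P; apply: coverable_sub => // x [].
pose x := (p%:R : R) `^ (- (k / 2)).
have x1 : x < 1 by rewrite /x -[ltRHS](powRr0 p%:R) ppowR_lt // oppr_lt0 divr_gt0.
have x0 : 0 <= x by exact: powR_ge0.
set K1 := c3 ^+ 2 * P2 in b1.
set K2 := (_ + _ : R) in b2P.
have K10 : 0 <= K1 by rewrite mulr_ge0 ?exprn_ge0.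
have K20 : 0 <= K2 by rewrite addr_ge0 ?mulr_ge0 ?exprn_ge0.
have Kx e K : 0 <= K -> bnd K e <= K / (1 - x) * x ^+ e.
  move=> K0; rewrite /bnd -mulrA ler_wpM2l //.
  have -> : q e (- k) = x ^+ e * x ^+ e.
    rewrite -exprD /x -powR_mulrn ?powR_ge0 // -powRrM natrD.
    by congr (_ `^ _); field.
  by rewrite mulrA ler_wpM2r ?exprn_ge0 // succ_mul_geometric // x0.
apply: (@null_limsup R p p_pr s ((K1 + (K2 + K3)) / (1 - x)) x).
- by rewrite gt_eqF.
- by rewrite x0.
- by apply: divr_ge0; [rewrite addr_ge0 // addr_ge0 | rewrite subr_ge0 ltW].
exists (maxn 1 (maxn e2 e3)) => e; rewrite !geq_max => /and3P[e_1 e_2 e_3].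
have := coverableU (b1 e e_1) (coverableU (b2P e e_2) (b3P e e_3)).
apply: coverable_sub.
  by move=> y [?|?|?]; [left|right; left|right; right].
by rewrite -!bndD; apply: Kx; rewrite addr_ge0 // addr_ge0.
Qed.

End NullSmallValues.

(** * From simultaneous approximation to small polynomials *)

Section PrimitiveApproximation.
Variables (R : realType) (p : nat) (p_pr : prime p).
Local Notation Qp := (@Qp R p p_pr).
Local Notation abs := (@padic_abs R p p_pr).

Definition approx_error (n : nat) (xi : Qp) (x : 'I_n.+1 -> int) : R :=
  \big[Num.max/0]_(m < n)
     abs ((x ord0)%:~R * xi ^+ m.+1 - (x (lift ord0 m))%:~R).

Lemma approx_error_ge0 n xi (x : 'I_n.+1 -> int) : 0 <= approx_error xi x.
Proof. by rewrite /approx_error; exact: bigmax_ge_id. Qed.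

Lemma approx_errorP n xi (x : 'I_n.+1 -> int) (e : R) : 0 <= e ->
  reflect (forall m : 'I_n, abs ((x ord0)%:~R * xi ^+ m.+1 - (x (lift ord0 m))%:~R) <= e)
    (approx_error xi x <= e).
Proof.
move=> e0; apply: (iffP idP) => [le m|le].
  exact: le_trans (le_bigmax _ _ m) le.
by apply: bigmax_le => // m _.
Qed.

Lemma approx_error_scale n xi (x y : 'I_n.+1 -> int) (c : int) :
  (forall i, x i = c * y i) ->
  approx_error xi x = abs c%:~R * approx_error xi y.
Proof.
move=> xy; rewrite /approx_error.
rewrite (big_morph (fun r => abs c%:~R * r) (id1 := 0) (op1 := Num.max)); last by rewrite mulr0.
  apply: eq_bigr => m _; rewrite -padic_absM !xy !rmorphM /=.
  by congr abs; rewrite mulrBr mulrA.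
by move=> a b; rewrite maxr_pMr ?padic_abs_ge0.
Qed.

(** There are finitely many integer vectors of bounded height. *)
Lemma approx_error_gap n xi (M : nat) : exists2 d : R, 0 < d &
  forall x : 'I_n.+1 -> int, (forall i, `|x i| <= M%:Z) ->
    0 < approx_error xi x -> d <= approx_error xi x.
Proof.
pose y (f : {ffun 'I_n.+1 -> 'I_(2 * M).+1}) (i : 'I_n.+1) : int := (f i)%:Z - M%:Z.
pose B : R := 1 + \sum_f (approx_error xi (y f))^-1.
have s0 : 0 <= \sum_f (approx_error xi (y f))^-1.
  by apply: sumr_ge0 => f _; rewrite invr_ge0 approx_error_ge0.
have B0 : 0 < B by rewrite ltr_pwDl.
exists B^-1; first by rewrite invr_gt0.
move=> x xM x0; have ex i : exists c : 'I_(2 * M).+1, x i = c%:Z - M%:Z by exact: shift_ord.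
have [c cE] := fin_all_exists ex.
have xE : x = y [ffun i => c i].
  by apply/funext => i; rewrite /y ffunE cE.
rewrite invf_ple ?posrE // xE /B (bigD1 [ffun i => c i]) //= addrCA lerDl.
by rewrite addr_ge0 // sumr_ge0 // => f _; rewrite invr_ge0 approx_error_ge0.
Qed.

Lemma int_vector_ppart n (x : 'I_n.+1 -> int) : (exists i, x i != 0) ->
  exists v (y : 'I_n.+1 -> int), (forall i, x i = (p ^ v)%N%:Z * y i) /\
    exists i, ~~ (p %| `|y i|)%N.
Proof.
move=> [i0 xi0].
pose G := \big[gcdn/0%N]_i `|x i|%N.
have Gdvd i : (G %| `|x i|)%N by rewrite /G (bigD1 i) //= dvdn_gcdl.
have G0 : (0 < G)%N.
  rewrite lt0n; apply: contraNneq xi0 => G0.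
  by have := Gdvd i0; rewrite G0 dvd0n absz_eq0.
pose v := logn p G.
have vdvd i : ((p ^ v)%N%:Z %| x i)%Z.
  by rewrite dvdzE absz_nat (dvdn_trans _ (Gdvd i)) // pfactor_dvdnn.
exists v, (fun i => (x i %/ (p ^ v)%N)%Z); split.
  by move=> i; rewrite mulrC divzK.
apply: contrapT => nex.
have : (p ^ v.+1 %| G)%N.
  rewrite /G; apply/dvdn_biggcdP => i _.
  have : (p %| `|(x i %/ (p ^ v)%N)%Z|)%N.
    by apply: contrapT => /negP H; apply: nex; exists i.
  move=> pd; rewrite -[x i](divzK (vdvd i)) abszM absz_nat expnS.
  by rewrite dvdn_mul.
by rewrite pfactor_dvdn // ltnn.
Qed.

(** Division of [x] by a power [p^v] divides the height by [p^v] and multiplies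
    the error by [p^v], which preserves the inequality because [lam > 0]. The height
    stays unbounded by [approx_error_gap], since errors tend to 0 and stay positive.
    If [p] divided [x_0] in a vector with small error, it would divide all [x_i]. *)
Lemma primitive_approximation n xi (lam : R) : abs xi <= 1 -> 0 < lam ->
  padic_approximable n xi lam -> forall Y : R,
  exists (X : R) (x : 'I_n.+1 -> int), [/\ Y <= X, 1 < X,
    forall i, `|x i|%:~R <= X, ~~ (p %| `|x ord0|)%N &
    approx_error xi x <= X `^ (- lam - 1)].
Proof.
move=> xi1 lam0 appr Y.
pose Y1 := Num.max Y 2.
have [d d0 dP] := approx_error_gap n xi (Num.truncn Y1).+1.
pose X0 := Num.max 1 ((d^-1 + 1) `^ lam^-1).
have [X X0X [x [xX /andP[ex0 exX]]]] := appr X0.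
have X1 : 1 <= X by rewrite (le_trans _ X0X) // le_max lexx.
have Xgt0 : 0 < X := lt_le_trans ltr01 X1.
have xXi i : `|x i|%:~R <= X.
  by apply: le_trans xX; rewrite ler_int; exact: (le_bigmax _ (fun i => `|x i|) i).
rewrite -/(approx_error xi x) in ex0 exX.
have [|v [y [xy [i0 yi0]]]] := @int_vector_ppart n x.
  apply: contrapT => nex; have x0 i : x i = 0.
    by apply: contrapT => /eqP H; apply: nex; exists i.
  move: ex0; rewrite ltNge => /negP; apply; apply/approx_errorP => // m.
  by rewrite !x0 mul0r subr0 padic_abs0.
have P0 : 0 < (p ^ v)%:R :> R by rewrite ltr0n expn_gt0 prime_gt0.
have aP : abs ((p ^ v)%N%:Z)%:~R = (p ^ v)%:R^-1.
  rewrite -[X in abs X]/((p ^ v)%:R) natrX padic_absX padic_abs_p.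
  by rewrite natrX exprVn.
have yE : approx_error xi y = (p ^ v)%:R * approx_error xi x.
  by rewrite (approx_error_scale xi xy) aP mulrA divff ?mul1r // gt_eqF.
have yX i : `|y i|%:~R <= X / (p ^ v)%:R.
  rewrite ler_pdivlMr // mulrC; apply: le_trans (xXi i).
  by rewrite xy normrM intrM.
have PX : (p ^ v)%:R <= X.
  rewrite -[leLHS]mul1r -ler_pdivlMr //; apply: le_trans (yX i0).
  rewrite -[leLHS]/(1%:~R) ler_int; case: (y i0) yi0 => [[|k]|k] //.
  by rewrite dvdn0.
have P1 : 1 <= (p ^ v)%:R :> R by rewrite ler1n expn_gt0 prime_gt0.
have errX : (p ^ v)%:R * X `^ (- lam - 1) <= (X / (p ^ v)%:R) `^ (- lam - 1).
  rewrite powRM ?invr_ge0 ?(ltW P0) ?(ltW Xgt0) // mulrC ler_wpM2l ?powR_ge0 //.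
  rewrite -powR_inv1 ?(ltW P0) // -powRrM mulN1r opprD !opprK.
  by apply: le1r_powR => //; rewrite lerDr ltW.
have XY : Y1 <= X / (p ^ v)%:R.
  rewrite leNgt; apply/negP => lt.
  have : d <= approx_error xi y.
    apply: dP; last by rewrite yE mulr_gt0.
    move=> i; rewrite -(ler_int R) (le_trans (yX i)) // (le_trans (ltW lt)) //.
    exact: (ltW (truncnS_gt Y1)).
  apply/negP; rewrite -ltNge yE.
  apply: (@le_lt_trans _ _ (X `^ (- lam))).
    have -> : X `^ (- lam) = X * X `^ (- lam - 1).
      rewrite -[X in _ = X * _](powRr1 (ltW Xgt0)) -powRD.
        by congr (_ `^ _); ring.
      by rewrite (gt_eqF Xgt0) implybT.
    by apply: ler_pM => //; exact: ltW.
  rewrite powRN invf_plt ?posrE ?powR_gt0 //.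
  have dl : (d^-1 + 1) = ((d^-1 + 1) `^ lam^-1) `^ lam.
    by rewrite -powRrM mulVf ?gt_eqF // powRr1 // addr_ge0 // invr_ge0 ltW.
  apply: (@lt_le_trans _ _ (d^-1 + 1)); first by rewrite ltrDl.
  rewrite dl ge0_ler_powR ?nnegrE ?powR_ge0 ?(ltW lam0) ?(ltW Xgt0) //.
  by rewrite (le_trans _ X0X) // le_max lexx orbT.
have XP1 : 1 < X / (p ^ v)%:R by rewrite (lt_le_trans _ XY) // lt_max ltr1n orbT.
have ey : approx_error xi y <= (X / (p ^ v)%:R) `^ (- lam - 1).
  by rewrite yE (le_trans _ errX) // ler_wpM2l // ltW.
exists (X / (p ^ v)%:R), y; split => //.
  by rewrite (le_trans _ XY) // le_max lexx.
apply/negP => py0; move/negP: yi0; apply.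
have e1 : approx_error xi y < 1.
  apply: le_lt_trans ey _; rewrite -opprD powRN invf_lt1 ?powR_gt0 ?(lt_trans ltr01) //.
  have := @gt0_ltr_powR R (lam + 1) _ 1 (X / (p ^ v)%:R); rewrite powR1.
  by apply; rewrite ?nnegrE ?ler01 ?(ltW (lt_trans ltr01 XP1)) // addr_gt0.
have padic_lt1 (z : int) : (p %| `|z|)%N = (abs z%:~R < 1).
  apply/idP/idP => [pz|z1]; last first.
    by apply: contraTT z1 => /(padic_abs_int_unit R p_pr) ->; rewrite ltxx.
  have : abs z%:~R <= p%:R ^- 1 by rewrite padic_abs_int_dvd expr1 dvdzE absz_nat.
  by move/le_lt_trans; apply; exact: ppow_lt1.
rewrite padic_lt1; case: (unliftP ord0 i0) => [m ->|->]; last by rewrite -padic_lt1.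
have -> : (y (lift ord0 m))%:~R = (y ord0)%:~R * xi ^+ m.+1 -
    ((y ord0)%:~R * xi ^+ m.+1 - (y (lift ord0 m))%:~R) :> Qp by rewrite subKr.
apply: padic_absB_lt.
  rewrite padic_absM (le_lt_trans (y := abs (y ord0)%:~R)) -?padic_lt1 //.
  by rewrite ler_piMr ?padic_abs_ge0 // padic_absX exprn_ile1 ?padic_abs_ge0.
apply: le_lt_trans e1; exact: (elimT (approx_errorP xi y (approx_error_ge0 xi y)) (lexx _) m).
Qed.

End PrimitiveApproximation.

Lemma hankel_defect_gt0 n k : (2 * k <= n.+1)%N -> (0 < n + 2 - 2 * k)%N.
Proof. by move=> ?; lia. Qed.

Lemma hankel_defect_natr (R : realType) n k : (2 * k <= n.+1)%N ->
  (n + 2 - 2 * k)%N%:R = n%:R + 2 - 2 * k%:R :> R.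
Proof. by move=> ?; rewrite natrB; [rewrite natrD natrM | lia]. Qed.

Section ApproximableSmallValues.
Variables (R : realType) (p : nat) (p_pr : prime p).
Local Notation Qp := (@Qp R p p_pr).
Local Notation abs := (@padic_abs R p p_pr).
Local Notation ev P x := (map_poly (intr : int -> Qp) P).[x].
Local Notation q e x := ((p%:R : R) `^ (e%:R * x)).

Let pR_gt0 : 0 < p%:R :> R. Proof. by rewrite ltr0n prime_gt0. Qed.
Let pR_gt1 : 1 < p%:R :> R. Proof. by rewrite ltr1n prime_gt1. Qed.

Lemma floor_log (W : R) : 1 <= W -> exists e, p%:R ^+ e <= W < p%:R ^+ e.+1.
Proof.
move=> W1; have W0 : 0 < W := lt_le_trans ltr01 W1.
have ex : exists e, W < p%:R ^+ e.+1.
  have W'0 : 0 < W^-1 by rewrite invr_gt0.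
  have [e eW] := ppow_small p_pr W'0; exists e.
  have : W < p%:R ^+ e by rewrite -ltf_pV2 ?posrE ?exprn_gt0.
  move/lt_le_trans; apply; rewrite ler_weXn2l // ltW //.
case: (ex_minnP ex) => e eW emin; exists e; rewrite eW andbT.
case: e eW emin => [|e] eW emin; first by rewrite expr0.
by rewrite leNgt; apply/negP => /emin; rewrite ltnn.
Qed.

(** [z] is an integer congruent to [x_1 / x_0] modulo [p^e]. *)
Lemma integer_data n (xi : Qp) (x : 'I_n.+1 -> int) (e : nat) : (0 < n)%N ->
  abs xi <= 1 -> ~~ (p %| `|x ord0|)%N -> approx_error xi x <= p%:R ^- e ->
  exists z : int, abs (xi - z%:~R) <= p%:R ^- e /\
    forall i : 'I_n.+1, ((p ^ e)%N%:Z %| x i - x ord0 * z ^+ i)%Z.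
Proof.
move=> n0 xi1 px0 err.
have pe0 : 0 <= p%:R ^- e :> R := ltW (ppow_gt0 R p_pr e).
have Pq : (p ^ e)%N%:Z = p%:Z ^+ e by rewrite -[LHS]natz natrX natz.
have cop : coprimez (x ord0) (p ^ e)%N%:Z.
  by rewrite coprimezE absz_nat coprime_sym coprimeXl // prime_coprime.
have [[y w] /= yw] := coprimezP _ _ cop.
pose x1 := x (inord 1); pose z := x1 * y; exists z.
have errP := elimT (approx_errorP xi x pe0) err.
have ax0 : abs (x ord0)%:~R = 1 by exact: padic_abs_int_unit.
have xiz : abs (xi - z%:~R) <= p%:R ^- e.
  rewrite (_ : abs _ = abs ((x ord0)%:~R * (xi - z%:~R))); last first.
    by rewrite padic_absM ax0 mul1r.
  have -> : (x ord0)%:~R * (xi - z%:~R) =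
     ((x ord0)%:~R * xi - x1%:~R) + (x1 * (w * (p ^ e)%N%:Z))%:~R :> Qp.
    have -> : w * (p ^ e)%N%:Z = 1 - y * x ord0 by rewrite -yw; ring.
    by rewrite /z !(rmorphM, rmorphB) /=; ring.
  apply: padic_absD_le.
    have e1 : inord 1 = lift ord0 (Ordinal n0) by apply/val_inj; rewrite /= inordK.
    by rewrite /x1 e1; have := errP (Ordinal n0); rewrite expr1.
  by rewrite padic_abs_int_dvd -Pq mulrA dvdz_mull.
have z1 : abs (z%:~R : Qp) <= 1 by exact: padic_abs_int.
split=> // i; rewrite Pq -(@padic_abs_int_dvd R p p_pr).
have -> : (x i - x ord0 * z ^+ i)%:~R =
   (x ord0)%:~R * (xi ^+ i - z%:~R ^+ i) - ((x ord0)%:~R * xi ^+ i - (x i)%:~R) :> Qp.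
  by rewrite rmorphB rmorphM rmorphXn /=; ring.
apply: padic_absB_le.
  rewrite padic_absM ax0 mul1r; have := @padic_ev_lipschitz R p p_pr 'X^i _ _ z1 xi1.
  by rewrite !map_polyXn !hornerXn => /le_trans; apply.
case: (unliftP ord0 i) => [m ->|->]; first exact: errP.
by rewrite expr0 mulr1 subrr padic_abs0.
Qed.

(** Choose [e] with [p^e <= X^(1 + lam) < p^(e+1)] and apply [hankel_recurrence]
    with [q = p^e]. The bound [q^(k-1) <= (C X)^k] gives [k - 1 <= k / (1 + lam)] in
    the limit, which excludes [k >= 4], and also [k = 3] if [lam > 1/2]. For the
    remaining [k], the hypotheses say that the exponents in the bound for the height
    of [P] are at most [sig / 2], [sig / 3], [sig / 6]. *)
Lemma approximable_small_values n (lam sig : R) (b : bool) :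
  (3 <= n)%N -> 3^-1 < lam -> 0 < sig ->
  2 <= n%:R * (1 + lam) * sig ->
  3 * (1 - lam) <= (1 + lam) * (n%:R - 2) * sig ->
  (if b then (5 <= n)%N /\ 6 * (1 - 2 * lam) <= (1 + lam) * (n%:R - 4) * sig
   else 2^-1 < lam) ->
  exists2 C, (0 < C)%N & forall xi : Qp, abs xi <= 1 -> padic_approximable n xi lam ->
    forall N, exists2 e, (N <= e)%N & small_value_set C sig b e xi.
Proof.
move=> n3 lam3 sig0 c1 c2 c3.
have lam0 : 0 < lam by apply: lt_trans lam3; rewrite invr_gt0.
have n0 : (0 < n)%N by lia.
have [C0 [C00 C0P]] := hankel_recurrence n0.
exists ((C0 * p) ^ 3)%N; first by rewrite expn_gt0 muln_gt0 C00 prime_gt0.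
move=> xi xi1 appr N.
pose k0 := if b then 4%N else 3%N.
pose c := (1 + lam)^-1.
have l1 : 0 < 1 + lam by rewrite addr_gt0.
have c0 : 0 < c by rewrite invr_gt0.
have cl : c * (1 + lam) = 1 by rewrite mulVf // gt_eqF.
pose d : R := (k0%:R - 1) - k0%:R * c.
have d0 : 0 < d.
  rewrite -(pmulr_lgt0 _ l1) /d mulrBl -mulrA cl mulr1 /k0.
  by case: (b) c3 => [_|c3]; lra.
pose K : R := ((C0 * p)%:R) ^+ n.
have [e0 e0P] := @ppowR_large R p p_pr K d d0.
pose e1 := maxn N e0.
have [X [x [XY X1 xX px0 err]]] := primitive_approximation xi1 lam0 appr (p%:R ^+ e1).
have X0 : 0 < X := lt_trans ltr01 X1.
have W1 : 1 <= X `^ (1 + lam).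
  by rewrite -[leLHS](powRr0 X) ler_powR // ltW.
have [e /andP[eW We]] := floor_log W1.
have e1e : (e1 <= e)%N.
  rewrite -ltnS -(@ltr_eXn2l R p%:R) //; apply: le_lt_trans We.
  apply: le_trans XY _; apply: le1r_powR; [exact: ltW | by rewrite lerDl ltW].
exists e; first by rewrite (leq_trans _ e1e) // leq_maxl.
have Kd : K < q e d by apply: e0P; rewrite (leq_trans _ e1e) // leq_maxr.
have err' : approx_error xi x <= p%:R ^- e.
  apply: le_trans err _; have -> : - lam - 1 = - (1 + lam) by ring.
  by rewrite powRN lef_pV2 ?posrE ?powR_gt0 ?exprn_gt0.
have [z [xiz zP]] := integer_data n0 xi1 px0 err'.
pose xn i : int := x (inord i).
pose Xn := Num.truncn X.
have x00 : x ord0 != 0 by apply: contraNneq px0 => ->.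
have in0 : inord 0 = ord0 :> 'I_n.+1 by apply/val_inj; rewrite /= inordK.
have := C0P xn z (p ^ e)%N Xn.
rewrite /xn in0 => /(_ _ x00) [].
- by rewrite expn_gt0 prime_gt0.
- by rewrite coprimezE absz_nat coprime_sym coprimeXl // prime_coprime.
- move=> i i_n; have := xX (inord i); rewrite -abszE -[leLHS]/((`|x (inord i)|%N)%:R).
  by rewrite -truncn_ge_nat // ltW.
- by move=> i i_n; have := zP (inord i); rewrite inordK.
move=> k [P [/andP[k_gt0 kn] sP P1 Pz [qk Hk]]].
have XnX : Xn%:R <= X by rewrite truncn_le ltW.
(* [X^(1 + lam) < p^(e + 1)] and [c = 1 / (1 + lam)] *)
have Xc : X <= p%:R * q e c.
  have -> : X = (X `^ (1 + lam)) `^ c.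
    by rewrite -powRrM mulrC cl powRr1 // ltW.
  apply: (@le_trans _ _ ((p%:R ^+ e.+1) `^ c)).
    by rewrite ge0_ler_powR ?nnegrE ?powR_ge0 ?exprn_ge0 ?(ltW pR_gt0) ?(ltW c0) ?(ltW We).
  rewrite -powR_mulrn ?(ltW pR_gt0) // -powRrM -natr1 mulrDl mul1r ppowRD // mulrC.
  rewrite ler_wpM2r ?powR_ge0 // -[leRHS](powRr1 (ltW pR_gt0)).
  by apply: ppowR_le => //; rewrite invf_le1 // lerDl ltW.
have CX : ((C0 * Xn) ^ k)%:R <= (C0 * p)%:R ^+ k * q e (k%:R * c).
  rewrite natrX -ppowR_expn -exprMn lerXn2r ?nnegrE ?mulr_ge0 ?powR_ge0 //.
  rewrite !natrM -mulrA ler_wpM2l //; exact: le_trans XnX Xc.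
have qE (j : nat) : (((p ^ e) ^ j)%N)%:R = q e j%:R :> R.
  by rewrite -expnM natrX -powR_mulrn ?(ltW pR_gt0) // natrM.
have C1 : 1 <= (C0 * p)%:R :> R by rewrite ler1n muln_gt0 C00 prime_gt0.
have kE : k.-1%:R = k%:R - 1 :> R by rewrite -subn1 natrB.
have qk' : q e (k%:R - 1) <= (C0 * p)%:R ^+ k * q e (k%:R * c).
  by rewrite -kE -qE; apply: le_trans CX; rewrite ler_nat.
have kk0 : (k < k0)%N.
  rewrite ltnNge; apply/negP => k0k; move: Kd; apply/negP; rewrite -leNgt.
  apply: (@le_trans _ _ ((C0 * p)%:R ^+ k)); last by rewrite /K ler_weXn2l.
  rewrite -(ler_pM2r (@ppowR_gt0 R p p_pr (e%:R * (k%:R * c)))).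
  apply: le_trans qk'; rewrite -ppowRD // -mulrDr; apply: ppowR_le => //.
  rewrite ler_wpM2l // /d; have : k0%:R <= k%:R :> R by rewrite ler_nat.
  have : c <= 1 by rewrite invf_le1 // lerDl ltW.
  by move: (k0%:R) (k%:R) => u w; nra.
have Px : abs (ev P xi) <= p%:R ^- e.
  rewrite -[ev P xi](subrK (ev P z%:~R)); apply: padic_absD_le.
    apply: le_trans xiz; apply: padic_ev_lipschitz => //; exact: padic_abs_int.
  rewrite horner_map /= padic_abs_int_dvd.
  by rewrite (_ : p%:Z ^+ e = (p ^ e)%N%:Z) // -[RHS]natz natrX natz.
(* [H^(n + 2 - 2 k) <= (C X)^k q^(1 - k)], to be compared with [p^(e th)] *)
have small (th : R) : (k <= 3)%N -> (2 * k <= n.+1)%N ->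
    (k%:R - (k%:R - 1) * (1 + lam)) <= (1 + lam) * (n + 2 - 2 * k)%N%:R * th ->
    @small_values R p p_pr k (height_bound p ((C0 * p) ^ 3) th e) e xi.
  move=> k3 k2 hth; have [H [PH HN]] := Hk k2.
  split=> //; exists P; split=> // i; apply: le_trans (PH i) _.
  rewrite lez_nat /height_bound truncn_ge_nat ?mulr_ge0 ?powR_ge0 //.
  set N' := (n + 2 - 2 * k)%N in HN hth.
  have N'0 : (0 < N')%N by exact: hankel_defect_gt0.
  rewrite -(ler_pXn2r N'0) ?nnegrE ?mulr_ge0 ?powR_ge0 //.
  rewrite exprMn ppowR_expn -(ler_pM2r (@ppowR_gt0 R p p_pr (e%:R * (k%:R - 1)))).
  apply: (@le_trans _ _ ((C0 * p)%:R ^+ k * q e (k%:R * c))).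
    by apply: le_trans CX; rewrite -kE -qE -natrX -natrM ler_nat.
  rewrite -mulrA -ppowRD // -mulrDr; apply: ler_pM.
  - by rewrite exprn_ge0.
  - exact: powR_ge0.
  - by rewrite natrX -exprM ler_weXn2l // (leq_trans k3) // leq_pmulr.
  apply: ppowR_le => //; rewrite ler_wpM2l //.
  have : (k%:R - (k%:R - 1) * (1 + lam)) * c <= N'%:R * th.
    by rewrite -(ler_pM2r l1) -mulrA cl mulr1 [leRHS]mulrC mulrA.
  by rewrite mulrBl -mulrA [(1 + lam) * c]mulrC cl mulr1 lerBlDr.
case: k k_gt0 kn sP qk Hk CX kk0 small {qk' kE} => [//|[|[|[|k]]]] _ kn sP qk Hk CX kk0 small.
- have k2 : (2 * 1 <= n.+1)%N by exact: leq_trans (leqW n3).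
  constructor 1; apply: small => //.
  by rewrite hankel_defect_natr // subrr mul0r subr0; move: c1; clear; lra.
- have k2 : (2 * 2 <= n.+1)%N by [].
  by constructor 2; apply: small => //; rewrite hankel_defect_natr //; move: c2; clear; lra.
- constructor 3; move: kk0 c3; rewrite /k0; case: (b) => // _ [n5 c3].
  have k2 : (2 * 3 <= n.+1)%N by [].
  by split=> //; apply: small => //; rewrite hankel_defect_natr //; move: c3; clear; lra.
- by exfalso; move: kk0; rewrite /k0; case: (b).
Qed.

End ApproximableSmallValues.

(** * Approximable points form a null set *)

(** For [sig = 2 / (n (1 + lam))] and [lam' = lam], the condition for degree 1 is an
    equality, the one for degree 2 is [n + 4 <= 3 n lam], and the one for degree 3 is
    [n + 2 <= 3 n lam]. The slack in [s] allows [sig] to be increased and then [lam']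
    to be decreased. For [n < 8] one has [(n + 4) / (3 n) > 1/2], which excludes
    degree 3. *)
Lemma upper_parameters (R : realType) (n : nat) (lam s : R) : (3 <= n)%N ->
  (n%:R + 4) / (3 * n%:R) <= lam -> 2 / (n%:R * (1 + lam)) < s ->
  exists lam' sig : R, [/\ 3^-1 < lam' /\ lam' < lam, 0 < sig /\ sig < s, sig < 1,
    2 <= n%:R * (1 + lam') * sig /\ 3 * (1 - lam') <= (1 + lam') * (n%:R - 2) * sig &
    if (8 <= n)%N then [/\ sig < 4^-1, (5 <= n)%N &
       6 * (1 - 2 * lam') <= (1 + lam') * (n%:R - 4) * sig]
    else 2^-1 < lam'].
Proof.
move=> n3 hl hs; set N : R := n%:R in hl hs *.
have N3 : 3 <= N by rewrite /N (ler_nat _ 3).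
have N0 : 0 < N by lra.
have hl' : N + 4 <= 3 * N * lam by rewrite mulrC -ler_pdivrMr //; lra.
pose T := N * (1 + lam).
have T1 : (4 * N + 4) / 3 <= T by rewrite /T; lra.
have T0 : 0 < T by lra.
have hs' : 2 < s * T by rewrite -ltr_pdivrMr.
(* [sig T = 2 + g] with [sig < s]; decreasing [lam] by [eta] costs [eta sig], which
   is small compared with [g] and with [n lam - n / 3 >= 4 / 3]. *)
pose g := Num.min (2^-1) ((s * T - 2) / 2).
have g0 : 0 < g by rewrite lt_min invr_gt0 ltr0n divr_gt0 ?subr_gt0.
have g1 : g <= 2^-1 by rewrite ge_min lexx.
have g2 : g <= (s * T - 2) / 2 by rewrite ge_min lexx orbT.
pose sig := (2 + g) / T.
have sT : sig * T = 2 + g by rewrite /sig divfK ?gt_eqF.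
pose eta := g / (50 * N).
have eN : eta * (50 * N) = g by rewrite /eta divfK ?gt_eqF // mulr_gt0.
have e0 : 0 < eta by rewrite /eta divr_gt0 // mulr_gt0.
have sig0 : 0 < sig by rewrite /sig divr_gt0 // addr_gt0.
have sig1 : sig < 1 by rewrite /sig ltr_pdivrMr // mul1r; lra.
have eN' : eta * N = g / 50 by rewrite -eN; field.
have eN1 : eta * N <= 100^-1 by rewrite eN'; lra.
have es : eta * sig <= eta by rewrite ler_piMr // ltW.
have esN : eta * sig * N <= g / 50.
  by rewrite -eN' ler_pM2r.
have sN : N * (1 + lam) * sig = 2 + g by rewrite -sT /T mulrC.
exists (lam - eta), sig; split.
- split; last by rewrite ltrBlDr ltrDl.
  rewrite -(ltr_pM2r N0); lra.
- split=> //; rewrite /sig ltr_pdivrMr //; lra.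
- by [].
- split; first by lra.
  rewrite -(ler_pM2r N0).
  have -> : (1 + (lam - eta)) * (N - 2) * sig * N = (N - 2) * (2 + g) - eta * sig * N * (N - 2).
    by rewrite -sN; ring.
  have : eta * sig * N * (N - 2) <= g / 50 * (N - 2) by rewrite ler_wpM2r //; lra.
  have : 1 * (g * 1) <= (N - 2) * (g * 1) by rewrite ler_wpM2r ?mulr_ge0 ?(ltW g0) //; lra.
  lra.
case: ifPn => [n8|n8].
  have N8 : 8 <= N by rewrite /N (ler_nat _ 8).
  split; [by rewrite /sig ltr_pdivrMr //; lra | by apply: leq_trans n8 |].
  rewrite -(ler_pM2r N0).
  have -> : (1 + (lam - eta)) * (N - 4) * sig * N = (N - 4) * (2 + g) - eta * sig * N * (N - 4).
    by rewrite -sN; ring.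
  have : eta * sig * N * (N - 4) <= g / 50 * (N - 4) by rewrite ler_wpM2r //; lra.
  have : 4 * g <= (N - 4) * g by rewrite ler_wpM2r ?(ltW g0) //; lra.
  lra.
have N7 : N <= 7 by rewrite /N (ler_nat _ _ 7) -ltnS ltnNge.
rewrite -(ltr_pM2r N0); lra.
Qed.

Section UpperBound.
Variables (R : realType) (p : nat) (p_pr : prime p).
Local Notation Qp := (@Qp R p p_pr).
Local Notation abs := (@padic_abs R p p_pr).

Let pR_gt1 : 1 < p%:R :> R. Proof. by rewrite ltr1n prime_gt1. Qed.

Lemma padic_abs_ppow t : abs (p%:R ^+ t) = p%:R ^- t.
Proof. by rewrite padic_absX padic_abs_p exprVn. Qed.

(** The vector [p^(t i) x_i] approximates the powers of [p^t xi]; its height grows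
    by the factor [p^(t n)], which the loss [lam - lam'] absorbs. *)
Lemma approximable_scale n (xi : Qp) (lam lam' : R) t : -1 <= lam' -> lam' < lam ->
  padic_approximable n xi lam -> padic_approximable n (p%:R ^+ t * xi) lam'.
Proof.
move=> lam'1 ll appr X0.
pose K : R := p%:R ^+ (t * n).
have K1 : 1 <= K by rewrite exprn_ege1 // ltW.
have K0 : 0 < K := lt_le_trans ltr01 K1.
have ll0 : 0 < lam - lam' by rewrite subr_gt0.
have [X XX [x [xX /andP[ex0 exX]]]] := appr (Num.max (Num.max 1 X0) ((K `^ (lam' + 1)) `^ (lam - lam')^-1)).
have X1 : 1 <= X by rewrite (le_trans _ XX) // !le_max lexx.
have Xgt0 : 0 < X := lt_le_trans ltr01 X1.
exists (K * X).
  rewrite (le_trans (_ : X0 <= X)) //; first by rewrite (le_trans _ XX) // !le_max lexx orbT.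
  by rewrite ler_peMl // ltW.
pose y (i : 'I_n.+1) : int := (p ^ (t * i))%N%:Z * x i.
have yE i : (y i)%:~R = (p ^ (t * i))%:R * (x i)%:~R :> R by rewrite /y rmorphM.
exists y; split.
  apply: (@le_trans _ _ ((K * (\big[Num.max/0]_(i < n.+1) `|x i|)%:~R))); last first.
    by rewrite ler_pM2l.
  have -> : K = ((p ^ (t * n))%N%:Z)%:~R by rewrite /K -natrX.
  rewrite -rmorphM ler_int; apply: bigmax_le.
    by rewrite mulr_ge0 // bigmax_ge_id.
  move=> i _; rewrite /y normrM ler_pM //.
    rewrite ger0_norm // lez_nat leq_pexp2l ?prime_gt0 // leq_mul2l -ltnS ltn_ord.
    by rewrite orbT.
  exact: (le_bigmax _ (fun i => `|x i|) i).
have term (m : 'I_n) : abs ((y ord0)%:~R * (p%:R ^+ t * xi) ^+ m.+1 - (y (lift ord0 m))%:~R) =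
   p%:R ^- (t * m.+1) * abs ((x ord0)%:~R * xi ^+ m.+1 - (x (lift ord0 m))%:~R).
  rewrite -padic_abs_ppow -padic_absM; congr abs.
  rewrite /y !rmorphM /= muln0 expn0 mul1r mulrBr.
  rewrite -[X in _ - X * _]/((p ^ (t * m.+1))%:R) natrX exprMn -exprM; ring.
apply/andP; split.
  move: ex0; rewrite !ltNge; apply: contra => le0.
  apply/approx_errorP => // m; have := elimT (approx_errorP _ y (lexx 0)) le0 m.
  by rewrite term pmulr_rle0 // ppow_gt0.
apply: (@le_trans _ _ (X `^ (- lam - 1))).
  apply/approx_errorP; rewrite ?powR_ge0 // => m; rewrite term.
  have := elimT (approx_errorP _ x (powR_ge0 X (- lam - 1))) exX m.
  apply: le_trans; rewrite ler_piMl ?padic_abs_ge0 //; exact: ppow_le1.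
have -> : - lam - 1 = - (lam + 1) by ring.
have -> : - lam' - 1 = - (lam' + 1) by ring.
rewrite !powRN lef_pV2 ?posrE ?powR_gt0 ?mulr_gt0 // powRM ?(ltW K0) ?(ltW Xgt0) //.
have -> : X `^ (lam + 1) = X `^ (lam - lam') * X `^ (lam' + 1).
  rewrite -powRD; first by congr (_ `^ _); ring.
  by rewrite (gt_eqF Xgt0) implybT.
rewrite ler_wpM2r ?powR_ge0 //.
have -> : K `^ (lam' + 1) = ((K `^ (lam' + 1)) `^ (lam - lam')^-1) `^ (lam - lam').
  by rewrite -powRrM mulVf ?gt_eqF // powRr1 // powR_ge0.
rewrite ge0_ler_powR ?nnegrE ?powR_ge0 ?(ltW ll0) ?(ltW Xgt0) //.
by rewrite (le_trans _ XX) // le_max lexx orbT.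
Qed.

(** Scaling by powers of [p] moves every point into the unit ball, where
    [approximable_small_values] applies. *)
Lemma approximable_null n (lam s : R) : (3 <= n)%N ->
  (n%:R + 4) / (3 * n%:R) <= lam -> 2 / (n%:R * (1 + lam)) < s -> s <= 1 ->
  exists2 lam', lam' < lam & null_set s [set xi : Qp | padic_approximable n xi lam'].
Proof.
move=> n3 hl hs s1.
have [lam' [sig [[l3 ll] [sig0 sigs] sig1 [c1 c2] c3]]] := upper_parameters n3 hl hs.
have s0 : 0 < s := lt_trans sig0 sigs.
pose lam2 := (lam' + lam) / 2.
have ll2 : lam' < lam2 by rewrite /lam2; lra.
exists lam2; first by rewrite /lam2; lra.
have lam'0 : 0 < lam' by apply: lt_trans l3; rewrite invr_gt0.
have [C C0 CP] : exists2 C, (0 < C)%N & forall xi : Qp, abs xi <= 1 ->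
    padic_approximable n xi lam' ->
    forall N, exists2 e, (N <= e)%N & small_value_set C sig (8 <= n)%N e xi.
  apply: approximable_small_values => //.
  by move: c3; case: ifP => // _ [].
have c4 : (8 <= n)%N -> sig < 4^-1 by move=> n8; move: c3; rewrite n8 => -[].
have sigss : 0 < sig < s by rewrite sig0.
have nul := @null_small_value_set R p p_pr s sig C (8 <= n)%N sigss s1 sig1 C0 c4.
have := @null_bigU R p p_pr s (fun t => [set xi : Qp | abs (p%:R ^+ t * xi) <= 1 /\
   padic_approximable n (p%:R ^+ t * xi) lam']) _ _.
move=> H; apply: null_set_sub (H _ _); last 1 first.
- move=> t; apply: null_set_sub (null_scale t nul) => xi /= [xi1 appr].
  exact: CP.
- move=> xi /= appr.
  have ap t : padic_approximable n (p%:R ^+ t * xi) lam'.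
    by apply: approximable_scale appr => //; lra.
  have [xi0|xi0] := eqVneq xi 0.
    by exists 0%N; split; [rewrite xi0 mulr0 padic_abs0 | exact: ap].
  have x0 : 0 < (abs xi)^-1 by rewrite invr_gt0 padic_abs_gt0.
  have [t tP] := ppow_small p_pr x0; exists t; split=> //.
  by rewrite padic_absM padic_abs_ppow -ler_pdivlMr ?padic_abs_gt0 // mul1r ltW.
- by rewrite gt_eqF.
Qed.

End UpperBound.

(** * Points with good rational approximations do not form a null set *)

Section LowerBound.
Variables (R : realType) (p : nat) (p_pr : prime p).
Local Notation Qp := (@Qp R p p_pr).
Local Notation abs := (@padic_abs R p p_pr).

Let pR_gt0 : 0 < p%:R :> R. Proof. by rewrite ltr0n prime_gt0. Qed.

Definition meets (f : nat -> Qp * R) (i y m : nat) : bool :=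
  `[< exists xi : Qp, abs (xi - y%:R) <= p%:R ^- m /\ abs (xi - (f i).1) < (f i).2 >].

(** The mass of the balls of the cover that meet a given ball is at most [theta]
    times the mass of this ball. For [theta < 1] such balls of the cover are smaller
    than the given ball. *)
Definition light (s theta : R) (f : nat -> Qp * R) (y m : nat) : Prop :=
  forall M, \sum_(i < M | meets f i y m) (f i).2 `^ s <= theta * (p%:R ^- m) `^ s.

Lemma padic_abs_natB (a b e : nat) :
  (abs (a%:R - b%:R) <= p%:R ^- e) = (a == b %[mod p ^ e])%N.
Proof.
rewrite (_ : a%:R - b%:R = (a%:Z - b%:Z)%:~R); last by rewrite rmorphB.
rewrite padic_abs_int_dvd -eqz_mod_dvd (_ : p%:Z ^+ e = (p ^ e)%N%:Z).
  by rewrite !modz_nat eqz_nat.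
by rewrite -[RHS]natz natrX natz.
Qed.

(** Children that meet a ball of radius [r], with [p^(-m-t-1) < r <= p^(-m-t)], have
    centres congruent modulo [p^(m+t)]; as they are distinct modulo [p^(m+2g)], they
    number at most [p^(2g-t)]. *)
Lemma card_children (f : nat -> Qp * R) (i y m m' g : nat)
    (S : {set 'I_(p ^ (2 * g))}) (lift_ : 'I_(p ^ (2 * g)) -> nat) :
  (m + 2 * g <= m')%N -> 0 <= (f i).2 < p%:R ^- m ->
  (forall u, u \in S -> lift_ u = u %[mod p ^ (2 * g)]) ->
  (#|[set u in S | meets f i (y + p ^ m * lift_ u) m']|)%:R <=
    1 + p%:R * (p ^ (2 * g))%:R * ((f i).2 / p%:R ^- m) :> R.
Proof.
move=> mm' /andP[r0 fm] liftP; set A := finset _.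
have pm0 := ppow_gt0 R p_pr m.
have rhs0 : 0 <= p%:R * (p ^ (2 * g))%:R * ((f i).2 / p%:R ^- m).
  by rewrite !mulr_ge0 // ?invr_ge0 ?(ltW pm0).
have close u v : u \in A -> v \in A ->
    abs ((y + p ^ m * lift_ u)%:R - (y + p ^ m * lift_ v)%:R) <= Num.max (f i).2 (p%:R ^- m').
  rewrite !inE => /andP[_ /asboolP[a [au af]]] /andP[_ /asboolP[b [bv bf]]].
  set yu := (_ + _)%:R in au *; set yv := (_ + _)%:R in bv *.
  have -> : yu - yv = (b - yv) - ((b - (f i).1) - (a - (f i).1)) - (a - yu) by ring.
  apply: padic_absB_le; last by rewrite (le_trans au) // le_max lexx orbT.
  apply: padic_absB_le; first by rewrite (le_trans bv) // le_max lexx orbT.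
  by apply: padic_absB_le; rewrite le_max ltW.
have congr_t t u v : u \in A -> v \in A -> (t <= 2 * g)%N -> (f i).2 <= p%:R ^- (m + t) ->
    (u = v %[mod p ^ t])%N.
  move=> uA vA tg ft.
  have : abs ((y + p ^ m * lift_ u)%:R - (y + p ^ m * lift_ v)%:R) <= p%:R ^- (m + t).
    apply: le_trans (close u v uA vA) _; rewrite ge_max ft ppow_le //.
    by apply: leq_trans mm'; rewrite leq_add2l.
  rewrite padic_abs_natB expnD eqn_modDl -!muln_modr eqn_pmul2l ?expn_gt0 ?prime_gt0 //.
  move/eqP => e.
  have Su w : w \in A -> (lift_ w = w %[mod p ^ t])%N.
    rewrite inE => /andP[/liftP wS _].
    by rewrite -(@modn_dvdm (p ^ (2 * g))) ?dvdn_exp2l // wS modn_dvdm // dvdn_exp2l.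
  by rewrite -(Su u uA) -(Su v vA).
have q0 : (0 < p ^ (2 * g))%N by rewrite expn_gt0 prime_gt0.
have [small|large] := leP (f i).2 (p%:R ^- (m + 2 * g)).
  have c1 : (#|A| <= 1)%N.
    have := @card_residue_class _ (p ^ (2 * g)) A q0.
    rewrite divn_small ?prednK //; apply => u v uA vA.
    exact: congr_t.
  by apply: (@le_trans _ _ 1); rewrite ?lerDl // (ler_nat _ _ 1).
have ext : exists t, ~~ ((f i).2 <= p%:R ^- (m + t)).
  by exists (2 * g)%N; rewrite -ltNge.
case: (ex_minnP ext) => -[|t] tP tmin.
  by move: tP; rewrite addn0 (ltW fm).
have t2g : (t < 2 * g)%N by apply: tmin; rewrite -ltNge.
have ft : (f i).2 <= p%:R ^- (m + t).
  by apply: contraT => /tmin; rewrite ltnn.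
have pt0 : (0 < p ^ t)%N by rewrite expn_gt0 prime_gt0.
have cA : (#|A| <= p ^ (2 * g - t))%N.
  have := @card_residue_class _ (p ^ t) A pt0.
  move=> H; apply: leq_trans (H _) _.
    by move=> u v uA vA; apply: congr_t => //; exact: ltnW.
  rewrite -[X in (_ < X)%N](mulKn _ pt0) -expnD subnKC; last exact: ltnW.
  rewrite ltn_divLR // divnK ?ltn_predL // dvdn_exp2l //; exact: ltnW.
apply: (@le_trans _ _ (p ^ (2 * g - t))%:R); first by rewrite ler_nat.
apply: (@le_trans _ _ (p%:R * (p ^ (2 * g))%:R * ((f i).2 / p%:R ^- m))); last by rewrite lerDr.
rewrite -ltNge in tP.
rewrite mulrA ler_pdivlMr //.
apply: (@le_trans _ _ (p%:R * (p ^ (2 * g))%:R * p%:R ^- (m + t.+1))); last first.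
  by rewrite ler_wpM2l ?mulr_ge0 // ltW.
rewrite -(subnKC (ltnW t2g)) addKn addnS !natrX exprS !exprD.
have pN0 : p%:R != 0 :> R by rewrite gt_eqF.
have : p%:R ^+ m != 0 :> R by rewrite expf_neq0.
have : p%:R ^+ t != 0 :> R by rewrite expf_neq0.
move: (p%:R ^+ m) (p%:R ^+ t) (p%:R ^+ (2 * g - t)) => a b c b0 a0.
by rewrite le_eqVlt; apply/orP; left; apply/eqP; field; rewrite a0 b0 pN0.
Qed.

End LowerBound.

Section LowerStep.
Variables (R : realType) (p : nat) (p_pr : prime p).
Local Notation Qp := (@Qp R p p_pr).
Local Notation abs := (@padic_abs R p p_pr).

Let pR_gt0 : 0 < p%:R :> R. Proof. by rewrite ltr0n prime_gt0. Qed.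
Let pR_gt1 : 1 < p%:R :> R. Proof. by rewrite ltr1n prime_gt1. Qed.

Lemma linear_large (a b : R) : 0 < a -> exists g0 : nat, forall g, (g0 <= g)%N -> b <= a * g%:R.
Proof.
move=> a0; exists (Num.truncn (b / a)).+1 => g gg.
rewrite mulrC -ler_pdivrMr // (le_trans (ltW (truncnS_gt _))) // ler_nat //.
Qed.

(** With [T = 2 / s], the [p^(2g)] balls of radius [p^(-m - g T)] have the mass of one
    ball of radius [p^(-m)]. The [-2] leaves room for the constants in
    [lower_step]. *)
Lemma step_scale (T T' : R) (m H0 : nat) : 2 < T -> T' < T -> 0 <= T' ->
  exists g m' : nat, [/\ (H0 <= p ^ g)%N, (m + 2 * g <= m')%N /\ (m < m')%N,
    m'%:R < m%:R + T * (g%:R - 2) & T' * (m + g + 1)%N%:R <= m'%:R].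
Proof.
move=> T2 TT T'0.
have [g1 g1P] := @linear_large (T - 2) (2 * T + 2) ltac:(by rewrite subr_gt0).
have [g2 g2P] := @linear_large (T - T') (T' * (m%:R + 1) + 2 * T + 2) ltac:(by rewrite subr_gt0).
pose g := maxn (maxn g1 g2) (maxn H0 1).
have e1 : 2 * T + 2 <= (T - 2) * g%:R.
  by apply: g1P; rewrite (leq_trans (leq_maxl g1 g2)) // leq_maxl.
have e2 : T' * (m%:R + 1) + 2 * T + 2 <= (T - T') * g%:R.
  by apply: g2P; rewrite (leq_trans (leq_maxr g1 g2)) // leq_maxl.
have m0 : 0 <= m%:R :> R by [].
have g0 : 1 <= g%:R :> R.
  by rewrite ler1n (leq_trans (leq_maxr H0 1)) // leq_maxr.
pose W := m%:R + T * (g%:R - 2) - 1.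
have W0 : 0 <= W by rewrite /W; lra.
exists g, (Num.truncn W).
have /andP[tW Wt] := truncn_itv W0.
have mg : (m + 2 * g <= Num.truncn W)%N.
  by rewrite truncn_ge_nat // natrD natrM /W; lra.
split.
- apply: (@leq_trans g); first by rewrite (leq_trans (leq_maxl H0 1)) // leq_maxr.
  exact/ltnW/ltn_expl/prime_gt1.
- split=> //; apply: leq_trans mg; rewrite -addn1 leq_add2l.
  by move: g0; rewrite ler1n => g0; rewrite muln_gt0.
- by apply: le_lt_trans tW _; rewrite /W ltrBlDr ltrDl.
- apply: le_trans (_ : W - 1 <= _).
    by rewrite !natrD /W; lra.
  by rewrite lerBlDr natr1 ltW.
Qed.

(** The children of the ball are the balls of radius [p^(-m')] around [y + p^m c / b],
    for the fractions [c / b] of [fraction_residues]; at their points,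
    [b xi - (b y + p^m c)] is at most [p^(-m')], with [b] and [b y + p^m c] of size
    [p^(m+g)]. A ball of the cover of radius [r] meets at most one child plus a
    proportion [r / p^(-m)] of all, by [card_children]. Its mass, capped at that of a
    light child, therefore has a sum over the children that is controlled by the
    lightness of the parent. *)
Lemma lower_step (s theta T' : R) (f : nat -> Qp * R) (y m H0 : nat) :
  0 < s < 1 -> theta = (16 * p%:R)^-1 -> 0 <= T' < 2 / s -> (forall i, 0 <= (f i).2) ->
  (y < p ^ m)%N -> light s theta f y m ->
  exists y' m' a b H : nat,
    [/\ (m < m')%N /\ y' = y %[mod p ^ m], (y' < p ^ m')%N, light s theta f y' m',
        [/\ (0 < b)%N, (H0 <= H)%N, (b <= H)%N & (a <= H)%N] &
        forall xi : Qp, abs (xi - y'%:R) <= p%:R ^- m' ->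
          abs (b%:R * xi - a%:R) <= H%:R `^ (- T')].
Proof.
move=> /andP[s0 s1] thE /andP[T'0 T'T] f0 ym lt.
have th0 : 0 < theta by rewrite thE invr_gt0 mulr_gt0.
have th1 : theta < 1 by rewrite thE invf_lt1 ?mulr_gt0 // -[ltLHS]mulr1 ltr_pM // (ltr_nat R 1).
have T2 : 2 < 2 / s by rewrite ltr_pdivlMr // gtr_pMr.
have [g [m' [gH [mg mm'] m'up m'lo]]] := step_scale m H0 T2 T'T T'0.
set T := 2 / s in T'T T2 m'up.
have [S [cS SP]] := fraction_residues g p_pr.
set q := (p ^ (2 * g))%N in S cS SP.
have q0 : (0 < q)%N by rewrite expn_gt0 prime_gt0.
pose dm := (m' - m)%N.
have dm0 : (0 < p ^ dm)%N by rewrite expn_gt0 prime_gt0.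
have gdm : (2 * g <= dm)%N by rewrite /dm leq_subRL // ltnW.
have ex (u : 'I_q) : exists t : nat * nat * nat, u \in S ->
    [/\ (0 < t.1.1 <= p ^ g)%N, (t.1.2 <= p ^ g)%N, (t.1.1 * t.2 = t.1.2 %[mod p ^ dm])%N,
        (t.2 < p ^ dm)%N & (t.2 = u %[mod q])%N].
  have [uS|uS] := boolP (u \in S); last by exists (0, 0, 0)%N.
  have [b [c [bh /andP[_ ch] pb bu]]] := SP u uS.
  have cop k : coprime b (p ^ k) by rewrite coprime_sym coprimeXl // prime_coprime.
  pose w := ((egcdn b (p ^ dm)).1 * c)%N.
  have bw : (b * w = c %[mod p ^ dm])%N.
    rewrite /w; case: egcdnP => [|km kn e _ /=]; first by case/andP: bh.
    rewrite mulnA (mulnC b) e (eqP (cop dm)).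
    by rewrite mulnDl mul1n mulnAC modnMDl.
  exists (b, c, w %% p ^ dm)%N => _ /=; split=> //.
  - by rewrite modnMmr.
  - exact: ltn_pmod.
  - have qd : (q %| p ^ dm)%N by rewrite dvdn_exp2l.
    rewrite modn_dvdm //; apply/eqP.
    have : (b * w == b * u %[mod q])%N.
      by rewrite bu -(modn_dvdm (b * w) qd) bw modn_dvdm.
    rewrite -eqz_nat -!modz_nat eqz_mod_dvd !PoszM -mulrBr Gauss_dvdzr.
      by rewrite -eqz_mod_dvd !modz_nat eqz_nat.
    by rewrite coprimezE !absz_nat coprime_sym cop.
have /fin_all_exists[t tP] := ex.
pose yc u := (y + p ^ m * (t u).2)%N.
pose rho : R := p%:R ^- m; pose rho' : R := p%:R ^- m'.
have rho0 : 0 < rho by exact: ppow_gt0.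
have rho'0 : 0 < rho' by exact: ppow_gt0.
have ppE k : (p%:R ^- k) `^ s = (p%:R : R) `^ (- (k%:R * s)).
  by rewrite -powR_invn ?(ltW pR_gt0) // -powRrM mulNr.
have scale : rho `^ s < rho' `^ s * (q%:R / 16).
  rewrite mulrA ltr_pdivlMr // /rho /rho' !ppE /q natrX -powR_mulrn ?(ltW pR_gt0) //.
  rewrite -ppowRD //; apply: (@le_lt_trans _ _ (p%:R `^ (- (m%:R * s)) * p%:R `^ 4%:R)).
    rewrite ler_wpM2l ?powR_ge0 // powR_mulrn ?(ltW pR_gt0) // -natrX ler_nat.
    by rewrite (@leq_exp2r 2 p 4) // prime_gt1.
  rewrite -ppowRD //; apply: ppowR_lt => //.
  move: m'up; rewrite -(ltr_pM2r s0) mulrDl mulrAC /T mulfVK ?gt_eqF // natrM; lra.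
have sub i u xi : u \in S -> abs (xi - (yc u)%:R) <= rho' -> abs (xi - y%:R) <= rho.
  move=> uS xiu; have -> : xi - y%:R = (xi - (yc u)%:R) + ((yc u)%:R - y%:R) by ring.
  apply: padic_absD_le.
    by apply: le_trans xiu _; apply: ppow_le => //; exact: ltnW.
  by rewrite padic_abs_natB /yc addnC mulnC modnMDl.
(* If no child is light, the capped masses [w i] give each child a weight of at
   least 1; exchanging the sums over children and over the cover contradicts the
   lightness of the parent. *)
have [u [uS uL]] : exists u, u \in S /\ light s theta f (yc u) m'.
  apply: contrapT => nex.
  pose c := theta * rho' `^ s.
  have c0 : 0 < c by rewrite mulr_gt0 // powR_gt0.
  pose w i : R := Num.min ((f i).2 `^ s / c) 1.
  have w0 i : 0 <= w i by rewrite le_min ler01 divr_ge0 ?powR_ge0 // ltW.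
  have bad u : exists M : nat, u \in S -> 1 <= \sum_(i < M | meets f i (yc u) m') w i.
    have [uS|uS] := boolP (u \in S); last by exists 0%N.
    have [M MP] : exists M, c < \sum_(i < M | meets f i (yc u) m') (f i).2 `^ s.
      apply: contrapT => nM; apply: nex; exists u; split=> // M.
      by rewrite leNgt; apply/negP => H; apply: nM; exists M.
    exists M => _; have [[i /andP[mi wi]]|nw] :=
        pselect (exists i : 'I_M, meets f i (yc u) m' && (1 <= (f i).2 `^ s / c)).
      rewrite (bigD1 i) //= /w (min_idPr wi) lerDl.
      by apply: sumr_ge0 => j _; exact: w0.
    rewrite (eq_bigr (fun i : 'I_M => (f i).2 `^ s / c)) => [|i mi].
      by rewrite -mulr_suml ler_pdivlMr // mul1r ltW.
    rewrite /w (min_idPl _) // leNgt; apply/negP => lt1.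
    by apply: nw; exists i; rewrite mi ltW.
  have /fin_all_exists[Mu MuP] := bad.
  pose M := (\sum_u Mu u)%N.
  have S_le : #|S|%:R <= \sum_(u in S) \sum_(i < M | meets f i (yc u) m') w i.
    rewrite -sum1_card natr_sum; apply: ler_sum => u uS; apply: le_trans (MuP u uS) _.
    have MM : (Mu u <= M)%N by rewrite /M (bigD1 u) //= leq_addr.
    rewrite (big_ord_widen_cond _ (fun i => meets f i (yc u) m') w MM).
    rewrite big_mkcond [leRHS]big_mkcond; apply: ler_sum => i _.
    by case: (meets _ _ _ _) => //=; case: ifP.
  have mass : \sum_(u in S) \sum_(i < M | meets f i (yc u) m') w i <=
      \sum_(i < M | meets f i y m) ((f i).2 `^ s / c + p%:R * q%:R * ((f i).2 `^ s / rho `^ s)).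
    rewrite (exchange_big_dep (fun i : 'I_M => meets f i y m)) /=; last first.
      move=> u i uS /asboolP[xi [xiu xif]]; apply/asboolP; exists xi; split=> //.
      exact: sub xiu.
    apply: ler_sum => i mi.
    rewrite (eq_bigl (fun u => u \in [set u in S | meets f i (yc u) m']%SET)); last first.
      by move=> u; rewrite inE.
    rewrite sumr_const.
    have rs : (f i).2 `^ s < rho `^ s.
      apply: (@le_lt_trans _ _ (theta * rho `^ s)); last first.
        by rewrite -[ltRHS]mul1r ltr_pM2r // powR_gt0.
      apply: le_trans (lt i.+1); rewrite (bigD1 (Ordinal (ltnSn i))) //= lerDl.
      by apply: sumr_ge0 => j _; exact: powR_ge0.
    have ri : (f i).2 < rho.
      rewrite ltNge; apply/negP => le; move: rs; rewrite ltNge => /negP; apply.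
      by rewrite ge0_ler_powR ?nnegrE ?(ltW s0) ?(ltW rho0) // ?f0.
    have cc := @card_children R p p_pr f i y m m' g S (fun u => (t u).2) mg.
    rewrite f0 ri in cc; have {cc} := cc isT.
    have tq u : u \in S -> ((t u).2 = u %[mod p ^ (2 * g)])%N by move=> /tP[].
    move=> /(_ tq) cc.
    have {}cc : w i *+ #|[set u in S | meets f i (yc u) m']%SET| <=
        w i * (1 + p%:R * (p ^ (2 * g))%:R * ((f i).2 / p%:R ^- m)).
      by rewrite -[leLHS]mulr_natr ler_wpM2l.
    apply: le_trans cc _; rewrite mulrDr mulr1 lerD //.
      by rewrite /w ge_min lexx.
    rewrite mulrCA -!mulrA ler_wpM2l // ler_wpM2l //.
    have rr : 0 <= (f i).2 / rho by rewrite divr_ge0 // ltW.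
    apply: (@le_trans _ _ ((f i).2 / rho)).
      by rewrite -[leRHS]mul1r ler_wpM2r // /w ge_min lexx orbT.
    rewrite -(ler_pM2r (powR_gt0 s rho0)) divfK ?gt_eqF ?powR_gt0 //.
    rewrite -[in leRHS](divfK (lt0r_neq0 rho0) (f i).2) powRM ?(ltW rho0) //.
    rewrite ler_wpM2r ?powR_ge0 //.
    have [->|r0] := eqVneq ((f i).2 / rho) 0; first exact: powR_ge0.
    apply: ger1_powR; last exact: ltW.
    by rewrite lt0r r0 rr ler_pdivrMr // mul1r ltW.
  have : (q%:R : R) <= 8 * #|S|%:R by rewrite -natrM ler_nat.
  apply/negP; rewrite -ltNge -ltr_pdivlMl //.
  apply: le_lt_trans S_le _; apply: le_lt_trans mass _.
  rewrite big_split /= -mulr_suml -mulr_sumr -mulr_suml.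
  have ltm := lt M.
  apply: (@le_lt_trans _ _ (rho `^ s / rho' `^ s + q%:R / 16)).
    apply: lerD.
      rewrite ler_pdivrMr // /c mulrCA mulrC; apply: le_trans ltm _.
      by rewrite divfK ?gt_eqF ?powR_gt0 // mulrC.
    rewrite mulrA ler_pdivrMr ?powR_gt0 //.
    apply: le_trans (ler_wpM2l _ ltm) _; first by rewrite mulr_ge0.
    rewrite thE le_eqVlt; apply/orP; left; apply/eqP.
    by field; rewrite gt_eqF.
  have -> : 8^-1 * q%:R = q%:R / 16 + q%:R / 16 :> R by field.
  by rewrite ltrD2r ltr_pdivrMr ?powR_gt0 // mulrC.
have [/andP[b0 bh] ch bw tl tu] := tP u uS.
exists (yc u), m', ((t u).1.1 * y + p ^ m * (t u).1.2)%N, (t u).1.1, (2 * p ^ (m + g))%N.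
have p1 := prime_gt1 p_pr.
have pg : (p ^ g <= 2 * p ^ (m + g))%N.
  by rewrite expnD mulnA leq_pmull // muln_gt0 expn_gt0 (prime_gt0 p_pr).
split=> //.
- split=> //; by rewrite /yc addnC mulnC modnMDl.
- rewrite /yc; have -> : (p ^ m' = p ^ m * p ^ dm)%N by rewrite -expnD subnKC // ltnW.
  apply: leq_trans (_ : p ^ m + p ^ m * (t u).2 <= _)%N; first by rewrite ltn_add2r.
  by rewrite -mulnS leq_mul2l tl orbT.
- split=> //; first by apply: leq_trans pg.
    exact: leq_trans bh pg.
  rewrite mul2n -addnn; apply: leq_add; rewrite expnD; last exact: leq_mul.
  by rewrite mulnC leq_mul // ltnW.
move=> xi xiu.
apply: (@le_trans _ _ rho').
  have -> : (t u).1.1%:R * xi - ((t u).1.1 * y + p ^ m * (t u).1.2)%:R =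
    (t u).1.1%:R * (xi - (yc u)%:R) +
      p%:R ^+ m * (((t u).1.1 * (t u).2)%:R - (t u).1.2%:R) :> Qp.
    by rewrite /yc !natrD !natrM !natrX; ring.
  apply: padic_absD_le.
    rewrite mulrC; apply: padic_absM_le; rewrite ?(ltW rho'0) //.
    exact: (@padic_abs_int R p p_pr (t u).1.1).
  rewrite padic_absM padic_absX padic_abs_p.
  have -> : rho' = p%:R ^- m * p%:R ^- dm.
    by rewrite /rho' -invfM -exprD subnKC // ltnW.
  by rewrite exprVn ler_wpM2l ?(ltW rho0) // padic_abs_natB; apply/eqP.
rewrite powRN lef_pV2 ?posrE ?exprn_gt0 ?powR_gt0 //; last first.
  by rewrite ltr0n muln_gt0 expn_gt0 (prime_gt0 p_pr).
apply: (@le_trans _ _ ((p%:R `^ (m + g + 1)%N%:R) `^ T')).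
  rewrite ge0_ler_powR ?nnegrE ?powR_ge0 // powR_mulrn ?(ltW pR_gt0) // -natrX ler_nat.
  by rewrite addn1 expnS leq_mul2r prime_gt1 // orbT.
rewrite -powRrM -(powR_mulrn m' (ltW pR_gt0)); apply: ppowR_le => //.
by rewrite mulrC.
Qed.

End LowerStep.

Section NotNull.
Variables (R : realType) (p : nat) (p_pr : prime p).
Local Notation Qp := (@Qp R p p_pr).
Local Notation abs := (@padic_abs R p p_pr).

Definition rational_approximations (T : R) (xi : Qp) : Prop :=
  forall (T' : R) (H0 : nat), T' < T -> exists a b H : nat,
    [/\ (0 < b)%N, (H0 <= H)%N, (b <= H)%N, (a <= H)%N &
        abs (b%:R * xi - a%:R) <= H%:R `^ (- T')].

(** Nested light balls shrink to a point [xi]. If a ball of the cover contained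
    [xi], it would meet all of them, whereas its mass exceeds that of the small
    ones, which are light. *)
Lemma rational_approximations_escape (s : R) (f : nat -> Qp * R) : 0 < s < 1 ->
  (forall i, 0 <= (f i).2) ->
  (forall N, \sum_(i < N) (f i).2 `^ s <= (16 * p%:R)^-1) ->
  exists2 xi : Qp, abs xi <= 1 /\ rational_approximations (2 / s) xi &
    forall i, ~ abs (xi - (f i).1) < (f i).2.
Proof.
move=> s01 f0 fs; have /andP[s0 s1] := s01; pose theta : R := (16 * p%:R)^-1.
have p0 : 0 < p%:R :> R by rewrite ltr0n prime_gt0.
have T0 : 0 < 2 / s by rewrite divr_gt0.
have thE : theta = (16 * p%:R)^-1 by [].
have th1 : theta <= 1.
  by rewrite /theta invf_le1 ?mulr_gt0 // -natrM ler1n muln_gt0 (prime_gt0 p_pr).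
(* The exponents demanded at successive steps increase to [2 / s]. *)
pose T_ (k : nat) := Num.max 0 (2 / s - k.+1%:R^-1).
have T_P k : 0 <= T_ k < 2 / s.
  by rewrite /T_ le_max lexx gt_max T0 /= gtrBl invr_gt0 ltr0n.
pose good (z : nat * nat) := (z.1 < p ^ z.2)%N /\ light s theta f z.1 z.2.
have ex (kz : nat * (nat * nat)) : exists w : (nat * nat) * (nat * nat * nat),
    good kz.2 -> [/\ (kz.2.2 < w.1.2)%N /\ w.1.1 = kz.2.1 %[mod p ^ kz.2.2],
        good w.1,
        [/\ (0 < w.2.1.2)%N, (kz.1 <= w.2.2)%N, (w.2.1.2 <= w.2.2)%N & (w.2.1.1 <= w.2.2)%N] &
        forall xi : Qp, abs (xi - w.1.1%:R) <= p%:R ^- w.1.2 ->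
          abs (w.2.1.2%:R * xi - w.2.1.1%:R) <= w.2.2%:R `^ (- T_ kz.1)].
  have [[yl lt]|ng] := pselect (good kz.2); last by exists ((0, 0), (0, 0, 0))%N.
  have [y' [m' [a [b [H [h1 h2 h3 h4 h5]]]]]] :=
    @lower_step R p p_pr s theta _ f _ _ kz.1 s01 thE (T_P kz.1) f0 yl lt.
  by exists ((y', m'), (a, b, H)).
have [F FP] := choice ex.
pose st k := iteri k (fun j z => (F (j, z)).1) (0, 0)%N.
have st_good k : good (st k).
  elim: k => [|k IH]; last by have [] := FP (k, st k) IH.
  split=> //= M; rewrite expr0 invr1 powR1 mulr1; apply: le_trans (fs M).
  rewrite big_mkcond; apply: ler_sum => i _; case: ifP => // _; exact: powR_ge0.
have stP k := FP (k, st k) (st_good k).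
have [||xi xiP] := @padic_nested R p p_pr (fun k => (st k).1) (fun k => (st k).2).
- by move=> k; have [[]] := stP k.
- by move=> k; have [[]] := stP k.
have mk k : (k <= (st k).2)%N.
  by elim: k => // k IH; apply: leq_ltn_trans IH _; have [[]] := stP k.
exists xi; first split.
- rewrite -(subrK (st 0).1%:R xi); apply: padic_absD_le.
    by apply: le_trans (xiP 0%N) _; rewrite ppow_le1.
  exact: (@padic_abs_int R p p_pr (st 0%N).1).
- move=> T' H0 TT.
  pose k := maxn H0 (Num.truncn (2 / s - T')^-1).
  have dT : 0 < 2 / s - T' by rewrite subr_gt0.
  have kT : T' <= T_ k.
    rewrite le_max; apply/orP; right; rewrite lerBrDr addrC -lerBrDr.
    rewrite invf_ple ?posrE // (le_trans (ltW (truncnS_gt _))) // ler_nat ltnS leq_maxr //.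
  have [_ _ [b0 kH bH aH] app] := stP k; move: app (xiP k.+1) => /[apply] app.
  exists (F (k, st k)).2.1.1, (F (k, st k)).2.1.2, (F (k, st k)).2.2; split=> //.
    exact: leq_trans (leq_maxl _ _) kH.
  apply: le_trans app _; rewrite ler_powR ?lerN2 // ler1n; exact: leq_trans bH.
move=> i xi_i.
have r0 : 0 < (f i).2 := le_lt_trans (padic_abs_ge0 _) xi_i.
have [k kr] := @ppow_small R p p_pr _ r0.
have [_ /(_ i.+1)] := st_good k; apply/negP; rewrite -ltNge.
apply: (@lt_le_trans _ _ ((f i).2 `^ s)).
  apply: (@le_lt_trans _ _ ((p%:R ^- (st k).2) `^ s)).
    by rewrite ler_piMl ?powR_ge0.
  rewrite gt0_ltr_powR ?nnegrE ?(ltW r0) ?invr_ge0 ?exprn_ge0 ?(ltW p0) //.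
  by apply: le_lt_trans kr; exact: ppow_le.
rewrite (bigD1 (Ordinal (ltnSn i))) /=; last by apply/asboolP; exists xi.
by rewrite lerDl; apply: sumr_ge0 => j _; exact: powR_ge0.
Qed.

Lemma rational_approximations_not_null (s : R) (E : set Qp) : 0 < s < 1 ->
  null_set s E ->
  exists xi : Qp, [/\ abs xi <= 1, rational_approximations (2 / s) xi & ~ E xi].
Proof.
move=> s01 nE.
have p0 : 0 < p%:R :> R by rewrite ltr0n prime_gt0.
have [|f [f0 fs fE]] := nE (16 * p%:R)^-1; first by rewrite invr_gt0 mulr_gt0.
have [xi [x1 xr] xf] := rational_approximations_escape s01 f0 fs.
by exists xi; split=> // /fE[i /xf].
Qed.

End NotNull.

(** * Algebraic numbers *)

Lemma finite_roots (F : fieldType) (P : {poly F}) : P != 0 ->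
  exists l : seq F, forall x, root P x -> x \in l.
Proof.
have [n] := ubnP (size P); elim: n P => // n IH P Pn P0.
have [[a Pa]|nr] := pselect (exists a, root P a); last first.
  by exists [::] => x Px; case: nr; exists x.
have /factor_theorem[Q PQ] := Pa.
have Q0 : Q != 0 by apply: contraNneq P0 => Q0; rewrite PQ Q0 mul0r.
have [|l lP] := IH Q _ Q0.
  by move: Pn; rewrite PQ size_Mmonic ?monicXsubC // size_XsubC addn2.
exists (a :: l) => x; rewrite PQ rootM root_XsubC inE => /orP[/lP->|->] //.
by rewrite orbT.
Qed.

Section Algebraic.
Variables (R : realType) (p : nat) (p_pr : prime p).
Local Notation Qp := (@Qp R p p_pr).

Lemma algebraic_countable : exists g : nat -> Qp,
  forall xi, ~ transcendental_padic xi -> exists i, xi = g i.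
Proof.
have ex (P : {poly rat}) : exists l : seq Qp, P != 0 ->
    forall x, root (map_poly ratr P) x -> x \in l.
  have [->|P0] := eqVneq P 0; first by exists [::].
  have nz : map_poly (ratr : rat -> Qp) P != 0.
    rewrite map_poly_eq0_id0 //; apply: contraNneq P0 => /(congr1 (@padic_abs R p p_pr)).
    by rewrite padic_abs_ratr padic_abs0 => /eqP; rewrite padic_absq_eq0 // lead_coef_eq0.
  by have [l lP] := finite_roots nz; exists l.
have [l lP] := choice ex.
exists (fun k => if pickle_inv k is Some Pi then (l Pi.1)`_(Pi.2) else 0) => xi.
rewrite /transcendental_padic => /contrapT[P P0 /(lP P P0) xl].
by exists (pickle (P, index xi (l P))); rewrite pickleK_inv /= nth_index.
Qed.

Lemma null_algebraic (s : R) : 0 < s -> null_set s [set xi : Qp | ~ transcendental_padic xi].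
Proof.
move=> s0; have [g gP] := algebraic_countable.
by apply: null_set_sub (null_countable g s0); exact: gP.
Qed.

End Algebraic.

(** * Exponents of points with good rational approximations *)

Section Exponents.
Variables (R : realType) (p : nat) (p_pr : prime p).
Local Notation Qp := (@Qp R p p_pr).
Local Notation abs := (@padic_abs R p p_pr).

Lemma padic_absXB_le (u v : Qp) k : abs u <= 1 -> abs v <= 1 ->
  abs (u ^+ k - v ^+ k) <= abs (u - v).
Proof.
move=> u1 v1; elim: k => [|k IH]; first by rewrite subrr padic_abs0 padic_abs_ge0.
have -> : u ^+ k.+1 - v ^+ k.+1 = (u ^+ k - v ^+ k) * u + (u - v) * v ^+ k.
  by rewrite !exprS; ring.
apply: padic_absD_le; first by apply: padic_absM_le => //; exact: padic_abs_ge0.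
apply: padic_absM_le => //; first exact: padic_abs_ge0.
by rewrite padic_absX exprn_ile1 // padic_abs_ge0.
Qed.

Lemma transcendental_linear (xi : Qp) (a b : int) : b != 0 ->
  transcendental_padic xi -> b%:~R * xi - a%:~R != 0.
Proof.
move=> b0 tr; apply/negP => /eqP e; apply: tr.
pose P : {poly rat} := b%:~R *: 'X - a%:~R%:P.
have P1 : P`_1 = b%:~R by rewrite !(coefE, coefD, coefN) /= mulr1 subr0.
have P0 : P`_0 = - a%:~R by rewrite !(coefE, coefD, coefN) /= mulr0 sub0r.
exists P; first by apply: contraNneq b0 => PE; move: P1; rewrite PE coef0 => /esym/eqP; rewrite intr_eq0.
have sP : (size (map_poly (ratr : rat -> Qp) P) <= 2)%N.
  apply: leq_trans (size_poly _ _) _; apply: leq_trans (size_polyD _ _) _.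
  rewrite size_polyN geq_max (leq_trans (size_polyC_leq1 _)) // andbT.
  by rewrite (leq_trans (size_scale_leq _ _)) // size_polyX.
have r0 : ratr 0 = 0 :> Qp by exact: (@ratr_nat Qp 0).
rewrite /root (horner_coef_wide _ sP) !big_ord_recl big_ord0 !coef_map_id0 //=.
rewrite P0 P1 -mulrNz !ratr_int expr0 mulr1 expr1 addr0 addrC mulrNz.
exact/eqP.
Qed.

Lemma approximable_weaken n (xi : Qp) (lam lam' : R) : lam' <= lam ->
  padic_approximable n xi lam -> padic_approximable n xi lam'.
Proof.
move=> ll appr X0; have [X] := appr (Num.max 1 X0).
rewrite ge_max => /andP[X1 XX] [x [xX /andP[x0 xe]]]; exists X => //; exists x.
by split=> //; rewrite x0 (le_trans xe) // ler_powR // lerD2r lerN2.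
Qed.

(** Take [x_i = b^(n-i) a^i]: the height is at most [H^n] and the errors are at most
    [|b xi - a|], by [padic_absXB_le]. *)
Lemma rational_approximable n (xi : Qp) (lam lam' : R) : (0 < n)%N -> abs xi <= 1 ->
  transcendental_padic xi -> rational_approximations (n%:R * (1 + lam)) xi ->
  lam' < lam -> padic_approximable n xi lam'.
Proof.
case: n => // n _ x1 tr ra ll X0.
have n0 : 0 < n.+1%:R :> R by rewrite ltr0n.
have [|a [b [H [b0 HX bH aH app]]]] := ra (n.+1%:R * (1 + lam')) (Num.truncn X0).+1.
  by rewrite ltr_pM2l // ltrD2l.
have H0 : (0 < H)%N := leq_trans b0 bH.
exists (H ^ n.+1)%:R.
  apply: le_trans (ltW (truncnS_gt _)) _; rewrite ler_nat; apply: leq_trans HX _.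
  by rewrite -{1}(expn1 H) leq_pexp2l.
pose x (i : 'I_n.+2) : int := (b ^ (n.+1 - i) * a ^ i)%N.
exists x; split.
  rewrite -[X in _ <= X]/((H ^ n.+1)%N%:Z%:~R) ler_int; apply: bigmax_le => // i _.
  rewrite /x ger0_norm // lez_nat; have -> : (H ^ n.+1 = H ^ (n.+1 - i) * H ^ i)%N.
    by rewrite -expnD subnK // -ltnS.
  by apply: leq_mul; [case: (_ - i)%N|case: (i : nat)] => // k; rewrite leq_exp2r.
have bx : abs (b%:R * xi) <= 1.
  by apply: padic_absM_le1 => //; exact: (@padic_abs_int R p p_pr b).
have termE (m : 'I_n.+1) : (x ord0)%:~R * xi ^+ m.+1 - (x (lift ord0 m))%:~R =
    ((b%:R * xi) ^+ m.+1 - a%:R ^+ m.+1) * b%:R ^+ (n - m) :> Qp.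
  have -> : x ord0 = (b ^ (n - m) * b ^ m.+1)%N :> int.
    by rewrite /x expn0 muln1 subn0 -expnD addnS subnK // -ltnS.
  rewrite /x lift0 subSS -!pmulrn !natrM !natrX exprMn; ring.
apply/andP; split.
  apply: (@lt_le_trans _ _ (abs ((x ord0)%:~R * xi ^+ (ord0 : 'I_n.+1).+1 - (x (lift ord0 ord0))%:~R))).
    rewrite termE !expr1 padic_abs_gt0 // mulf_neq0 // ?expf_neq0 //.
      by have := @transcendental_linear xi a b _ tr; apply; rewrite -lt0n.
    rewrite -padic_abs_eq0 -[b%:R]/(b%:Z%:~R) padic_abs_intE -?lt0n // gt_eqF //.
    exact: ppow_gt0.
  exact: (le_bigmax _ (fun m : 'I_n.+1 => abs ((x ord0)%:~R * xi ^+ m.+1 - (x (lift ord0 m))%:~R)) ord0).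
have He : (H ^ n.+1)%:R `^ (- lam' - 1) = H%:R `^ (- (n.+1%:R * (1 + lam'))) :> R.
  by rewrite natrX -powR_mulrn // -powRrM; congr (_ `^ _); ring.
rewrite He; apply: bigmax_le => [|m _]; first exact: powR_ge0.
rewrite termE; apply: padic_absM_le; first exact: powR_ge0.
  apply: le_trans app; apply: padic_absXB_le => //.
  exact: (@padic_abs_int R p p_pr a).
by rewrite padic_absX exprn_ile1 ?padic_abs_ge0 // (@padic_abs_int R p p_pr b).
Qed.

Lemma lambda_exp_ge n (xi : Qp) (lam : R) :
  (forall lam', lam' < lam -> padic_approximable n xi lam') ->
  (lam%:E <= lambda_exp n xi)%E.
Proof.
move=> H; apply/lee_addgt0Pr => e e0; rewrite -leeBlDr // -EFinB.
apply: ereal_sup_ubound; exists (lam - e) => //.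
by apply: H; rewrite gtrBl.
Qed.

Lemma lambda_exp_gt n (xi : Qp) (lam : R) : (lam%:E < lambda_exp n xi)%E ->
  exists2 lam', lam < lam' & padic_approximable n xi lam'.
Proof.
move=> /ereal_sup_gt[_ [lam' appr <-]]; rewrite lte_fin => ll.
by exists lam'.
Qed.

End Exponents.

(** * Spectrum and dimension *)

Section Infinite.
Variables (R : realType) (p : nat) (p_pr : prime p).
Local Notation Qp := (@Qp R p p_pr).
Local Notation abs := (@padic_abs R p p_pr).

(** A limit of integers [a_k < p^(m_k)] such that [a_(k+1)] is [a_k] or
    [a_k + p^(m_k)] and [m_(k+1) = (k + 1) (m_k + 1)]. At each stage one of the two
    choices is far from the [k]-th algebraic number. *)
Lemma exists_lambda_exp_oo n : (0 < n)%N ->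
  exists2 xi : Qp, transcendental_padic xi & lambda_exp n xi = +oo%E.
Proof.
move=> n0; have [g gP] := algebraic_countable R p_pr.
have ex (kz : nat * (nat * nat)) : exists a : nat,
    [/\ a = kz.2.1 %[mod p ^ kz.2.2], (a <= kz.2.1 + p ^ kz.2.2)%N &
        ~ abs (g kz.1 - a%:R) <= p%:R ^- kz.2.2.+1].
  move: kz => [k [a m]] /=.
  have [ga|] := pselect (abs (g k - a%:R) <= p%:R ^- m.+1); last first.
    by exists a; split=> //; rewrite leq_addr.
  exists (a + p ^ m)%N; split=> //; first by rewrite modnDr.
  move=> ga'; have : abs ((a + p ^ m)%:R - a%:R) <= p%:R ^- m.+1.
    rewrite (_ : _ - _ = (g k - a%:R) - (g k - (a + p ^ m)%:R)); last by ring.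
    exact: padic_absB_le.
  by rewrite natrD addrAC subrr add0r natrX padic_abs_ppow leNgt (ppow_lt R p_pr) ltnS leqnn.
have [F FP] := choice ex.
pose st k := iteri k (fun j z => (F (j, z), j.+1 * z.2.+1)%N) (0, 0)%N.
have stS k : st k.+1 = (F (k, st k), k.+1 * (st k).2.+1)%N by [].
have mS k : ((st k).2 < (st k.+1).2)%N by rewrite stS /= leq_pmull.
have mk k : (k <= (st k).2)%N by elim: k => // k IH; exact: leq_ltn_trans (mS k).
have stP k := FP (k, st k).
have lt_st k : ((st k).1 < p ^ (st k).2)%N.
  elim: k => [|k IH]; first by rewrite expn0.
  have [_ le _] := stP k; apply: leq_ltn_trans le _.
  apply: (@leq_trans (p ^ (st k).2.+1)).
    rewrite /= (@leq_trans (2 * p ^ (st k).2)) //.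
      by rewrite mul2n -addnn ltn_add2r.
    by rewrite expnS leq_mul2r prime_gt1 // orbT.
  by rewrite leq_exp2l ?prime_gt1 // mS.
have [||xi xiP] := @padic_nested R p p_pr (fun k => (st k).1) (fun k => (st k).2).
- exact: mS.
- by move=> k; have [] := stP k.
have tr : transcendental_padic xi.
  apply: contrapT => /gP[k xk]; have [_ _] := stP k; apply; rewrite -xk.
  apply: le_trans (xiP k.+1) _; apply: ppow_le => //; exact: mS.
have x1 : abs xi <= 1.
  by have := xiP 0%N; rewrite /st /= subr0 expr0 invr1.
exists xi => //; apply/eqyP => lam _; apply: lambda_exp_ge => lam' ll.
apply: rational_approximable ll => // T' H0 _.
pose k := maxn H0 (Num.truncn T'); pose H := (p ^ (st k).2.+1)%N.
have kH : (k < H)%N by apply: leq_ltn_trans (mk k) _; exact/ltnW/ltn_expl/prime_gt1.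
exists (st k.+1).1, 1%N, H; split=> //.
- exact: leq_trans (leq_maxl _ _) (ltnW kH).
- exact: leq_ltn_trans kH.
- have [_ le _] := stP k; apply: leq_trans le _.
  apply: (@leq_trans (2 * p ^ (st k).2)).
    rewrite mul2n -addnn leq_add2r; exact/ltnW/lt_st.
  by rewrite /H expnS leq_mul2r prime_gt1 // orbT.
rewrite mul1r; apply: le_trans (xiP k.+1) _.
have H1 : 1 <= H%:R :> R by rewrite ler1n; exact: leq_ltn_trans kH.
apply: (@le_trans _ _ (H%:R `^ (- k.+1%:R))).
  by rewrite powR_invn ?ler0n // /H natrX -exprM mulnC.
rewrite ler_powR // lerN2 (le_trans (ltW (truncnS_gt _))) // ler_nat ltnS leq_maxr //.
Qed.

End Infinite.

Section Dimension.
Variables (R : realType) (p : nat) (p_pr : prime p).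
Local Notation Qp := (@Qp R p p_pr).

Section Level.
Variables (n : nat) (lam : R).
Hypotheses (n3 : (3 <= n)%N) (hl : (n%:R + 4) / (3 * n%:R) <= lam).
Local Notation dim := (2 / (n%:R * (1 + lam))).

Lemma expected_dim : 0 < dim < 1.
Proof.
have n3R : 3 <= n%:R :> R by rewrite ler_nat.
have n0 : 0 < n%:R :> R by apply: lt_le_trans n3R.
have : n%:R + 4 <= lam * (3 * n%:R) by rewrite -ler_pdivrMr // mulr_gt0.
move=> h; have T2 : 2 < n%:R * (1 + lam) by lra.
have T0 : 0 < n%:R * (1 + lam) by apply: lt_trans T2.
by rewrite divr_gt0 // ltr_pdivrMr // mul1r.
Qed.

Lemma null_exceeding : null_set dim [set xi : Qp | (lam%:E < lambda_exp n xi)%E].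
Proof.
have /andP[d0 d1] := expected_dim.
have n0 : 0 < n%:R :> R by rewrite ltr0n (leq_trans _ n3).
have T0 : 0 < n%:R * (1 + lam) by move: d0; rewrite pmulr_rgt0 // invr_gt0.
pose l (j : nat) := lam + j.+1%:R^-1.
have ll j : lam < l j by rewrite ltrDl invr_gt0.
apply: null_set_sub (null_bigU (E := fun j => [set xi | padic_approximable n xi (l j)])
    (lt0r_neq0 d0) _).
  move=> xi /lambda_exp_gt[lam' lt appr].
  have d : 0 < lam' - lam by rewrite subr_gt0.
  exists (Num.truncn (lam' - lam)^-1); apply: approximable_weaken appr.
  rewrite -lerBrDl invf_ple ?posrE //; exact: ltW (truncnS_gt _).
move=> j; have [|||lam' ltl] := @approximable_null R p p_pr n (l j) dim n3.
- exact: le_trans hl (ltW (ll j)).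
- have l1 : n%:R * (1 + lam) < n%:R * (1 + l j) by rewrite ltr_pM2l // ltrD2l.
  by rewrite ltr_pM2l // ltf_pV2 // posrE // (lt_trans T0).
- exact: ltW.
by apply: null_set_sub => xi; apply: approximable_weaken; exact: ltW.
Qed.

(** The points of [rational_approximations (n (1 + lam))] do not form a null set, so
    they are not contained in the union of [E], of the points with larger exponent
    and of the algebraic numbers. *)
Lemma exists_lambda_exp (E : set Qp) : null_set dim E ->
  exists xi : Qp, [/\ transcendental_padic xi, lambda_exp n xi = lam%:E & ~ E xi].
Proof.
move=> nE; have d01 := expected_dim; have /andP[d0 d1] := d01.
have dN0 := lt0r_neq0 d0.
have nU := null_setU dN0 (null_setU dN0 nE null_exceeding) (@null_algebraic R p p_pr _ d0).
have [xi [x1 ra nx]] := rational_approximations_not_null d01 nU.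
have tr : transcendental_padic xi by apply: contrapT => h; apply: nx; right.
have ge : (lam%:E <= lambda_exp n xi)%E.
  apply: lambda_exp_ge => lam' ll; apply: rational_approximable ll => //.
    exact: leq_trans n3.
  by move: ra; rewrite invf_div mulrCA divff // mulr1.
exists xi; split=> //; last by move=> Ex; apply: nx; left; left.
apply/eqP; rewrite eq_le ge andbT leNgt; apply/negP => gt.
by apply: nx; left; right.
Qed.

Lemma lambda_exp_dim :
  hausdorff_dim [set xi : Qp | lambda_exp n xi = lam%:E] = dim%:E.
Proof.
have /andP[d0 d1] := expected_dim.
apply/eqP; rewrite eq_le; apply/andP; split.
  apply/lee_addgt0Pr => e e0.
  pose s := Num.min (dim + e) 1.
  have ds : dim < s by rewrite lt_min ltrDl e0.
  have [|lam' ll nl] := @approximable_null R p p_pr n lam s n3 hl ds.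
    by rewrite ge_min lexx orbT.
  have s0 : 0 < s := lt_trans d0 ds.
  apply: (@le_trans _ _ s%:E); last by rewrite -EFinD lee_fin ge_min lexx.
  apply: ereal_inf_lbound; exists s => //; split; first exact: ltW.
  apply: hausdorff_null => //; apply: null_set_sub nl => xi /= xiE.
  have [|lam'' lt] := @lambda_exp_gt R p p_pr n xi lam'; first by rewrite xiE lte_fin.
  by apply: approximable_weaken; exact: ltW.
apply: le_ereal_inf_tmp => _ [s [s0 ms] <-]; rewrite lee_fin leNgt; apply/negP => sd.
have nA : null_set dim [set xi : Qp | lambda_exp n xi = lam%:E].
  by apply: (@null_hausdorff R p p_pr s) => //; rewrite s0 ltW.
by have [xi [_ xiE]] := exists_lambda_exp nA.
Qed.

End Level.
End Dimension.

Theorem theorem2p2 (R : realType) (p : nat) (p_pr : prime p) :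
  (forall n : nat, (3 <= n)%N ->
     [set l : \bar R | (((n%:R + 4) / (3 * n%:R))%:E <= l <= +oo)%E]
       `<=` lambda_spectrum R p_pr n /\
     (forall lambda : R, (n%:R + 4) / (3 * n%:R) <= lambda ->
        hausdorff_dim [set xi : Qp R p_pr | lambda_exp n xi = lambda%:E] =
          (2 / (n%:R * (1 + lambda)))%:E)) /\
  (forall lambda : R, 1 / 3 < lambda ->
     exists n0 : nat, forall n : nat, (n0 < n)%N ->
       hausdorff_dim [set xi : Qp R p_pr | lambda_exp n xi = lambda%:E] =
         (2 / (n%:R * (1 + lambda)))%:E).
Proof.
split=> [n n3|lam lam3].
  split=> [l /andP[+ _]|lam hl]; last exact: lambda_exp_dim.
  case: l => [lam| |] hl.
  - have h0 : null_set (2 / (n%:R * (1 + lam))) (set0 : set (Qp R p_pr)).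
      apply: null_set_sub (null_exceeding p_pr n3 hl).
      exact: sub0set.
    by have [xi [tr xiE _]] := exists_lambda_exp n3 hl h0; exists xi.
  - have [|xi tr xiE] := @exists_lambda_exp_oo R p p_pr n; first exact: leq_trans n3.
    by exists xi.
  - by move: hl; rewrite leeNy_eq.
have d : 0 < 3 * lam - 1 by lra.
exists (maxn 2 (Num.truncn (4 / (3 * lam - 1)))) => n.
rewrite gtn_max => /andP[n3 nn]; apply: lambda_exp_dim => //.
have n0 : 0 < n%:R :> R by rewrite ltr0n (leq_trans _ n3).
rewrite ler_pdivrMr ?mulr_gt0 //.
have : 4 / (3 * lam - 1) <= n%:R.
  by apply: (le_trans (ltW (truncnS_gt _))); rewrite ler_nat.
rewrite ler_pdivrMr //; lra.
Qed.
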